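(* Let $\lambda$ and $\gamma$ be partitions, let $\alpha$ be a composition and let $\mu=sort(\alpha)$ be the partition obtained by sorting the parts of $\alpha$ in weakly decreasing order. Then the coefficient of $\tilde s_\gamma$ in the expansion of $\tilde h_\mu\,\tilde s_\lambda$ in the basis $\{\tilde s_\nu\}_\nu$ equals the number of tableaux $T\in\mathcal{MCT}_\gamma(\lambda,\alpha)$ whose labels are sets containing at most one unbarred letter (and at most one barred letter) and which are lattice tableaux.
   Context: For $\mu\vdash n$, $\Xi_\mu$ is the multiset of $n$ complex numbers consisting, for each part $\mu_i$, of all $\mu_i$-th roots of unity; $f[\Xi_\mu]$ is the evaluation of the symmetric function $f$ at these values (other variables $0$). For a partition $\lambda$, $\tilde s_\lambda$ is the symmetric function characterized by $\tilde s_\lambda[\Xi_\nu]=\chi^{(n-|\lambda|,\lambda)}(\nu)$ for all $n\ge|\lambda|+\lambda_1$, $\nu\vdash n$ ($\chi^\rho$ the irreducible $S_n$-character), and $\tilde h_\lambda$ is characterized by $\tilde h_\lambda[\Xi_\nu]=\langle h_{(n-|\lambda|,\lambda)},p_\nu\rangle$ for all such $n,\nu$ (Hall inner product, $h$ complete homogeneous, $p$ power sums). The $\tilde s_\lambda$ form a basis of the symmetric functions. Tableaux conventions: French notation (row 1 at the bottom). Alphabet $\bar1<\bar2<\cdots<1<2<\cdots$. Multisets over it with at most one barred letter are ordered by reverse lex order: compare largest elements, then second largest, etc.; $M<N$ if at the first difference $M$'s element is smaller, or if all compared agree and $M$ has fewer elements. For a partition $\gamma$ and $r\ge\gamma_1$,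 shape $(r,\gamma)/(\gamma_1)$ has cells $(1,j)$, $\gamma_1<j\le r$, and $(i+1,j)$, $i\ge1$, $1\le j\le\gamma_i$. $\mathcal{MCT}_\gamma(\lambda,\alpha)$ is the set of fillings of some shape $(r,\gamma)/(\gamma_1)$ by nonempty multisets with at most one barred letter each, weakly increasing along rows and strictly increasing up columns in reverse lex order, with multiset union of labels $\{\bar1^{\lambda_1},\bar2^{\lambda_2},\ldots,1^{\alpha_1},2^{\alpha_2},\ldots\}$, and with no row-1 cell labeled only by a barred letter. Reading order: bottom row to top row, right to left within rows. For a multiset $S$ of unbarred letters, $read(T|_S)$ is the word of barred letters $\bar j$ (in reading order) of cells labeled $\{\bar j\}\cup S$; $read(T|_-)$ is the case $S=\emptyset$. With $S_1<\cdots<S_d$ the distinct nonempty unbarred parts of labels of $T$, $T$ is a lattice tableau if $read(T|_-)read(T|_{S_1})\cdots read(T|_{S_d})$ (reading $\bar j$ as $j$) is lattice: every prefix has at least as many $j$'s as $(j+1)$'s for all $j\ge1$. *)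

(* Defs.v *)
From HB Require Import structures.
From mathcomp Require Import all_boot all_order all_fingroup all_algebra.
From mathcomp Require Import all_solvable all_field all_character.
From mathcomp Require Import finmap mpoly.
From mathcomp Require Import boolp.

Set Implicit Arguments.
Unset Strict Implicit.
Unset Printing Implicit Defensive.

Import Order.TTheory GRing.Theory Num.Theory.

Local Open Scope ring_scope.

Definition is_part (s : seq nat) : bool := sorted geq s && (0%N \notin s).

Record intpart := IntPart { part_val :> seq nat; _ : is_part part_val }.
HB.instance Definition _ := [isSub for part_val].
HB.instance Definition _ := [Choice of intpart by <:].

Definition conj_part (s : seq nat) : seq nat :=
  mkseq (fun j => count (leq j.+1) s) (head 0%N s).

(* Symmetric functions over algC: the projective limit, in the category of
   graded rings, of the rings of symmetric polynomials in n variables, the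
   transition maps setting the last variable to 0. *)

Definition kill_last n (p : {mpoly algC[n.+1]}) : {mpoly algC[n]} :=
  p \mPo [tuple of rcons [tuple 'X_i | i < n] 0].

Definition sf_axiom (F : forall n, {mpoly algC[n]}) : Prop :=
  [/\ forall n, F n \is symmetric,
      forall n, kill_last (F n.+1) = F n
    & exists d, forall n, (msize (F n) <= d)%N].

Record symfun := SymFun {
  sf_poly :> forall n, {mpoly algC[n]};
  sf_poly_axiom : sf_axiom sf_poly
}.

HB.instance Definition _ := gen_eqMixin symfun.
HB.instance Definition _ := gen_choiceMixin symfun.

Lemma sf_ext (f g : symfun) : (forall n, f n = g n) -> f = g.
Proof.
case: f g => [f fP] [g gP] /= fg.
have E : f = g by apply: functional_extensionality_dep.
by subst g; congr SymFun; apply: Prop_irrelevance.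
Qed.

Fact sf_zero_subproof : sf_axiom (fun=> 0).
Proof.
split=> [n|n|]; [exact: rpred0|exact: comp_mpoly0|].
by exists 0%N => n; rewrite msize0.
Qed.
Definition sf_zero := SymFun sf_zero_subproof.

Fact sf_one_subproof : sf_axiom (fun=> 1).
Proof.
split=> [n|n|]; [exact: rpred1|exact: comp_mpoly1|].
by exists 1%N => n; rewrite msize1.
Qed.
Definition sf_one := SymFun sf_one_subproof.

Fact sf_opp_subproof (f : symfun) : sf_axiom (fun n => - f n).
Proof.
case: f => f [f1 f2 [d f3]] /=; split=> [n|n|].
- by rewrite rpredN f1.
- by rewrite /kill_last comp_mpolyN -(f2 n).
- by exists d => n; rewrite -scaleN1r (leq_trans (msizeZ_le _ _)).
Qed.
Definition sf_opp f := SymFun (sf_opp_subproof f).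

Fact sf_add_subproof (f g : symfun) : sf_axiom (fun n => f n + g n).
Proof.
case: f g => f [f1 f2 [d f3]] [g [g1 g2 [e g3]]] /=; split=> [n|n|].
- by rewrite rpredD ?f1 ?g1.
- by rewrite /kill_last comp_mpolyD -(f2 n) -(g2 n).
- exists (maxn d e) => n; rewrite (leq_trans (msizeD_le _ _)) //.
  by rewrite geq_max !leq_max f3 g3 orbT.
Qed.
Definition sf_add f g := SymFun (sf_add_subproof f g).

Fact sf_mul_subproof (f g : symfun) : sf_axiom (fun n => f n * g n).
Proof.
case: f g => f [f1 f2 [d f3]] [g [g1 g2 [e g3]]] /=; split=> [n|n|].
- by rewrite rpredM ?f1 ?g1.
- by rewrite /kill_last rmorphM -(f2 n) -(g2 n).
- exists (d + e).+1 => n; rewrite (leq_trans (msizeM_le _ _)) //.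
  by rewrite ltnS leq_add.
Qed.
Definition sf_mul f g := SymFun (sf_mul_subproof f g).

Fact sf_scale_subproof (k : algC) (f : symfun) : sf_axiom (fun n => k *: f n).
Proof.
case: f => f [f1 f2 [d f3]] /=; split=> [n|n|].
- by rewrite rpredZ ?f1.
- by rewrite /kill_last comp_mpolyZ -(f2 n).
- by exists d => n; rewrite (leq_trans (msizeZ_le _ _)).
Qed.
Definition sf_scale k f := SymFun (sf_scale_subproof k f).

Fact sf_addA : associative sf_add.
Proof. by move=> f g h; apply: sf_ext => n; rewrite /= addrA. Qed.
Fact sf_addC : commutative sf_add.
Proof. by move=> f g; apply: sf_ext => n; rewrite /= addrC. Qed.
Fact sf_add0 : left_id sf_zero sf_add.
Proof. by move=> f; apply: sf_ext => n; rewrite /= add0r. Qed.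
Fact sf_addN : left_inverse sf_zero sf_opp sf_add.
Proof.
by move=> f; apply: sf_ext => n; rewrite /= addNr.
Qed.
HB.instance Definition _ :=
  GRing.isZmodule.Build symfun sf_addA sf_addC sf_add0 sf_addN.

Fact sf_mulA : associative sf_mul.
Proof. by move=> f g h; apply: sf_ext => n; rewrite /= mulrA. Qed.
Fact sf_mulC : commutative sf_mul.
Proof. by move=> f g; apply: sf_ext => n; rewrite /= mulrC. Qed.
Fact sf_mul1 : left_id sf_one sf_mul.
Proof. by move=> f; apply: sf_ext => n; rewrite /= mul1r. Qed.
Fact sf_mulDl : left_distributive sf_mul sf_add.
Proof.
by move=> f g h; apply: sf_ext => n; rewrite /= mulrDl.
Qed.
Fact sf_one_neq0 : sf_one != 0.
Proof.
apply/eqP => /(congr1 (fun f : symfun => f 0%N)).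
by rewrite /=; apply/eqP; rewrite oner_eq0.
Qed.
HB.instance Definition _ := GRing.Zmodule_isComNzRing.Build symfun
  sf_mulA sf_mulC sf_mul1 sf_mulDl sf_one_neq0.

Fact sf_scaleA a b f : sf_scale a (sf_scale b f) = sf_scale (a * b) f.
Proof. by apply: sf_ext => n; rewrite /= scalerA. Qed.
Fact sf_scale1 : left_id 1 sf_scale.
Proof. by move=> f; apply: sf_ext => n; rewrite /= scale1r. Qed.
Fact sf_scaleDr : right_distributive sf_scale +%R.
Proof.
by move=> a f g; apply: sf_ext => n; rewrite /= scalerDr.
Qed.
Fact sf_scaleDl f : {morph sf_scale^~ f : a b / a + b}.
Proof.
by move=> a b; apply: sf_ext => n; rewrite /= scalerDl.
Qed.
HB.instance Definition _ := GRing.Zmodule_isLmodule.Build algC symfun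
  sf_scaleA sf_scale1 sf_scaleDr sf_scaleDl.

Fact sf_scaleAl (a : algC) (f g : symfun) : a *: (f * g) = (a *: f) * g.
Proof. by apply: sf_ext => n; rewrite /= scalerAl. Qed.
HB.instance Definition _ :=
  GRing.Lmodule_isLalgebra.Build algC symfun sf_scaleAl.
HB.instance Definition _ := GRing.Lalgebra_isComAlgebra.Build algC symfun.

(* [sf_poly f n] is f with all variables but the first n set to 0, so this is
   f evaluated at the entries of X and at 0 for every other variable. *)
Definition sf_eval (f : symfun) (X : seq algC) : algC :=
  (f (size X)).@[fun i : 'I_(size X) => X`_i].

Definition psum_poly k n : {mpoly algC[n]} := \sum_(i < n) 'X_i ^+ k.+1.

Fact psum_subproof k : sf_axiom (psum_poly k).
Proof.
split=> [n|n|].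
- apply/issymP => s; rewrite /psum_poly raddf_sum /=.
  rewrite (reindex_inj (@perm_inj _ s^-1%g)) /=; apply: eq_bigr => i _.
  rewrite rmorphXn /=; congr (_ ^+ _); rewrite msymX; congr 'X_[_].
  apply/mnmP => j; rewrite !mnmE; congr (nat_of_bool _).
  by apply: (inj_eq perm_inj).
- rewrite /psum_poly /kill_last raddf_sum big_ord_recr /=.
  rewrite rmorphXn /= comp_mpolyXU /= nth_rcons size_map size_enum_ord ltnn.
  rewrite eqxx expr0n /= addr0; apply: eq_bigr => i _.
  rewrite rmorphXn /= comp_mpolyXU /= nth_rcons size_map size_enum_ord.
  by rewrite ltn_ord (nth_map i) ?size_enum_ord // nth_ord_enum.
- exists k.+2 => n; rewrite /psum_poly (leq_trans (msize_sum _ _ _)) //.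
  apply/bigmax_leqP_seq => i _ _.
  by rewrite mpolyXn msizeX mdegMn mdeg1 mul1n.
Qed.

(* The power sum of exponent k.+1. *)
Definition psumS k := SymFun (psum_subproof k).

Definition psym (nu : intpart) : symfun := \prod_(k <- nu) psumS k.-1.

Definition monos_poly (P : pred (seq nat)) d n : {mpoly algC[n]} :=
  \sum_(m : 'X_{1..n < d} | P (m : 'X_{1..n})) 'X_[m].

Lemma monos_polyE P d n (m : 'X_{1..n}) :
  (monos_poly P d n)@_m = (P m && (mdeg m < d)%N)%:R.
Proof.
rewrite /monos_poly raddf_sum /=; case: (ltnP (mdeg m) d) => lt_md; last first.
  rewrite andbF big1 // => k _; rewrite mcoeffX.
  by case: eqP => // km; move: (valP k); rewrite /= km ltnNge lt_md.
rewrite andbT; case Pm: (P m).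
  rewrite (bigD1 (BMultinom lt_md)) //= mcoeffX eqxx big1 ?addr0 // => k.
  case/andP=> _ /negbTE; rewrite -val_eqE /= => neq; by rewrite mcoeffX neq.
rewrite big1 // => k Pk; rewrite mcoeffX.
by case: eqP => // km; rewrite km Pm in Pk.
Qed.

Lemma kill_lastX n (m : 'X_{1..n.+1}) (k : 'X_{1..n}) :
  (kill_last 'X_[m])@_k = (m == mnmwiden k)%:R.
Proof.
rewrite /kill_last comp_mpolyX big_ord_recr /= (tnth_nth 0) /= nth_rcons.
rewrite size_map size_enum_ord ltnn eqxx expr0n.
have -> : \prod_(i < n) tnth [tuple of rcons [tuple 'X_j | j < n] 0]
    (widen_ord (leqnSn n) i) ^+ m (widen_ord (leqnSn n) i) =
    'X_[[multinom m (widen_ord (leqnSn n) i) | i < n]] :> {mpoly algC[n]}.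
  rewrite mpolyXE_id; apply: eq_bigr => i _; rewrite mnmE.
  rewrite (tnth_nth 0) /= nth_rcons size_map size_enum_ord ltn_ord.
  by rewrite (nth_map i) ?size_enum_ord // nth_ord_enum.
rewrite mulr_natr mcoeffMn mcoeffX -mulrnA mulnb; congr (nat_of_bool _)%:R.
apply/andP/eqP => [[/eqP E /eqP m0]|->].
  apply/mnmP => i; have [ltin|] := ltnP i n; last first.
    move=> leni; have -> : i = ord_max.
      by apply/val_inj/eqP; rewrite /= eqn_leq leni -ltnS ltn_ord.
    by rewrite mnmwiden_ordmax m0.
  have -> : i = widen_ord (leqnSn n) (Ordinal ltin) by apply: val_inj.
  by rewrite mnmwiden_widen -E mnmE.
rewrite mnmwiden_ordmax; split=> //; apply/eqP/mnmP => i.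
by rewrite mnmE mnmwiden_widen.
Qed.

(* [P], read on exponent vectors, must not depend on the order of the
   variables nor on how many of them are unused. *)
Definition monos_pred (P : pred (seq nat)) :=
  (forall s t, perm_eq s t -> P s = P t) /\ (forall s, P (rcons s 0%N) = P s).

Fact monos_subproof P d : monos_pred P -> sf_axiom (monos_poly P d).
Proof.
case=> Pperm P0; split=> [n|n|].
- apply/issymP => s; apply/mpolyP => m; rewrite mcoeff_sym !monos_polyE.
  have pm : perm_eq [multinom m (s i) | i < n] m.
    apply/tuple_permP; exists s; apply: (@eq_from_nth _ 0%N).
      by rewrite !size_tuple.
    move=> i; rewrite size_tuple => lti.
    by rewrite -!(tnth_nth 0%N _ (Ordinal lti)) !tnth_mktuple.
  congr (nat_of_bool (_ && _))%:R; first exact: Pperm.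
  congr (_ < _)%N; rewrite !mdegE [RHS](reindex_inj (@perm_inj _ s)) /=.
  by apply: eq_bigr => i _; rewrite mnmE.
- apply/mpolyP => k.
  transitivity ((monos_poly P d n.+1)@_(mnmwiden k)).
    rewrite /monos_poly /kill_last (raddf_sum (comp_mpoly _)) !raddf_sum /=.
    by apply: eq_bigr => m _; rewrite kill_lastX mcoeffX.
  rewrite !monos_polyE P0; congr (nat_of_bool (_ && (_ < _)%N))%:R.
  rewrite !mdegE big_ord_recr /= mnmwiden_ordmax addn0.
  by apply: eq_bigr => i _; rewrite mnmwiden_widen.
- exists d => n; rewrite /monos_poly (leq_trans (msize_sum _ _ _)) //.
  by apply/bigmax_leqP_seq => m _ _; rewrite msizeX; apply: valP m.
Qed.

Definition hom_pred k : pred (seq nat) := fun s => sumn s == k.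

Fact hom_predP k : monos_pred (hom_pred k).
Proof.
split=> [s t st|s]; last by rewrite /hom_pred sumn_rcons addn0.
by rewrite /hom_pred; congr (_ == _); apply: perm_sumn.
Qed.

Definition hom k := SymFun (monos_subproof k.+1 (hom_predP k)).

Definition hsym (s : seq nat) : symfun := \prod_(k <- s) hom k.

Definition mono_pred (ka : seq nat) : pred (seq nat) :=
  fun s => perm_eq (filter (leq 1) s) ka.

Fact mono_predP ka : monos_pred (mono_pred ka).
Proof.
split=> [s t st|s]; last by rewrite /mono_pred filter_rcons.
by apply: (permPl _ ka); apply: perm_filter.
Qed.

Definition monomial (ka : intpart) :=
  SymFun (monos_subproof (sumn ka).+1 (mono_predP ka)).

Definition is_hall (B : {bilinear symfun -> symfun -> algC | *%R & *%R}) :=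
  forall ka la : intpart, B (hsym ka) (monomial la) = (ka == la)%:R.

Definition roots_of_unity (d : nat) : seq algC :=
  sval (closed_field_poly_normal ('X^d - 1 : {poly algC})).

Definition Xi (nu : seq nat) : seq algC := flatten (map roots_of_unity nu).

Definition cycle_type n (s : 'S_n) : seq nat :=
  sort geq [seq #|pred_of_set c| | c <- enum (porbits s)].

(* The stabiliser of the partition of 'I_n into consecutive intervals of
   lengths given by rho. *)
Definition young_set n (rho : seq nat) : {set 'S_n} :=
  [set s : 'S_n | [forall i : 'I_n,
    reshape_index rho (s i) == reshape_index rho i]].

Fact young_group_set n rho : group_set (young_set n rho).
Proof.
apply/group_setP; split=> [|s t]; first by rewrite inE; apply/forallP=> i; rewrite perm1.
rewrite !inE => /forallP sP /forallP tP; apply/forallP => i.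
by rewrite permM (eqP (tP _)).
Qed.
Canonical young n rho := Group (young_group_set n rho).

Fact sign_subproof n :
  is_class_fun <<[set: 'S_n]>>%g [ffun s : 'S_n => (-1) ^+ odd_perm s : algC].
Proof.
rewrite genGid; apply: intro_class_fun => [s t _ _|s]; last by rewrite inE.
by rewrite odd_permJ.
Qed.
Definition sign_char n : 'CF([set: 'S_n]) := Cfun 0 (sign_subproof n).

(* The irreducible character labelled by rho is the unique common irreducible
   constituent of the representations of S_n induced from the trivial
   representation of the Young subgroup of rho and from the sign representation
   of the Young subgroup of the conjugate of rho.  The value is 0 when no such
   constituent exists (which does not happen for a partition rho of n). *)
Definition chi n (rho : seq nat) : 'CF([set: 'S_n]) :=
  if [pick i : Iirr [set: 'S_n] |
        (i \in irr_constt ('Ind[[set: 'S_n]] (1 : 'CF(young n rho)))) &&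
        (i \in irr_constt ('Ind[[set: 'S_n]]
                 ('Res[young n (conj_part rho)] (sign_char n))))]
  is Some i then 'chi_i else 0.

(* In the two characterisations, (n - |la|, la) is a partition of n (written
   with a zero part when n = 0, which changes neither side). *)
Definition is_stilde (la : intpart) (f : symfun) : Prop :=
  forall (n : nat) (nu : intpart) (s : 'S_n),
    (sumn la + head 0%N la <= n)%N -> cycle_type s = nu ->
    sf_eval f (Xi nu) = chi n ((n - sumn la)%N :: la) s.

Definition is_htilde (hall : symfun -> symfun -> algC)
    (la : intpart) (f : symfun) : Prop :=
  forall (n : nat) (nu : intpart),
    (sumn la + head 0%N la <= n)%N -> sumn nu = n ->
    sf_eval f (Xi nu) = hall (hsym ((n - sumn la)%N :: la)) (psym nu).

(* [a] is the coefficient of [b ga] in an expansion of [f] as a finite linear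
   combination of the family [b]. *)
Definition coef_in (b : intpart -> symfun) (f : symfun) (ga : intpart)
    (a : algC) : Prop :=
  exists c : {fsfun intpart -> algC with 0},
    f = \sum_(nu <- finsupp c) c nu *: b nu /\ c ga = a.

(* (false, j) is the barred letter j and (true, j) the unbarred letter j, for
   j >= 1, so the lexicographic order on pairs is the order of the alphabet.
   A multiset of letters is the weakly decreasing sequence of its elements; the
   reverse lex order on multisets is the lexicographic order on these sequences
   (a proper prefix being smaller). *)
Definition letter := (bool *l nat)%type.
Definition label := seqlexi letter.

Definition letter_ge : rel letter := fun x y => (y <= x)%O.
Definition label_le : rel label := fun M N => (M <= N)%O.
Definition label_lt : rel label := fun M N => (M < N)%O.

Definition barred (x : letter) : bool := ~~ x.1.
Definition unbarred (x : letter) : bool := x.1.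

Definition is_label (M : label) : bool :=
  [&& M != [::], sorted letter_ge M & (count barred M <= 1)%N].

(* Row 1 (bottom) first, each row from left to right.  The row 1 of the shape
   (r, ga)/(ga_1) is stored without its ga_1 missing cells, so that its length
   is r - ga_1; it has no cell in a common column with the rows above it. *)
Definition tableau := seq (seq label).

Definition letters (b : bool) (al : seq nat) : seq letter :=
  flatten (mkseq (fun i => nseq (nth 0%N al i) ((b, i.+1) : letter)) (size al)).

Record is_mct (ga la al : seq nat) (T : tableau) : Prop := IsMCT {
  mct_nonempty : T != [::];
  mct_shape : shape (behead T) = ga;
  mct_labels : all (all is_label) T;
  mct_rows : all (sorted label_le) T;
  mct_cols : forall i j, (j < nth 0%N ga i.+1)%N ->
    label_lt (nth [::] (nth [::] (behead T) i) j)
             (nth [::] (nth [::] (behead T) i.+1) j);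
  mct_content :
    perm_eq (flatten (flatten T)) (letters false la ++ letters true al);
  mct_row1 : all (has unbarred) (head [::] T)
}.

Definition reading (T : tableau) : seq label := flatten (map rev T).

Definition unbarred_part (M : label) : label := filter unbarred M.

(* Each label contributes at most one letter, having at most one barred one. *)
Definition read_word (T : tableau) (S : label) : seq nat :=
  flatten [seq [seq x.2 | x <- filter barred M]
          | M <- reading T & unbarred_part M == S].

Definition unbarred_parts (T : tableau) : seq label :=
  sort label_le (undup [seq S <- map unbarred_part (reading T) | S != [::]]).

Definition lattice_word (w : seq nat) : Prop :=
  forall k j : nat, (0 < j)%N ->
    (count_mem j.+1 (take k w) <= count_mem j (take k w))%N.

Definition is_lattice (T : tableau) : Prop :=
  lattice_word (flatten (map (read_word T) ([::] :: unbarred_parts T))).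

Definition set_label (M : label) : bool :=
  [&& uniq M, (count unbarred M <= 1)%N & (count barred M <= 1)%N].

(* Main.v *)
Require Import Defs.
From mathcomp Require Import all_boot all_order all_fingroup all_algebra.
From mathcomp Require Import all_solvable all_field all_character.
From mathcomp Require Import finmap mpoly boolp zify.

Set Implicit Arguments.
Unset Strict Implicit.
Unset Printing Implicit Defensive.

Import Order.TTheory GRing.Theory Num.Theory.

(* A symmetric function is determined by its values at the multisets [Xi nu] for
   large [|nu|], so it suffices to compare characters of S_n for n large.  Let
   [word_char n M th s] count the functions from {1..n} to an alphabet that are
   constant on the cycles of s and have content th (this is [<h_th, p_nu>]), and let
   [schur_char n N la] be the Jacobi-Trudi alternating sum of such counts.  The
   product of [word_char n L nu] and [schur_char n N la] is an alternating sum of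
   counts of functions to pairs of letters (k, i), of which the k-content is nu and
   the i-content is alternated; each of these counts is the sum of the [schur_char]
   of the shapes of the semistandard tableaux in the alphabet of pairs ordered
   lexicographically.  A Bender-Knuth involution acting after the first violation of
   the lattice condition cancels every tableau that is not a lattice tableau.  For n
   large the first row of a surviving tableau begins with many pairs (0, 0), which
   stand for the empty label; erasing them leaves the tableaux of the theorem.

   The same involution shows that the [schur_char] are orthonormal and that
   [word_char n M th] is the sum of the [schur_char] of the shapes of the tableaux of
   content th.  Hence each [schur_char n N rho] is an irreducible character, and
   [chi n rho] is this one: a common constituent [schur_char n N si] of the two
   induced characters that define [chi n rho] satisfies
   [\sum_i i * si_i = \sum_i i * rho_i], which forces [si = rho]. *)

Lemma big_nat_only1 (T : Type) (idx : T) (op : Monoid.law idx) m n i (F : nat -> T) :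
  m <= i < n -> (forall j, m <= j < n -> j != i -> F j = idx) ->
  \big[op/idx]_(m <= j < n) F j = F i.
Proof.
move=> mn_i F_idx; have := big_nat1_eq op F i m n; rewrite mn_i => <-.
rewrite [RHS]big_mkcond; apply: eq_big_nat => j mn_j.
by case: eqP => [-> //|/eqP]; apply: F_idx.
Qed.

(** * Toggling a row of a Gelfand-Tsetlin pattern *)

Section Toggle.

Variables (R : nat) (inner outer : nat -> nat).

Definition mid_min r :=
  if r.+1 < R then maxn (inner r) (outer r.+1) else inner r.

Definition mid_max r := if r is r'.+1 then minn (outer r) (inner r') else outer 0.

Definition interlaced (mid : nat -> nat) :=
  forall r, r < R -> mid_min r <= mid r <= mid_max r.

(* For [t = gap = 0] this is the Bender-Knuth involution, as then
   [outer 0 = mid_max 0]. *)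
Definition toggle mid t gap r :=
  if r < t then mid r
  else if r == t then outer t + mid_min t - gap - mid t
  else mid_min r + mid_max r - mid r.

Definition togglable (mid : nat -> nat) t gap :=
  [/\ t < R, mid t + gap <= outer t & outer t <= mid_max t + gap].

Lemma mid_max_le r : mid_max r <= outer r.
Proof. by case: r => //= r; apply: geq_minl. Qed.

Lemma mid_min_ge r : inner r <= mid_min r.
Proof. by rewrite /mid_min; case: ifP => // _; apply: leq_maxl. Qed.

Lemma toggle_interlaced mid t gap :
  interlaced mid -> togglable mid t gap -> interlaced (toggle mid t gap).
Proof.
move=> midP [tR gap_le gap_ge] r rR; have := midP _ rR; have := midP _ tR.
rewrite /toggle; case: ltnP => // _; case: eqP => [->|_]; lia.
Qed.

Lemma toggle_togglable mid t gap : interlaced mid ->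
  togglable mid t gap -> togglable (toggle mid t gap) t gap.
Proof.
move=> midP [tR gap_le gap_ge]; split=> //; have := midP _ tR.
by rewrite /toggle ltnn eqxx; lia.
Qed.

Lemma toggleK mid t gap r : interlaced mid -> togglable mid t gap -> r < R ->
  toggle (toggle mid t gap) t gap r = mid r.
Proof.
move=> midP [tR gap_le gap_ge] rR; have := midP _ rR; have := midP _ tR.
rewrite {1}/toggle; case: ltnP => [rt|tr]; first by rewrite /toggle rt.
case: eqP => [->|neq]; rewrite /toggle; first by rewrite ltnn eqxx; lia.
by rewrite ltnNge tr /=; case: eqP => // _; lia.
Qed.

Lemma sum_mid_min_max t : t < R ->
  \sum_(t <= r < R) (mid_min r + mid_max r) + outer t =
  mid_max t + \sum_(t <= r < R) (inner r + outer r).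
Proof.
move=> tR; move eqd: (R - t.+1) => d.
elim: d t tR eqd => [|d IHd] t tR eqd.
  have -> : R = t.+1 by lia.
  by rewrite !big_nat1 /mid_min; case: ifP; lia.
have tR' : t.+1 < R by lia.
have := IHd _ tR'; rewrite !(big_ltn tR).
set sum_mid := \sum_(t.+1 <= r < R) _; set sum_ends := \sum_(t.+1 <= r < R) _.
rewrite [mid_min t]/mid_min [mid_max t.+1]/= tR' => /(_ ltac:(lia)); lia.
Qed.

Lemma sum_toggle mid t gap : interlaced mid -> togglable mid t gap ->
  \sum_(t <= r < R) toggle mid t gap r + \sum_(t <= r < R) mid r + gap =
  \sum_(t <= r < R) (inner r + outer r).
Proof.
move=> midP [tR gap_le gap_ge]; rewrite -big_split /= !(big_ltn tR).
rewrite [in toggle _ _ _ t]/toggle ltnn eqxx.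
have -> : \sum_(t.+1 <= r < R) (toggle mid t gap r + mid r) =
  \sum_(t.+1 <= r < R) (mid_min r + mid_max r).
  apply: eq_big_nat => r /andP[tr rR]; rewrite /toggle.
  by rewrite ltnNge (ltnW tr) gtn_eqF //=; have := midP _ rR; lia.
have := midP _ tR; have [tR'|tR'] := ltnP t.+1 R; last first.
  by rewrite !big_geq // /mid_min ltnNge tR' /=; lia.
have := sum_mid_min_max tR'.
set sum_mid := \sum_(t.+1 <= r < R) _; set sum_ends := \sum_(t.+1 <= r < R) _.
rewrite [mid_min t]/mid_min [mid_max t.+1]/= tR'; lia.
Qed.

End Toggle.

Lemma eq_toggle R inner inner' outer outer' mid mid' t gap r : t < R -> r < R ->
  (forall s, s < R ->
     [/\ inner s = inner' s, outer s = outer' s & mid s = mid' s]) ->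
  toggle R inner outer mid t gap r = toggle R inner' outer' mid' t gap r.
Proof.
move=> tR rR eq_shapes.
have eq_min s : s < R -> mid_min R inner outer s = mid_min R inner' outer' s.
  move=> sR; rewrite /mid_min; have [-> _ _] := eq_shapes _ sR.
  by case: ltnP => // sR'; have [_ -> _] := eq_shapes _ sR'.
have eq_max s : s < R -> mid_max inner outer s = mid_max inner' outer' s.
  case: s => [|s] sR /=; have [_ -> _] := eq_shapes _ sR => //.
  by have [-> _ _] := eq_shapes _ (ltnW sR).
rewrite /toggle eq_min // eq_min // eq_max //.
by have [_ _ ->] := eq_shapes _ rR; have [_ -> ->] := eq_shapes _ tR.
Qed.

(** * The lattice condition on semistandard arrays *)

Lemma ltn_mul_add L N k i : k < L -> i < N -> k * N + i < L * N.
Proof.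
move=> kL iN; have : k.+1 * N <= L * N by rewrite leq_mul2r kL orbT.
by rewrite mulSn; lia.
Qed.

Lemma ltn_mul_split L N j : j < L * N ->
  exists k i, [/\ k < L, i < N & j = k * N + i].
Proof.
move=> jLN; have N_gt0 : 0 < N by case: N jLN => //; rewrite muln0.
exists (j %/ N), (j %% N); rewrite -divn_eq ltn_mod N_gt0; split=> //.
by rewrite ltn_divLR.
Qed.

Lemma divn_mul_add N k i : i < N -> (k * N + i) %/ N = k.
Proof.
move=> iN; rewrite divnMDl ?divn_small ?addn0 //; exact: leq_ltn_trans iN.
Qed.

Lemma modn_mul_add N k i : i < N -> (k * N + i) %% N = i.
Proof. by move=> iN; rewrite modnMDl modn_small. Qed.

(* A semistandard tableau with R rows is recorded by the number [v r j] of
   entries j in row r; [subshape v j] is the shape of its entries < j. *)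
Definition subshape (v : nat -> nat -> nat) j r := \sum_(0 <= j' < j) v r j'.

Definition colsum R (v : nat -> nat -> nat) j := \sum_(0 <= r < R) v r j.

(* The entry k * N + i stands for the pair (k, i) of a group k and a letter i < N,
   pairs being ordered lexicographically. *)
Definition group_content N (u : nat -> nat) k := \sum_(0 <= i < N) u (k * N + i).

Definition letter_content L N (u : nat -> nat) i :=
  \sum_(0 <= k < L) u (k * N + i).

Definition semistandard R M v :=
  forall r j, r.+1 < R -> j < M -> subshape v j.+1 r.+1 <= subshape v j r.

(* The letters of the entries are read group by group, and row by row in a group. *)
Definition letters_read R N v k r i :=
  letter_content k N (colsum R v) i + colsum r v (k * N + i).

Definition violation R N v k r i :=
  letters_read R N v k r i < letters_read R N v k r.+1 i.+1.

Lemma subshapeS v j r : subshape v j.+1 r = subshape v j r + v r j.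
Proof. by rewrite /subshape big_nat_recr. Qed.

Lemma leq_subshape v r j j' : j <= j' -> subshape v j r <= subshape v j' r.
Proof. by move=> jj'; rewrite [leqRHS](@big_cat_nat _ _ _ j) //= leq_addr. Qed.

Lemma colsumS r v j : colsum r.+1 v j = colsum r v j + v r j.
Proof. by rewrite /colsum big_nat_recr. Qed.

Lemma letters_readS R N v k r i :
  letters_read R N v k r.+1 i = letters_read R N v k r i + v r (k * N + i).
Proof. by rewrite /letters_read colsumS addnA. Qed.

Lemma letters_read_next_group R N v k i :
  letters_read R N v k.+1 0 i = letters_read R N v k R i.
Proof.
rewrite /letters_read /letter_content big_nat_recr //= [colsum 0 _ _]/colsum.
by rewrite big_nil addn0.
Qed.

Lemma sum_group_content N u k :
  \sum_(0 <= k' < k) group_content N u k' = \sum_(0 <= j < k * N) u j.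
Proof.
elim: k => [|k IHk]; first by rewrite !big_nil.
rewrite big_nat_recr //= IHk [RHS](@big_cat_nat _ _ _ (k * N)) //=; last first.
  by rewrite leq_mul2r leqnSn orbT.
congr (_ + _); rewrite -[X in \sum_(X <= j < _) u j]add0n big_addn mulSn addnK.
by apply: eq_bigr => i _; rewrite addnC.
Qed.

Lemma subshape_mul N v k r :
  subshape v (k * N) r = \sum_(0 <= k' < k) group_content N (v r) k'.
Proof. by rewrite sum_group_content. Qed.

Lemma sum_letter_content L N u :
  \sum_(0 <= i < N) letter_content L N u i = \sum_(0 <= j < L * N) u j.
Proof. by rewrite exchange_big -sum_group_content. Qed.

Lemma semistandard_interlaced R L N v k i : semistandard R (L * N) v ->
  k < L -> i.+1 < N ->
  interlaced R (subshape v (k * N + i)) (subshape v (k * N + i).+2)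
    (subshape v (k * N + i).+1).
Proof.
move=> ssv kL iN r rR; have jM : (k * N + i).+1 < L * N.
  by rewrite -addnS ltn_mul_add.
have inner_le := leq_subshape v r (leqnSn (k * N + i)).
have outer_ge := leq_subshape v r (leqnSn (k * N + i).+1).
apply/andP; split.
  rewrite /mid_min; case: ifP => // rR'; rewrite geq_max inner_le /=.
  exact: ssv.
case: r rR inner_le outer_ge => [|r] rR _ outer_ge //=.
by rewrite leq_min outer_ge /=; apply: ssv => //; apply: ltnW.
Qed.

Section Flip.

Variables (R L N : nat) (v : nat -> nat -> nat) (k0 r0 i0 gap : nat).

Definition toggle_group t gap k :=
  toggle R (subshape v (k * N + i0)) (subshape v (k * N + i0).+2)
    (subshape v (k * N + i0).+1) t gap.

Definition togglable_group t gap k :=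
  togglable R (subshape v (k * N + i0)) (subshape v (k * N + i0).+2)
    (subshape v (k * N + i0).+1) t gap.

Definition flip_mid k :=
  if k < k0 then subshape v (k * N + i0).+1
  else if k == k0 then toggle_group r0 gap k
  else toggle_group 0 0 k.

Definition flip_subshape j r :=
  if j %% N == i0.+1 then flip_mid (j %/ N) r else subshape v j r.

Definition flip r j := flip_subshape j.+1 r - flip_subshape j r.

Hypotheses (i0N : i0.+1 < N) (k0L : k0 < L) (ssv : semistandard R (L * N) v)
  (tog : togglable_group r0 gap k0).

Lemma flip_subshapeE k i r : i < N -> flip_subshape (k * N + i) r =
  if i == i0.+1 then flip_mid k r else subshape v (k * N + i) r.
Proof. by move=> iN; rewrite /flip_subshape modn_mul_add // divn_mul_add. Qed.

Lemma flip_subshapeSE k i r : i < N -> flip_subshape (k * N + i).+1 r =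
  if i == i0 then flip_mid k r else subshape v (k * N + i).+1 r.
Proof.
move=> iN; rewrite -addnS; have [iN'|iN'] := ltnP i.+1 N.
  by rewrite flip_subshapeE // eqSS.
have -> : k * N + i.+1 = k.+1 * N + 0 by rewrite mulSn; lia.
rewrite flip_subshapeE; last by lia.
by have -> : i == i0 = false by lia.
Qed.

Lemma togglable_group00 k : togglable_group 0 0 k.
Proof.
have [r0R _ _] := tog; split=> //=; rewrite ?addn0 ?leq_subshape //.
exact: leq_ltn_trans r0R.
Qed.

Lemma flip_mid_interlaced k : k < L ->
  interlaced R (subshape v (k * N + i0)) (subshape v (k * N + i0).+2) (flip_mid k).
Proof.
move=> kL r rR; have midP := semistandard_interlaced ssv kL i0N.
rewrite /flip_mid; case: ltnP => _; first exact: midP.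
case: eqP => [k_k0|_]; apply: toggle_interlaced => //; first by rewrite k_k0.
exact: togglable_group00.
Qed.

Lemma flip_mid_bounds k r : k < L -> r < R ->
  subshape v (k * N + i0) r <= flip_mid k r <= subshape v (k * N + i0).+2 r.
Proof.
move=> kL rR; have /andP[min_le le_max] := flip_mid_interlaced kL rR.
rewrite (leq_trans (mid_min_ge _ _ _ _) min_le) /=.
exact: leq_trans le_max (mid_max_le _ _ _).
Qed.

Lemma flip_subshape_mono j r : r < R -> j < L * N ->
  flip_subshape j r <= flip_subshape j.+1 r.
Proof.
move=> rR /ltn_mul_split[k [i [kL iN ->]]].
rewrite flip_subshapeE // flip_subshapeSE //; have := flip_mid_bounds kL rR.
case: eqP => [->|_]; case: eqP => [i_i0|_].
- by lia.
- by case/andP=> _; rewrite addnS.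
- by rewrite i_i0 => /andP[].
- by move=> _; apply: leq_subshape.
Qed.

Variable w : nat -> nat -> nat.
Hypothesis wE : forall r j, r < R -> j < L * N -> w r j = flip r j.

Lemma subshape_flip j r : r < R -> j <= L * N -> subshape w j r = flip_subshape j r.
Proof.
move=> rR; elim: j => [|j IHj] jM.
  by rewrite /flip_subshape mod0n /subshape !big_nil.
by rewrite subshapeS IHj ?(ltnW jM) // wE // subnKC // flip_subshape_mono.
Qed.

Lemma flip_inner k r : k < L -> r < R ->
  subshape w (k * N + i0) r = subshape v (k * N + i0) r.
Proof.
move=> kL rR; have i0N' := ltnW i0N.
rewrite subshape_flip ?(ltnW (ltn_mul_add kL i0N')) // flip_subshapeE //.
by rewrite ltn_eqF.
Qed.

Lemma flip_mid_subshape k r : k < L -> r < R ->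
  subshape w (k * N + i0).+1 r = flip_mid k r.
Proof.
move=> kL rR; have i0N' := ltnW i0N.
by rewrite subshape_flip ?(ltn_mul_add kL i0N') // flip_subshapeSE // eqxx.
Qed.

Lemma flip_outer k r : k < L -> r < R ->
  subshape w (k * N + i0).+2 r = subshape v (k * N + i0).+2 r.
Proof.
move=> kL rR; rewrite -addnS subshape_flip ?(ltn_mul_add kL i0N) //.
by rewrite flip_subshapeSE // gtn_eqF.
Qed.

Lemma subshape_flip_mul k r : k <= L -> r < R ->
  subshape w (k * N) r = subshape v (k * N) r.
Proof.
move=> kL rR; rewrite subshape_flip ?leq_mul2r ?kL ?orbT //.
by rewrite -[k * N]addn0 flip_subshapeE //; lia.
Qed.

Lemma flip_other_letter k r i : k < L -> r < R -> i < N -> i != i0 -> i != i0.+1 ->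
  w r (k * N + i) = v r (k * N + i).
Proof.
move=> kL rR iN /negbTE ne0 /negbTE ne1.
rewrite wE ?ltn_mul_add // /flip flip_subshapeE // flip_subshapeSE // ne0 ne1.
by rewrite subshapeS addKn.
Qed.

Lemma flip_pair k r : k < L -> r < R ->
  w r (k * N + i0) + w r (k * N + i0.+1) = v r (k * N + i0) + v r (k * N + i0.+1).
Proof.
move=> kL rR; have := flip_outer kL rR; rewrite !subshapeS flip_inner // -!addnS.
by lia.
Qed.

Lemma flip_before k r i : k < L -> r < R -> i < N ->
  (k < k0) || (k == k0) && (r < r0) -> w r (k * N + i) = v r (k * N + i).
Proof.
move=> kL rR iN before_start.
have mid_same : flip_mid k r = subshape v (k * N + i0).+1 r.
  rewrite /flip_mid; case: ltnP before_start => //= _ /andP[/eqP -> rr0].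
  by rewrite eqxx /toggle_group /toggle rr0.
have := flip_mid_subshape kL rR; rewrite mid_same !subshapeS flip_inner //.
move/addnI => same0.
have [->|ne0] := eqVneq i i0; first exact: same0.
have [->|ne1] := eqVneq i i0.+1; last exact: flip_other_letter.
by have := flip_pair kL rR; rewrite same0 => /addnI.
Qed.

Lemma sum_flip_group t e k : k < L -> togglable_group t e k ->
  flip_mid k = toggle_group t e k ->
  \sum_(t <= r < R) w r (k * N + i0) + e = \sum_(t <= r < R) v r (k * N + i0.+1).
Proof.
move=> kL tog_k mid_k.
have := sum_toggle (semistandard_interlaced ssv kL i0N) tog_k.
rewrite -/(toggle_group t e k) -mid_k.
have -> : \sum_(t <= r < R) flip_mid k r =
    \sum_(t <= r < R) (subshape v (k * N + i0) r + w r (k * N + i0)).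
  apply: eq_big_nat => r /andP[_ rR].
  by rewrite -flip_mid_subshape // subshapeS flip_inner.
have -> : \sum_(t <= r < R)
      (subshape v (k * N + i0) r + subshape v (k * N + i0).+2 r) =
    \sum_(t <= r < R) (subshape v (k * N + i0) r +
      (subshape v (k * N + i0).+1 r + v r (k * N + i0.+1))).
  by apply: eq_bigr => r _; rewrite subshapeS addnS.
by rewrite !big_split /=; lia.
Qed.

Lemma flip_semistandard : semistandard R (L * N) w.
Proof.
move=> r j rR jM; rewrite !subshape_flip //; try lia.
case: (ltn_mul_split jM) => k [i [kL iN ->]].
rewrite flip_subshapeSE // flip_subshapeE //.
have := flip_mid_interlaced kL.
case: eqP => [->|_].
  have -> : i0 == i0.+1 = false by lia.
  by move/(_ _ rR) => /=; rewrite leq_min => /andP[_ /andP[]].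
case: eqP => [->|_]; last by move=> _; apply: ssv => //; apply: ltn_mul_add.
move/(_ _ (ltnW rR)) => /andP[+ _]; rewrite /mid_min rR geq_max => /andP[_].
by rewrite -addnS.
Qed.

Lemma leq_flip r j : r < R -> j < L * N -> w r j <= subshape v (L * N) r.
Proof.
move=> rR jM; rewrite -subshape_flip_mul //.
by apply: leq_trans (leq_subshape w r jM); rewrite subshapeS leq_addl.
Qed.

Lemma flip_group_content k r : k < L -> r < R ->
  group_content N (w r) k = group_content N (v r) k.
Proof.
move=> kL rR; apply: (@addnI (\sum_(0 <= k' < k) group_content N (w r) k')).
rewrite -[LHS](big_nat_recr k) //= -subshape_mul subshape_flip_mul //.
by rewrite subshape_mul big_nat_recr //= -!subshape_mul subshape_flip_mul // ltnW.
Qed.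

End Flip.

Lemma flipK R L N v k0 r0 i0 gap w :
  i0.+1 < N -> k0 < L -> semistandard R (L * N) v ->
  togglable_group R N v i0 r0 gap k0 ->
  (forall r j, r < R -> j < L * N -> w r j = flip R N v k0 r0 i0 gap r j) ->
  forall r j, r < R -> j < L * N -> flip R N w k0 r0 i0 gap r j = v r j.
Proof.
move=> i0N k0L ssv tog wE.
have togK t e k r : k < L -> r < R -> togglable_group R N v i0 t e k ->
    flip_mid R N v k0 r0 i0 gap k = toggle_group R N v i0 t e k ->
    toggle_group R N w i0 t e k r = subshape v (k * N + i0).+1 r.
  move=> kL rR tog_k mid_k; have [tR _ _] := tog_k.
  rewrite -[RHS](toggleK (semistandard_interlaced ssv kL i0N) tog_k rR).
  apply: eq_toggle => // s sR; split; first exact: flip_inner wE _ _ _ _.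
    exact: flip_outer wE _ _ _ _.
  by rewrite (flip_mid_subshape i0N k0L ssv tog wE) // mid_k.
have midK k r : k < L -> r < R ->
    flip_mid R N w k0 r0 i0 gap k r = subshape v (k * N + i0).+1 r.
  move=> kL rR; rewrite {1}/flip_mid; case: ltnP => [k_lt|k_ge].
    rewrite (flip_mid_subshape i0N k0L ssv tog wE) //.
    by rewrite /flip_mid k_lt.
  case: eqP => [k_k0|k_k0]; apply: togK => //.
  - by rewrite k_k0.
  - by rewrite /flip_mid ltnNge k_ge k_k0 eqxx.
  - exact: togglable_group00 tog _.
  - by rewrite /flip_mid ltnNge k_ge; case: eqP k_k0.
have subshapeK j r : r < R -> j <= L * N ->
    flip_subshape R N w k0 r0 i0 gap j r = subshape v j r.
  move=> rR jM; rewrite /flip_subshape; case: eqP => [j_i0|j_i0]; last first.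
    rewrite (subshape_flip i0N k0L ssv tog wE) // /flip_subshape.
    by case: eqP j_i0.
  have j_lt : j < L * N.
    rewrite ltn_neqAle jM andbT; apply/eqP => j_LN.
    by move: j_i0; rewrite j_LN modnMl.
  have [k [i [kL iN j_ki]]] := ltn_mul_split j_lt.
  move: j_i0; rewrite j_ki modn_mul_add // divn_mul_add // => ->.
  by rewrite midK // addnS.
by move=> r j rR jM; rewrite /flip !subshapeK ?(ltnW jM) // subshapeS addKn.
Qed.

(** * Flipping an array after its first lattice violation *)

Definition shift N (u : nat -> nat) i := u i + (N - i).

Definition swap_at i (u : nat -> nat) j :=
  if j == i then u i.+1 else if j == i.+1 then u i else u j.

(* (k, r, i) is read before (k0, r0, i0); in a row the letters are read in
   decreasing order. *)
Definition read_earlier k0 r0 i0 k r i :=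
  (k < k0) || ((k == k0) && ((r < r0) || ((r == r0) && (i0 < i)))).

Record first_violation R L N v k0 r0 i0 : Prop := FirstViolation {
  first_violation_group : k0 < L;
  first_violation_row : r0 < R;
  first_violation_letter : i0.+1 < N;
  first_violation_violation : violation R N v k0 r0 i0;
  first_violation_first : forall k r i, k < L -> r < R -> i.+1 < N ->
    read_earlier k0 r0 i0 k r i -> ~~ violation R N v k r i
}.

Definition violation_gap R N v k0 r0 i0 :=
  (letters_read R N v k0 r0 i0).+1 - letters_read R N v k0 r0 i0.+1.

Lemma letter_content_read R L N v k r i : k < L -> r <= R ->
  letter_content L N (colsum R v) i = letters_read R N v k r i
  + \sum_(r <= r' < R) v r' (k * N + i)
  + \sum_(k.+1 <= k' < L) colsum R v (k' * N + i).
Proof.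
move=> kL rR; rewrite /letter_content (@big_cat_nat _ _ _ k 0 L) ?(ltnW kL) //=.
by rewrite (big_ltn kL) [colsum R v _](@big_cat_nat _ _ _ r) //= !addnA.
Qed.

Lemma leq_letters_read R L N v k r i : k < L -> r <= R ->
  letters_read R N v k r i <= letter_content L N (colsum R v) i.
Proof. by move=> kL rR; rewrite (letter_content_read N v i kL rR) -addnA leq_addr. Qed.

Section FirstViolation.

Variables (R L N : nat) (v : nat -> nat -> nat) (k0 r0 i0 : nat).

Local Notation read := (letters_read R N).
Local Notation gap := (violation_gap R N v k0 r0 i0).

Hypotheses (ssv : semistandard R (L * N) v)
  (first_v : first_violation R L N v k0 r0 i0).

Let k0L := first_violation_group first_v.
Let r0R := first_violation_row first_v.
Let i0N := first_violation_letter first_v.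
Let violation_v := first_violation_violation first_v.
Let no_earlier_violation := first_violation_first first_v.

Lemma first_violation_prev_row r : r0 = r.+1 -> read v k0 r0 i0.+1 <= read v k0 r i0.
Proof.
move=> r0_r; rewrite r0_r leqNgt; apply: no_earlier_violation => //; try lia.
by rewrite /read_earlier; lia.
Qed.

Lemma first_violation_read_le : read v k0 r0 i0.+1 <= read v k0 r0 i0.
Proof.
case r0_r: r0 => [|r]; last first.
  rewrite -r0_r; apply: leq_trans (first_violation_prev_row r0_r) _.
  by rewrite r0_r letters_readS leq_addr.
case k0_k: k0 => [|k].
  by rewrite /letters_read /letter_content /colsum !big_nil.
rewrite !letters_read_next_group; have R_pred : R = R.-1.+1 by lia.
have : ~~ violation R N v k R.-1 i0.
  by apply: no_earlier_violation; try lia; rewrite /read_earlier; lia.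
rewrite /violation -leqNgt -R_pred => /leq_trans; apply.
by rewrite [X in _ <= read v k X i0]R_pred letters_readS leq_addr.
Qed.

Lemma first_violation_togglable : togglable_group R N v i0 r0 gap k0.
Proof.
have read_le := first_violation_read_le.
split=> //; rewrite /violation_gap.
  rewrite [leqRHS]subshapeS -addnS.
  by move: violation_v; rewrite /violation !letters_readS; lia.
case r0_r: r0 => [|r]; first by rewrite /= leq_addr.
have read_prev := first_violation_prev_row r0_r.
have read_r0 : read v k0 r0 i0 = read v k0 r i0 + v r (k0 * N + i0).
  by rewrite r0_r letters_readS.
have mid_r := subshapeS v (k0 * N + i0) r.
have outer_le : subshape v (k0 * N + i0).+2 r0 <= subshape v (k0 * N + i0).+1 r.
  rewrite r0_r; apply: ssv; first by rewrite -r0_r.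
  by rewrite -addnS ltn_mul_add.
by rewrite /= -r0_r; lia.
Qed.

Let tog := first_violation_togglable.

Lemma leq_flip_first r j : r < R -> j < L * N ->
  flip R N v k0 r0 i0 gap r j <= subshape v (L * N) r.
Proof. exact: (leq_flip i0N k0L ssv tog (fun _ _ _ _ => erefl)). Qed.

Variable w : nat -> nat -> nat.
Hypothesis wE : forall r j, r < R -> j < L * N -> w r j = flip R N v k0 r0 i0 gap r j.

Lemma flip_letters_read k r i : k < L -> r <= R -> i < N ->
  (k < k0) || (k == k0) && (r <= r0) -> read w k r i = read v k r i.
Proof.
move=> kL rR iN before_start; congr (_ + _).
  apply: eq_big_nat => k' /andP[_ k'k]; apply: eq_big_nat => r' /andP[_ r'R].
  by apply: (flip_before i0N k0L ssv tog wE) => //; lia.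
apply: eq_big_nat => r' /andP[_ r'r].
by apply: (flip_before i0N k0L ssv tog wE) => //; lia.
Qed.

Lemma flip_violation_gap : violation_gap R N w k0 r0 i0 = gap.
Proof. by rewrite /violation_gap !flip_letters_read //; lia. Qed.

Lemma flip_violation : violation R N w k0 r0 i0.
Proof.
rewrite /violation letters_readS !flip_letters_read //; try lia.
have : gap <= w r0 (k0 * N + i0.+1).
  have [_ gap_le _] := toggle_togglable (semistandard_interlaced ssv k0L i0N) tog.
  have := flip_outer i0N k0L ssv tog wE k0L r0R.
  have := flip_mid_subshape i0N k0L ssv tog wE k0L r0R.
  rewrite /flip_mid ltnn eqxx [subshape w _.+2 _]subshapeS addnS => -> outer_r0.
  by move: gap_le; rewrite -outer_r0 leq_add2l.
by rewrite /violation_gap; lia.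
Qed.

Lemma flip_no_earlier_violation k r i : k < L -> r < R -> i.+1 < N ->
  read_earlier k0 r0 i0 k r i -> ~~ violation R N w k r i.
Proof.
move=> kL rR iN earlier; have := no_earlier_violation kL rR iN earlier.
move: earlier; rewrite /read_earlier /violation => earlier.
rewrite (flip_letters_read kL (ltnW rR) (ltnW iN)); last by lia.
have [row_before|row_r0] := boolP ((k < k0) || (k == k0) && (r < r0)).
  by rewrite flip_letters_read //; lia.
have [k_k0 r_r0 i0_i] : [/\ k = k0, r = r0 & i0 < i] by split; lia.
rewrite !letters_readS flip_letters_read ?(ltnW rR) //; last by lia.
by rewrite (flip_other_letter i0N k0L wE) //; lia.
Qed.

Lemma flip_first_violation : first_violation R L N w k0 r0 i0.
Proof.
split=> //; first exact: flip_violation.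
exact: flip_no_earlier_violation.
Qed.

Local Notation content u := (letter_content L N (colsum R u)).

Lemma flip_content_other i : i < N -> i != i0 -> i != i0.+1 -> content w i = content v i.
Proof.
move=> iN ne0 ne1; apply: eq_big_nat => k /andP[_ kL].
apply: eq_big_nat => r /andP[_ rR].
exact: (flip_other_letter i0N k0L wE).
Qed.

Lemma flip_content_i0 : (content w i0).+1 = content v i0.+1.
Proof.
rewrite !(letter_content_read _ _ _ k0L (ltnW r0R)) flip_letters_read; try lia.
have rows_at : \sum_(r0 <= r < R) w r (k0 * N + i0) + gap =
    \sum_(r0 <= r < R) v r (k0 * N + i0.+1).
  apply: (sum_flip_group i0N k0L ssv tog wE k0L tog).
  by rewrite /flip_mid ltnn eqxx.
have groups_after : \sum_(k0.+1 <= k < L) colsum R w (k * N + i0) =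
    \sum_(k0.+1 <= k < L) colsum R v (k * N + i0.+1).
  apply: eq_big_nat => k /andP[k0k kL].
  have := sum_flip_group i0N k0L ssv tog wE kL (togglable_group00 tog k).
  by rewrite addn0; apply; rewrite /flip_mid ltnNge (ltnW k0k) gtn_eqF.
by rewrite groups_after -rows_at /violation_gap; have := first_violation_read_le; lia.
Qed.

Lemma flip_content_i0S : content w i0.+1 = (content v i0).+1.
Proof.
have : content w i0 + content w i0.+1 = content v i0 + content v i0.+1.
  rewrite -!big_split /=; apply: eq_big_nat => k /andP[_ kL].
  rewrite -!big_split /=; apply: eq_big_nat => r /andP[_ rR].
  exact: (flip_pair i0N k0L ssv tog wE).
by have := flip_content_i0; lia.
Qed.

Lemma shift_flip_content i : i < N ->
  shift N (content w) i = swap_at i0 (shift N (content v)) i.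
Proof.
move=> iN; rewrite /swap_at /shift.
case: eqP => [->|/eqP ne0]; first by have := flip_content_i0; lia.
case: eqP => [->|/eqP ne1]; first by have := flip_content_i0S; lia.
by rewrite flip_content_other.
Qed.

End FirstViolation.

Lemma first_violation_uniq R L N v k0 r0 i0 k1 r1 i1 :
  first_violation R L N v k0 r0 i0 -> first_violation R L N v k1 r1 i1 ->
  [/\ k0 = k1, r0 = r1 & i0 = i1].
Proof.
move=> [k0L r0R i0N viol0 first0] [k1L r1R i1N viol1 first1].
have not_earlier0 : ~~ read_earlier k1 r1 i1 k0 r0 i0.
  by apply/negP => /(first1 _ _ _ k0L r0R i0N)/negP.
have not_earlier1 : ~~ read_earlier k0 r0 i0 k1 r1 i1.
  by apply/negP => /(first0 _ _ _ k1L r1R i1N)/negP.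
by move: not_earlier0 not_earlier1; rewrite /read_earlier; split; lia.
Qed.

Lemma read_earlier_code R N k0 r0 i0 k r i : r < R -> i < N -> i0 < N ->
  read_earlier k0 r0 i0 k r i ->
  (k * R + r) * N + (N - i.+1) < (k0 * R + r0) * N + (N - i0.+1).
Proof.
move=> rR iN i0N; have rows_lt a b : a < b -> a * N + (N - i.+1) < b * N.
  by move=> ab; have := @ltn_mul_add b N a (N - i.+1) ab; apply; lia.
case/orP=> [k_lt|/andP[/eqP -> /orP[r_lt|/andP[/eqP -> i0_lt]]]].
- apply: leq_trans (rows_lt _ _ _) (leq_addr _ _).
  by apply: leq_trans (ltn_mul_add k_lt rR) (leq_addr _ _).
- by apply: leq_trans (rows_lt _ _ _) (leq_addr _ _); rewrite ltn_add2l.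
- by lia.
Qed.

(** * Semistandard arrays *)

Section Arrays.

Variables R M B : nat.

Definition array := {ffun 'I_R * 'I_M -> 'I_B.+1}.

Definition entry (c : array) (r j : nat) : nat :=
  if insub r is Some r' then if insub j is Some j' then c (r', j') else 0 else 0.

(* Entries of [v] that exceed B are lost. *)
Definition array_of (v : nat -> nat -> nat) : array :=
  [ffun p => inord (v (val p.1) (val p.2))].

Definition arr_shape (c : array) := subshape (entry c) M.
Definition arr_content (c : array) := colsum R (entry c).

Lemma entryE (c : array) (r : 'I_R) (j : 'I_M) : entry c r j = c (r, j).
Proof. by rewrite /entry !valK. Qed.

Lemma entry_array_of v r j : r < R -> j < M -> v r j <= B ->
  entry (array_of v) r j = v r j.
Proof.
move=> rR jM vB; rewrite (entryE _ (Ordinal rR) (Ordinal jM)) ffunE /=.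
by rewrite inordK.
Qed.

Lemma entry_le c r j : entry c r j <= B.
Proof.
rewrite /entry; case: insubP => // r' _ _; case: insubP => // j' _ _.
by rewrite -ltnS ltn_ord.
Qed.

Lemma entry_out_col c r j : M <= j -> entry c r j = 0.
Proof. by move=> Mj; rewrite /entry; case: insub => // r'; rewrite insubN // -leqNgt. Qed.

Lemma entry_out_row c r j : R <= r -> entry c r j = 0.
Proof. by move=> Rr; rewrite /entry insubN // -leqNgt. Qed.

Lemma array_ext (c d : array) :
  (forall r j, r < R -> j < M -> entry c r j = entry d r j) -> c = d.
Proof.
move=> eq_entry; apply/ffunP => -[r j]; apply: val_inj => /=.
by rewrite -!entryE; apply: eq_entry.
Qed.

Lemma arr_shape_out c r : R <= r -> arr_shape c r = 0.
Proof. by move=> Rr; rewrite /arr_shape /subshape big1 // => j _; rewrite entry_out_row. Qed.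

Lemma arr_content_out c j : M <= j -> arr_content c j = 0.
Proof. by move=> Mj; rewrite /arr_content /colsum big1 // => r _; rewrite entry_out_col. Qed.

Lemma sum_arr_shape c :
  \sum_(0 <= r < R) arr_shape c r = \sum_(0 <= j < M) arr_content c j.
Proof. by rewrite exchange_big. Qed.

Definition ssyt (c : array) :=
  [forall r : 'I_R, forall j : 'I_M, (r.+1 < R) ==>
     (subshape (entry c) j.+1 r.+1 <= subshape (entry c) j r)].

Lemma ssytP c : reflect (semistandard R M (entry c)) (ssyt c).
Proof.
apply: (iffP forallP) => [ssc r j rR jM|ssc r].
  by have /forallP/(_ (Ordinal jM))/implyP/(_ rR) := ssc (Ordinal (ltnW rR)).
by apply/forallP => j; apply/implyP => rR; apply: ssc.
Qed.

Lemma ssyt_shape_le c r : ssyt c -> arr_shape c r.+1 <= arr_shape c r.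
Proof.
move/ssytP=> ssc; have [rR|Rr] := ltnP r.+1 R; last by rewrite (arr_shape_out c Rr).
rewrite /arr_shape; have [->|M_gt0] := posnP M; first by rewrite /subshape !big_nil.
apply: leq_trans (leq_subshape _ _ (leq_pred M)).
by rewrite -[X in subshape _ X _ <= _](prednK M_gt0) ssc ?prednK.
Qed.

Lemma ssyt_entry_lt c r j : ssyt c -> r < R -> j < M -> j < r -> entry c r j = 0.
Proof.
move/ssytP => ssc rR jM jr.
suff : subshape (entry c) j.+1 r <= 0 by rewrite subshapeS; lia.
elim: j r rR jM jr => [|j IHj] [|r] // rR jM jr.
  by apply: leq_trans (ssc r 0 rR jM) _; rewrite /subshape big_nil.
by apply: leq_trans (ssc r j.+1 rR jM) _; apply: IHj => //; lia.
Qed.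

End Arrays.

Section LatticeArrays.

Variables R L N M B : nat.
Implicit Types (c : array R M B) (x y : 'I_L * 'I_R * 'I_N).

Definition lattice c := [forall k : 'I_L, forall r : 'I_R, forall i : 'I_N,
  (i.+1 < N) ==> ~~ violation R N (entry c) k r i].

Lemma latticeP c : reflect (forall k r i, k < L -> r < R -> i.+1 < N ->
    letters_read R N (entry c) k r.+1 i.+1 <= letters_read R N (entry c) k r i)
  (lattice c).
Proof.
apply: (iffP forallP) => [latc k r i kL rR iN|latc k].
  have /forallP/(_ (Ordinal rR)) := latc (Ordinal kL).
  by move/forallP/(_ (Ordinal (ltnW iN)))/implyP/(_ iN); rewrite /violation -leqNgt.
apply/forallP => r; apply/forallP => i; apply/implyP => iN.
by rewrite /violation -leqNgt; apply: latc.
Qed.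

Definition is_first_violation c (x : 'I_L * 'I_R * 'I_N) :=
  [&& x.2.+1 < N, violation R N (entry c) x.1.1 x.1.2 x.2 &
   [forall k : 'I_L, forall r : 'I_R, forall i : 'I_N,
     ((i.+1 < N) && read_earlier x.1.1 x.1.2 x.2 k r i) ==>
     ~~ violation R N (entry c) k r i]].

Lemma is_first_violationP c x :
  reflect (first_violation R L N (entry c) x.1.1 x.1.2 x.2) (is_first_violation c x).
Proof.
case: x => [[k0 r0] i0] /=; apply: (iffP and3P) => [[i0N viol fst]|[_ _ i0N viol fst]].
  split=> // k r i kL rR iN earlier.
  move/forallP/(_ (Ordinal kL))/forallP/(_ (Ordinal rR)): fst.
  by move/forallP/(_ (Ordinal (ltnW iN)))/implyP; apply; rewrite iN.
split=> //; apply/forallP => k; apply/forallP => r; apply/forallP => i.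
by apply/implyP => /andP[iN earlier]; apply: fst.
Qed.

Lemma is_first_violation_uniq c x y :
  is_first_violation c x -> is_first_violation c y -> x = y.
Proof.
move=> /is_first_violationP fx /is_first_violationP fy.
have [] := first_violation_uniq fx fy.
by case: x y {fx fy} => [[k r] i] [[k' r'] i'] /= /val_inj-> /val_inj-> /val_inj->.
Qed.

Lemma exists_first_violation c : ~~ lattice c -> exists x, is_first_violation c x.
Proof.
move=> not_lattice.
pose bad (x : 'I_L * 'I_R * 'I_N) :=
  (x.2.+1 < N) && violation R N (entry c) x.1.1 x.1.2 x.2.
pose code (x : 'I_L * 'I_R * 'I_N) := (x.1.1 * R + x.1.2) * N + (N - x.2.+1).
have [x0 bad_x0] : exists x, bad x.
  case/forallPn: not_lattice => k /forallPn[r /forallPn[i]].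
  by rewrite negb_imply negbK => viol; exists (k, r, i).
have [x /andP[iN viol] x_min] := arg_minnP code bad_x0; exists x.
apply/and3P; split=> //; apply/forallP => k; apply/forallP => r; apply/forallP => i.
apply/implyP => /andP[iN' earlier]; apply/negP => viol'.
have := x_min (k, r, i); rewrite /bad iN' viol' => /(_ isT).
by rewrite leqNgt (read_earlier_code _ _ _ earlier).
Qed.

Definition flip_array c (x : 'I_L * 'I_R * 'I_N) : array R M B :=
  array_of R M B (flip R N (entry c) x.1.1 x.1.2 x.2
    (violation_gap R N (entry c) x.1.1 x.1.2 x.2)).

Definition lattice_involution c :=
  if [pick x | is_first_violation c x] is Some x then flip_array c x else c.

Lemma lattice_involutionE c x :
  is_first_violation c x -> lattice_involution c = flip_array c x.
Proof.
move=> first_x; rewrite /lattice_involution.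
case: pickP => [y first_y|/(_ x)]; last by rewrite first_x.
by rewrite (is_first_violation_uniq first_x first_y).
Qed.

End LatticeArrays.

Section FlipArray.

Variables (R L N B : nat) (c : array R (L * N) B) (x : 'I_L * 'I_R * 'I_N).
Hypotheses (ssc : ssyt c) (first_x : is_first_violation c x)
  (shape_le : forall r, arr_shape c r <= B).

Let ssv := ssytP _ ssc.
Let first_v := is_first_violationP _ _ first_x.

Lemma entry_flip_array r j : r < R -> j < L * N ->
  entry (flip_array c x) r j = flip R N (entry c) x.1.1 x.1.2 x.2
    (violation_gap R N (entry c) x.1.1 x.1.2 x.2) r j.
Proof.
move=> rR jM; apply: entry_array_of => //; apply: leq_trans (shape_le r).
exact: leq_flip_first.
Qed.

Let i0N := first_violation_letter first_v.
Let k0L := first_violation_group first_v.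
Let tog := first_violation_togglable ssv first_v.

Lemma flip_array_ssyt : ssyt (flip_array c x).
Proof. exact/ssytP/(flip_semistandard i0N k0L ssv tog entry_flip_array). Qed.

Lemma flip_array_shape : arr_shape (flip_array c x) = arr_shape c.
Proof.
apply/funext => r; have [rR|Rr] := ltnP r R; last by rewrite !arr_shape_out.
exact: (subshape_flip_mul i0N k0L ssv tog entry_flip_array).
Qed.

Lemma flip_array_group_content k : k < L ->
  group_content N (arr_content (flip_array c x)) k = group_content N (arr_content c) k.
Proof.
move=> kL; rewrite /group_content exchange_big [RHS]exchange_big /=.
apply: eq_big_nat => r /andP[_ rR].
exact: (flip_group_content i0N k0L ssv tog entry_flip_array).
Qed.

Lemma flip_array_first : is_first_violation (flip_array c x) x.
Proof. exact/is_first_violationP/(flip_first_violation ssv first_v entry_flip_array). Qed.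

Lemma flip_arrayK : flip_array (flip_array c x) x = c.
Proof.
have entryK r j : r < R -> j < L * N ->
    flip R N (entry (flip_array c x)) x.1.1 x.1.2 x.2
      (violation_gap R N (entry (flip_array c x)) x.1.1 x.1.2 x.2) r j = entry c r j.
  move=> rR jM; rewrite (flip_violation_gap ssv first_v entry_flip_array).
  exact: (flipK i0N k0L ssv tog entry_flip_array).
apply: array_ext => r j rR jM.
by rewrite entry_array_of ?entryK //; apply: entry_le.
Qed.

Lemma shift_flip_array_content i : i < N ->
  shift N (letter_content L N (arr_content (flip_array c x))) i =
  swap_at x.2 (shift N (letter_content L N (arr_content c))) i.
Proof. exact: (shift_flip_content ssv first_v entry_flip_array). Qed.

End FlipArray.

Definition agree M (u u' : nat -> nat) : bool := [forall i : 'I_M, u i == u' i].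

Lemma agreeP M u u' : reflect (forall i, i < M -> u i = u' i) (agree M u u').
Proof.
apply: (iffP forallP) => [eq_u i iM|eq_u i]; first exact/eqP/(eq_u (Ordinal iM)).
by rewrite eq_u.
Qed.

Lemma agreexx M u : agree M u u.
Proof. exact/agreeP. Qed.

Lemma agreeC M u u' : agree M u u' = agree M u' u.
Proof. by apply: eq_forallb => i; rewrite eq_sym. Qed.

Lemma eq_agreel M u u' v : agree M u u' -> agree M u v = agree M u' v.
Proof. by move/forallP=> eq_u; apply: eq_forallb => i; rewrite (eqP (eq_u i)). Qed.

Lemma eq_sum_agree M u u' : agree M u u' ->
  \sum_(0 <= i < M) u i = \sum_(0 <= i < M) u' i.
Proof. by move/agreeP => eq_u; apply: eq_big_nat => i /andP[_]; apply: eq_u. Qed.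

(** * Words and class functions of the symmetric group *)

Lemma eq_mul_add N k i k' i' : i < N -> i' < N ->
  (k * N + i == k' * N + i') = (k == k') && (i == i').
Proof.
move=> iN i'N; apply/eqP/andP => [eq_ki|[/eqP-> /eqP->] //]; split; apply/eqP.
  by rewrite -(divn_mul_add k iN) eq_ki divn_mul_add.
by rewrite -(modn_mul_add k iN) eq_ki modn_mul_add.
Qed.

Section Words.

Variables n M : nat.

Definition word := {ffun 'I_n -> 'I_M}.
Implicit Types (f g : word) (s t : 'S_n).

Definition content f (i : nat) := \sum_(x < n) (f x == i :> nat).

Definition fixed s f := [forall x, f (s x) == f x].

Definition permute f t : word := [ffun x => f (t x)].

Lemma content_permute f t : content (permute f t) = content f.
Proof.
apply/funext => i; rewrite /content [RHS](reindex_inj (@perm_inj _ t)) /=.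
by apply: eq_bigr => x _; rewrite ffunE.
Qed.

Lemma content_out f i : M <= i -> content f i = 0.
Proof.
by move=> Mi; apply: big1 => x _; rewrite ltn_eqF // (leq_trans (ltn_ord _)).
Qed.

Lemma sum_content f : \sum_(0 <= i < M) content f i = n.
Proof.
rewrite exchange_big /= -[RHS]card_ord -sum1_card; apply: eq_bigr => x _.
rewrite big_mkord (big_only1 (f x)) ?eqxx // => i ne_i _.
by apply/eqP; rewrite eqb0 eq_sym val_eqE.
Qed.

Lemma fixed_conj s t f : fixed (s ^ t)%g f = fixed s (permute f t).
Proof.
apply/forallP/forallP => fix_f x.
  by have := fix_f (t x); rewrite conjgE !permM permK ![permute f t _]ffunE.
have := fix_f (t^-1%g x); rewrite ![permute f t _]ffunE conjgE !permM.
by rewrite permKV.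
Qed.

Lemma fixedE s f : fixed s f = (permute f s == f).
Proof.
apply/forallP/eqP => [fix_f|fix_f x]; last by rewrite -{2}fix_f ffunE.
by apply/ffunP => x; rewrite ffunE (eqP (fix_f x)).
Qed.

Lemma permuteM f s t : permute f (s * t) = permute (permute f t) s.
Proof. by apply/ffunP => x; rewrite !ffunE permM. Qed.

Lemma card_permute_fiber f t0 :
  #|[set t | permute f t == permute f t0]| = #|[set s | fixed s (permute f t0)]|.
Proof.
rewrite -(card_imset _ (mulIg t0^-1)%g); apply: eq_card => s.
rewrite [RHS]inE fixedE -permuteM; apply/imsetP/idP => [[t]|fix_s].
  by rewrite inE => fix_t ->; rewrite mulgKV.
by exists (s * t0)%g; rewrite ?inE ?mulgK.
Qed.

Lemma card_fixers_permute f t :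
  #|[set s | fixed s (permute f t)]| = #|[set s | fixed s f]|.
Proof.
rewrite -[RHS](card_preimset _ (can_inj (conjgK t))); apply: eq_card => s.
by rewrite !inE fixed_conj.
Qed.

Lemma permute_bij t : bijective (permute^~ t).
Proof.
exists (permute^~ t^-1%g) => f; apply/ffunP => x; rewrite !ffunE.
  by rewrite permKV.
by rewrite permK.
Qed.

Lemma count_mem_word f (i : 'I_M) : count_mem i [tuple f x | x < n] = content f i.
Proof.
rewrite -sum1_count big_mkcond /= big_map big_enum; apply: eq_bigr => x _.
by rewrite /= -val_eqE /=; case: eqP.
Qed.

Lemma agree_content_permute f g : agree M (content f) (content g) ->
  exists t, g = permute f t.
Proof.
move/agreeP => eq_content.
have : perm_eq [tuple g x | x < n] [tuple f x | x < n].
  by apply/allP => i _ /=; rewrite !count_mem_word eq_content.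
case/tuple_permP => t /val_inj gt; exists t; apply/ffunP => x.
by rewrite ffunE -[LHS](tnth_mktuple g) gt !tnth_mktuple.
Qed.

Lemma exists_word u : \sum_(0 <= i < M) u i = n -> exists f, agree M (content f) u.
Proof.
move=> sum_u; pose w := flatten [seq nseq (u (val i)) i | i <- enum 'I_M].
have size_w : size w == n.
  rewrite size_flatten /shape -map_comp sumnE big_map big_enum /=.
  by rewrite -[X in _ == X]sum_u big_mkord; apply/eqP/eq_bigr => i _; rewrite size_nseq.
pose f : word := [ffun x => tnth (Tuple size_w) x].
exists f; apply/agreeP => i iM; rewrite -[i]/(val (Ordinal iM)) -count_mem_word.
have -> : [tuple f x | x < n] = Tuple size_w.
  by apply: eq_from_tnth => x; rewrite tnth_mktuple ffunE.
rewrite /= count_flatten -map_comp sumnE big_map big_enum /=.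
rewrite (big_only1 (Ordinal iM)) //= ?count_nseq /= ?eqxx ?mul1n // => j.
by rewrite count_nseq /= => /negbTE ->.
Qed.

(* Only the parts [u i] with [i < M] and [u i <= n] are meaningful. *)
Definition composition := array 1 M n.
Implicit Types c d : composition.

Definition part c := entry c 0.

Definition is_comp c := \sum_(0 <= i < M) part c i == n.

Definition comp_of (u : nat -> nat) : composition := array_of 1 M n (fun=> u).

Lemma part_out c i : M <= i -> part c i = 0.
Proof. exact: entry_out_col. Qed.

Lemma arr_content_comp c : arr_content c = part c.
Proof. by apply/funext => i; rewrite /arr_content /colsum big_nat1. Qed.

Lemma part_comp_of u : \sum_(0 <= i < M) u i = n -> agree M (part (comp_of u)) u.
Proof.
move=> sum_u; apply/agreeP => i iM; rewrite [LHS]entry_array_of // -sum_u.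
by rewrite big_mkord (bigD1 (Ordinal iM)) //= leq_addr.
Qed.

Lemma is_comp_of u : \sum_(0 <= i < M) u i = n -> is_comp (comp_of u).
Proof. by move=> sum_u; rewrite /is_comp (eq_sum_agree (part_comp_of sum_u)) sum_u. Qed.

Lemma agree_part c d : agree M (part c) (part d) = (c == d).
Proof.
apply/agreeP/eqP => [eq_cd|-> //]; apply: array_ext => -[|r] // i _.
exact: eq_cd.
Qed.

Lemma comp_ofE u c : \sum_(0 <= i < M) u i = n -> (comp_of u == c) = agree M u (part c).
Proof. by move=> sum_u; rewrite -agree_part (eq_agreel _ (part_comp_of sum_u)). Qed.

Lemma part_content f : part (comp_of (content f)) = content f.
Proof.
apply/funext => i; have [iM|Mi] := ltnP i M; last by rewrite part_out ?content_out.
exact: (agreeP _ _ _ (part_comp_of (sum_content f))).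
Qed.

Lemma sum_card_fixers c : is_comp c ->
  \sum_(f | comp_of (content f) == c) #|[set s | fixed s f]| = n`!.
Proof.
move/eqP => sum_c; have [f0 f0c] := exists_word sum_c.
rewrite -card_Sn -sum1_card.
rewrite (partition_big (permute f0) (fun f => comp_of (content f) == c)) /=; last first.
  by move=> t _; rewrite comp_ofE ?sum_content // content_permute.
apply: eq_bigr => f; rewrite comp_ofE ?sum_content // agreeC => f_c.
have [t0 ->] : exists t, f = permute f0 t.
  by apply: agree_content_permute; rewrite (eq_agreel _ f0c).
by rewrite sum1dep_card card_permute_fiber.
Qed.

End Words.

Local Open Scope ring_scope.

Lemma sum_sign_reversing (K : numDomainType) (T : finType) (P : pred T)
    (A : T -> K) (phi : T -> T) :
  (forall c, P c -> [/\ P (phi c), phi (phi c) = c & A (phi c) = - A c]) ->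
  \sum_(c | P c) A c = 0.
Proof.
move=> phiP; set S := \sum_(c | P c) A c.
have S_opp : S = - S.
  rewrite {1}/S (reindex_onto phi phi) /=; last by move=> c /phiP[].
  rewrite -sumrN; apply: eq_big => [c|c].
    apply/andP/idP => [[P_phi /eqP phiK]|Pc]; last by have [-> -> _] := phiP _ Pc.
    by have [+ _ _] := phiP _ P_phi; rewrite phiK.
  case/andP=> P_phi /eqP phiK; have [+ _ _] := phiP _ P_phi.
  by rewrite phiK => /phiP[].
have : S *+ 2 = 0 by rewrite mulr2n {1}S_opp addNr.
by move/eqP; rewrite mulrn_eq0 => /eqP.
Qed.

Definition local_below (T : Type) N (Phi : (nat -> nat) -> T) :=
  forall u u', agree N u u' -> Phi u = Phi u'.

Definition alternating (K : zmodType) N (Phi : (nat -> nat) -> K) :=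
  local_below N Phi /\ forall u i, (i.+1 < N)%N -> Phi (swap_at i u) = - Phi u.

(* Only lattice arrays survive an alternating sum (Stembridge, Bender-Knuth). *)
Lemma sum_lattice (K : numDomainType) R L N M B (nu : nat -> nat)
    (A : (nat -> nat) -> (nat -> nat) -> K) :
  M = (L * N)%N -> (\sum_(0 <= k < L) nu k <= B)%N ->
  (forall shape, alternating N (A shape)) ->
  \sum_(c : array R M B | ssyt c && agree L (group_content N (arr_content c)) nu)
     A (arr_shape c) (shift N (letter_content L N (arr_content c))) =
  \sum_(c : array R M B | [&& ssyt c,
         agree L (group_content N (arr_content c)) nu & lattice L N c])
     A (arr_shape c) (shift N (letter_content L N (arr_content c))).
Proof.
move=> -> nuB altA; rewrite (bigID (@lattice R L N (L * N) B)) /=.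
rewrite [X in _ + X](_ : _ = 0) ?addr0.
  by apply: eq_bigl => c; rewrite andbA.
apply: (@sum_sign_reversing _ _ _ _ (@lattice_involution R L N (L * N) B)) => c.
case/andP=> /andP[ssc groups_c] /exists_first_violation[x first_x].
have shape_le r : (arr_shape c r <= B)%N.
  have [rR|Rr] := ltnP r R; last by rewrite arr_shape_out.
  apply: leq_trans nuB; rewrite -(eq_sum_agree groups_c) sum_group_content.
  by rewrite -sum_arr_shape big_mkord (bigD1 (Ordinal rR)) //= leq_addr.
have first' := flip_array_first ssc first_x shape_le.
rewrite (lattice_involutionE first_x); split.
- have same_groups : agree L (group_content N (arr_content (flip_array c x)))
      (group_content N (arr_content c)).
    by apply/agreeP => k; apply: flip_array_group_content.
  rewrite flip_array_ssyt //= (eq_agreel _ same_groups) groups_c /=.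
  case/is_first_violationP: first' => kL rR iN viol _.
  by apply: contraTN viol => /latticeP lat_c; rewrite /violation -leqNgt lat_c.
- by rewrite (lattice_involutionE first') flip_arrayK.
- have [local_A swap_A] := altA (arr_shape c); rewrite flip_array_shape //.
  have [_ _ i0N _ _] := is_first_violationP _ _ first_x.
  rewrite -(swap_A _ _ i0N); apply: local_A; apply/agreeP => i.
  exact: shift_flip_array_content.
Qed.

Section ContentSum.

Variables n M : nat.
Implicit Types (f : word n M) (s t : 'S_n) (u th : nat -> nat).

Fact content_sum_subproof (Phi : (nat -> nat) -> algC) :
  is_class_fun <<[set: 'S_n]>>%g [ffun s => \sum_(f : word n M | fixed s f) Phi (content f)].
Proof.
rewrite genGid; apply: intro_class_fun => [s t _ _|s]; last by rewrite inE.
rewrite [RHS](reindex (fun f : word n M => permute f t)); last first.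
  exact/onW_bij/permute_bij.
by apply: eq_big => f; rewrite ?fixed_conj // content_permute.
Qed.
Definition content_sum Phi : 'CF([set: 'S_n]) := Cfun 0 (content_sum_subproof Phi).

Definition word_char th := content_sum (fun u => (agree M u th)%:R).

Lemma content_sumE Phi s :
  content_sum Phi s = \sum_(f : word n M | fixed s f) Phi (content f).
Proof. by rewrite cfunElock. Qed.

Lemma word_charE th s :
  word_char th s = #|[set f : word n M | fixed s f & agree M (content f) th]|%:R.
Proof.
rewrite content_sumE -sum1_card natr_sum [RHS]big_mkcond [LHS]big_mkcond /=.
by apply: eq_bigr => f _; rewrite inE; case: fixed; case: agree.
Qed.

Lemma eq_word_char th th' : agree M th th' -> word_char th = word_char th'.
Proof.
move=> eq_th; apply/cfunP => s; rewrite !content_sumE; apply: eq_bigr => f _.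
by rewrite !(agreeC _ (content f)) (eq_agreel _ eq_th).
Qed.

Lemma burnside Phi : \sum_s content_sum Phi s =
  n`!%:R * \sum_(c : composition n M | is_comp c) Phi (part c).
Proof.
under eq_bigr => s _ do rewrite content_sumE.
rewrite (exchange_big_dep xpredT) //=.
rewrite (partition_big (fun f => comp_of n M (content f)) (@is_comp n M)) /=; last first.
  by move=> f _; rewrite is_comp_of ?sum_content.
rewrite mulr_sumr; apply: eq_bigr => c c_comp.
rewrite -(sum_card_fixers c_comp) natr_sum mulr_suml; apply: eq_bigr => f /eqP <-.
rewrite part_content sumr_const mulr_natl; congr (_ *+ _).
by apply: eq_card => s; rewrite inE.
Qed.

Lemma content_sum_expand Phi :
  content_sum Phi = \sum_(c : composition n M | is_comp c) Phi (part c) *: word_char (part c).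
Proof.
apply/cfunP => s; rewrite content_sumE sum_cfunE.
rewrite (partition_big (fun f => comp_of n M (content f)) (@is_comp n M)) /=; last first.
  by move=> f _; rewrite is_comp_of ?sum_content.
apply: eq_bigr => c _; rewrite cfunE content_sumE mulr_sumr [RHS]big_mkcond.
rewrite [LHS]big_mkcond; apply: eq_bigr => f _; rewrite comp_ofE ?sum_content //.
case: (fixed s f) => //=; case: ifP => f_c; rewrite ?mulr0 ?mulr1 //.
by rewrite -(part_content f); congr Phi; congr part; apply/eqP; rewrite comp_ofE ?sum_content.
Qed.

Lemma cfdot_content_sum (phi : 'CF([set: 'S_n])) Phi :
  (forall u, Phi u \is Num.real) ->
  '[phi, content_sum Phi] = n`!%:R^-1 * \sum_s (phi * content_sum Phi) s.
Proof.
move=> Phi_real; rewrite cfdotE cardsT card_Sn; congr (_ * _).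
apply: eq_big => [s|s _]; first by rewrite inE.
by rewrite [RHS]cfunE conj_Creal // content_sumE rpred_sum.
Qed.

Definition relabel (w : 'S_M) u i := if insub i is Some i' then u (val (w i')) else 0%N.

Lemma relabelE (w : 'S_M) u (i : 'I_M) : relabel w u i = u (w i).
Proof. by rewrite /relabel valK. Qed.

Lemma word_char_relabel (w : 'S_M) th : word_char (relabel w th) = word_char th.
Proof.
pose rename (v : 'S_M) (f : word n M) : word n M := [ffun x => v (f x)].
have renameK v : cancel (rename v) (rename v^-1%g).
  by move=> f; apply/ffunP => x; rewrite !ffunE permK.
apply/cfunP => s; rewrite !content_sumE (reindex (rename w^-1%g)) /=; last first.
  by exists (rename w) => f _; have := renameK w^-1%g f; rewrite ?invgK ?renameK.
apply: eq_big => f.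
  by apply: eq_forallb => x; rewrite !ffunE (inj_eq perm_inj).
move=> _; congr (nat_of_bool _)%:R.
have content_rename (i : 'I_M) : content (rename w^-1%g f) i = content f (w i).
  apply: eq_bigr => x _; rewrite ffunE !val_eqE; congr (nat_of_bool _).
  by rewrite (can2_eq (permKV w) (permK w)).
apply/forallP/forallP => eq_th i; last by rewrite content_rename relabelE.
by have := eq_th (w^-1%g i); rewrite content_rename relabelE permKV.
Qed.

End ContentSum.

Section WordProduct.

Variables n M N : nat.

Definition pair_word (f : word n M) (g : word n N) : word n (M * N) :=
  [ffun x => Ordinal (ltn_mul_add (ltn_ord (f x)) (ltn_ord (g x)))].

Lemma val_pair_word f g x : pair_word f g x = (f x * N + g x)%N :> nat.
Proof. by rewrite ffunE. Qed.

Lemma fixed_pair_word s f g : fixed s (pair_word f g) = fixed s f && fixed s g.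
Proof.
have fixedE x : (pair_word f g (s x) == pair_word f g x) =
    (f (s x) == f x) && (g (s x) == g x).
  by rewrite -val_eqE /= !val_pair_word eq_mul_add.
apply/forallP/andP => [fix_fg|[/forallP fix_f /forallP fix_g] x].
  by split; apply/forallP => x; have := fix_fg x; rewrite fixedE => /andP[].
by rewrite fixedE fix_f fix_g.
Qed.

Lemma pair_word_bij : bijective (fun p : word n M * word n N => pair_word p.1 p.2).
Proof.
apply: inj_card_bij => [[f g] [f' g'] /= /ffunP eq_fg|]; last first.
  by rewrite card_prod !card_ffun !card_ord expnMn.
have eq_x x : (f x == f' x) && (g x == g' x).
  have := congr1 val (eq_fg x); rewrite /= !val_pair_word => eq_val.
  by rewrite -!val_eqE /= -(@eq_mul_add N) // eq_val eqxx.
by congr pair; apply/ffunP => x; have /andP[/eqP ? /eqP ?] := eq_x x.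
Qed.

Lemma group_content_pair_word f g :
  agree M (group_content N (content (pair_word f g))) (content f).
Proof.
apply/agreeP => k kM; rewrite /group_content exchange_big /=; apply: eq_bigr => x _.
rewrite big_mkord val_pair_word (big_only1 (g x)) //.
  by rewrite eq_mul_add // eqxx andbT.
move=> i ne_i _; rewrite eq_mul_add //; apply/eqP.
by rewrite eqb0 [X in _ && X]eq_sym val_eqE (negbTE ne_i) andbF.
Qed.

Lemma letter_content_pair_word f g :
  agree N (letter_content M N (content (pair_word f g))) (content g).
Proof.
apply/agreeP => i iN; rewrite /letter_content exchange_big /=; apply: eq_bigr => x _.
rewrite big_mkord val_pair_word (big_only1 (f x)) //; first by rewrite eq_mul_add // eqxx.
move=> k ne_k _; rewrite eq_mul_add //; apply/eqP.
by rewrite eqb0 [X in X && _]eq_sym val_eqE (negbTE ne_k).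
Qed.

Lemma word_char_mul th Psi : local_below N Psi ->
  word_char n M th * content_sum n N Psi = content_sum n (M * N) (fun u =>
    (agree M (group_content N u) th)%:R * Psi (letter_content M N u)).
Proof.
move=> localPsi; apply/cfunP => s; rewrite cfunE !content_sumE big_distrlr pair_big /=.
rewrite [RHS](reindex (fun p => pair_word p.1 p.2)) /=; last exact/onW_bij/pair_word_bij.
apply: eq_big => [[f g]|[f g] _] /=; first by rewrite fixed_pair_word.
rewrite (eq_agreel _ (group_content_pair_word f g)); congr (_ * _).
by apply: localPsi; rewrite agreeC letter_content_pair_word.
Qed.

End WordProduct.

(** * Alternating sums of word characters *)

Definition alternant N (v u : nat -> nat) : algC :=
  \det (\matrix_(i < N, j < N) (u i == v j)%:R).

(* The Jacobi-Trudi alternating sum. *)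
Definition schur_char n N rho : 'CF([set: 'S_n]) :=
  content_sum n N (fun u => alternant N (shift N rho) (shift N u)).

Definition nonincreasing N (u : nat -> nat) : bool :=
  [forall i : 'I_N, (i.+1 < N)%N ==> (u i.+1 <= u i)%N].

Lemma nonincreasingP N u :
  reflect (forall i, (i.+1 < N)%N -> (u i.+1 <= u i)%N) (nonincreasing N u).
Proof.
apply: (iffP forallP) => [dec_u i iN|dec_u i]; last exact/implyP/dec_u.
exact: (implyP (dec_u (Ordinal (ltnW iN)))).
Qed.

Lemma eq_nonincreasing N u u' : agree N u u' -> nonincreasing N u = nonincreasing N u'.
Proof.
move/agreeP => eq_u; apply: eq_forallb => i.
by case: (boolP (i.+1 < N)%N) => //= iN; rewrite !eq_u.
Qed.

Lemma ssyt_nonincreasing R M B (d : array R M B) :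
  ssyt d -> nonincreasing R (arr_shape d).
Proof. by move=> ssd; apply/nonincreasingP => r _; apply: ssyt_shape_le. Qed.

Lemma agree_shift N u v : agree N (shift N u) (shift N v) = agree N u v.
Proof. by apply: eq_forallb => i; rewrite eqn_add2r. Qed.

Lemma alternant_alternating N v : alternating N (alternant N v).
Proof.
split=> [u u' /agreeP eq_u|u i iN].
  by congr (\det _); apply/matrixP => i j; rewrite !mxE eq_u.
pose i0 := Ordinal (ltnW iN); pose i1 := Ordinal iN.
rewrite /alternant; set A := (X in - \det X).
have -> : \matrix_(i2, j) (swap_at i u i2 == v j)%:R = xrow i0 i1 A.
  apply/matrixP => a b; rewrite !mxE /swap_at.
  case: tpermP => [->|->|/eqP ne0 /eqP ne1] /=; rewrite ?eqxx //.
    by rewrite [_ == i]gtn_eqF.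
  by move: ne0 ne1; rewrite -!val_eqE /= => /negbTE -> /negbTE ->.
by rewrite xrowE det_mulmx det_perm odd_tperm -val_eqE /= ltn_eqF // expr1 mulN1r.
Qed.

Lemma alternant_int N v u : alternant N v u \is a Num.int.
Proof.
rewrite /alternant /determinant rpred_sum // => w _; rewrite rpredM ?rpred_sign //.
by rewrite rpred_prod // => i _; rewrite mxE rpred_nat.
Qed.

Lemma alternant_real N v u : alternant N v u \is Num.real.
Proof. by rewrite Rreal_int ?alternant_int. Qed.

Lemma alternant_neq0 N v u : alternant N v u != 0 ->
  exists w : 'S_N, forall i : 'I_N, u i = v (w i).
Proof.
move=> alt_neq0; have [/existsP[w /forallP wP]|/existsPn no_w] :=
  boolP [exists w : 'S_N, forall i : 'I_N, u i == v (w i)].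
  by exists w => i; apply/eqP.
case/eqP: alt_neq0; apply: big1 => w _; case/forallPn: (no_w w) => i /negbTE u_i.
by rewrite (bigD1 i) //= mxE u_i mul0r mulr0.
Qed.

Lemma gtn_sorted_mkseq_shift N u : nonincreasing N u -> sorted gtn (mkseq (shift N u) N).
Proof.
move/nonincreasingP => dec_u; apply/(sortedP 0%N) => i; rewrite size_mkseq => iN.
by rewrite !nth_mkseq ?(ltnW iN) //=; have := dec_u i iN; rewrite /shift; lia.
Qed.

(* Two strictly decreasing sequences with the same set of values coincide. *)
Lemma shift_perm_agree N u v (w : 'S_N) : nonincreasing N u -> nonincreasing N v ->
  (forall i : 'I_N, shift N u i = shift N v (w i)) -> agree N u v.
Proof.
move=> dec_u dec_v u_vw; rewrite -agree_shift; apply/agreeP => i iN.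
suff: mkseq (shift N u) N = mkseq (shift N v) N.
  by move/(congr1 (fun s => nth 0%N s i)); rewrite !nth_mkseq.
apply: (@irr_sorted_eq _ gtn); rewrite ?gtn_sorted_mkseq_shift //.
- by move=> a b c /= ab bc; apply: ltn_trans ab.
- exact: ltnn.
move=> y; apply/mapP/mapP => -[j]; rewrite mem_iota add0n => /andP[_ jN] ->.
  exists (val (w (Ordinal jN))); first by rewrite mem_iota /= add0n.
  exact: (u_vw (Ordinal jN)).
exists (val (w^-1%g (Ordinal jN))); first by rewrite mem_iota /= add0n.
by rewrite u_vw permKV.
Qed.

Lemma alternant_shift N u v : nonincreasing N u -> nonincreasing N v ->
  alternant N (shift N v) (shift N u) = (agree N u v)%:R.
Proof.
move=> dec_u dec_v; have [eq_uv|not_agree] := boolP (agree N u v); last first.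
  apply/eqP; apply: contraNT not_agree => /alternant_neq0[w].
  exact: shift_perm_agree.
rewrite ((alternant_alternating N _).1 _ (shift N v)) ?agree_shift // /alternant.
rewrite (_ : \matrix_(i, j) _ = 1%:M) ?det1 //; apply/matrixP => i j; rewrite !mxE.
congr (nat_of_bool _)%:R; apply/eqP/eqP => [shift_ij|-> //]; apply: val_inj.
have := gtn_sorted_mkseq_shift dec_v.
rewrite gtn_sorted_uniq_geq => /andP[/(uniqP 0%N) inj_shift _].
by apply: inj_shift; rewrite /= ?inE ?size_mkseq ?nth_mkseq.
Qed.

Lemma schur_charE n N rho s : schur_char n N rho s =
  \sum_(f : word n N | fixed s f) alternant N (shift N rho) (shift N (content f)).
Proof. exact: content_sumE. Qed.

Lemma eq_schur_char n N rho si : agree N rho si -> schur_char n N rho = schur_char n N si.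
Proof.
move/agreeP => eq_rho; apply/cfunP => s; rewrite !schur_charE; apply: eq_bigr => f _.
by congr (\det _); apply/matrixP => i j; rewrite !mxE /shift eq_rho.
Qed.

Lemma schur_char_expand n N rho : schur_char n N rho =
  \sum_(c : composition n N | is_comp c)
    alternant N (shift N rho) (shift N (part c)) *: word_char n N (part c).
Proof. exact: content_sum_expand. Qed.

(** * Kostka numbers and orthonormality *)

Section Transposition.

Variables n M N : nat.

Definition unfold_rows (d : array N M n) : composition n (M * N) :=
  array_of 1 (M * N) n (fun _ j => entry d (j %% N) (j %/ N)).

Lemma part_unfold_rows d k i : (k < M)%N -> (i < N)%N ->
  part (unfold_rows d) (k * N + i) = entry d i k.
Proof.
move=> kM iN; rewrite [LHS]entry_array_of ?entry_le ?ltn_mul_add //.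
by rewrite modn_mul_add // divn_mul_add.
Qed.

Lemma unfold_rows_bij : bijective unfold_rows.
Proof.
apply: inj_card_bij => [d d' eq_dd'|]; last first.
  by rewrite !card_ffun !card_prod !card_ord mul1n mulnC.
by apply: array_ext => i k iN kM; rewrite -!part_unfold_rows // eq_dd'.
Qed.

Lemma group_content_unfold_rows d :
  agree M (group_content N (part (unfold_rows d))) (arr_content d).
Proof.
apply/agreeP => k kM; apply: eq_big_nat => i /andP[_ iN]; exact: part_unfold_rows.
Qed.

Lemma letter_content_unfold_rows d k i : (k <= M)%N -> (i < N)%N ->
  letter_content k N (part (unfold_rows d)) i = subshape (entry d) k i.
Proof.
move=> kM iN; apply: eq_big_nat => k' /andP[_ k'k]; apply: part_unfold_rows => //.
exact: leq_trans k'k kM.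
Qed.

Lemma lattice_unfold_rows d : lattice M N (unfold_rows d) = ssyt d.
Proof.
have readE k i : (k <= M)%N -> (i < N)%N ->
    letters_read 1 N (entry (unfold_rows d)) k 0 i = subshape (entry d) k i.
  move=> kM iN; rewrite /letters_read -/(arr_content _) arr_content_comp.
  by rewrite letter_content_unfold_rows // /colsum big_nil addn0.
apply/latticeP/ssytP => [lat_d r j rN jM|ss_d k [|//] i kM _ iN].
  have := lat_d j 0%N r jM isT rN.
  by rewrite -!letters_read_next_group !readE // ltnW.
by rewrite -!letters_read_next_group !readE ?ss_d // ltnW.
Qed.

Lemma sum_lattice_row (K : nmodType) th (F : (nat -> nat) -> K) : local_below N F ->
  \sum_(c : composition n (M * N) |
          agree M (group_content N (part c)) th && lattice M N c)
     F (letter_content M N (part c)) =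
  \sum_(d : array N M n | ssyt d && agree M (arr_content d) th) F (arr_shape d).
Proof.
move=> localF; rewrite (reindex unfold_rows) /=; last exact/onW_bij/unfold_rows_bij.
apply: eq_big => [d|d _]; last first.
  by apply: localF; apply/agreeP => i; apply: letter_content_unfold_rows.
by rewrite lattice_unfold_rows (eq_agreel _ (group_content_unfold_rows d)) andbC.
Qed.

End Transposition.

Lemma ssyt_comp n M (c : composition n M) : ssyt c.
Proof. exact/ssytP. Qed.

Section Kostka.

Variables n M N : nat.

Lemma cfdot_word_schur th rho : (\sum_(0 <= k < M) th k)%N = n ->
  '[word_char n M th, schur_char n N rho] =
  \sum_(d : array N M n | ssyt d && agree M (arr_content d) th)
     alternant N (shift N rho) (shift N (arr_shape d)).
Proof.
move=> sum_th; set alt := alternant N (shift N rho).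
have local_alt : local_below N (fun u => alt (shift N u)).
  by move=> u u' eq_u; apply: (alternant_alternating N _).1; rewrite agree_shift.
rewrite cfdot_content_sum; last by move=> u; apply: alternant_real.
rewrite word_char_mul // burnside mulKf ?pnatr_eq0 -?lt0n ?fact_gt0 //.
rewrite -(@sum_lattice_row n M N _ th _ local_alt).
transitivity (\sum_(c : composition n (M * N) |
    ssyt c && agree M (group_content N (arr_content c)) th)
    alt (shift N (letter_content M N (arr_content c)))).
  rewrite big_mkcond [RHS]big_mkcond; apply: eq_bigr => c _.
  rewrite ssyt_comp arr_content_comp /=; case: ifP => [_|not_comp].
    by case: agree; rewrite ?mul1r ?mul0r.
  case: ifP => // /eq_sum_agree; rewrite sum_group_content sum_th => sum_c.
  by rewrite /is_comp sum_c eqxx in not_comp.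
rewrite (@sum_lattice _ _ _ _ _ _ _ (fun=> alt)) ?sum_th //; last first.
  by move=> _; apply: alternant_alternating.
by apply: eq_big => c; rewrite ?ssyt_comp arr_content_comp.
Qed.

(* The Kostka number K_(rho, th). *)
Lemma cfdot_word_schur_nat th rho : (\sum_(0 <= k < M) th k)%N = n ->
  nonincreasing N rho -> '[word_char n M th, schur_char n N rho] =
  #|[set d : array N M n |
      [&& ssyt d, agree M (arr_content d) th & agree N (arr_shape d) rho]]|%:R.
Proof.
move=> sum_th dec_rho; rewrite cfdot_word_schur // -sum1_card natr_sum.
rewrite big_mkcond [RHS]big_mkcond; apply: eq_bigr => d _; rewrite inE.
case: (boolP (ssyt d)) => //= ssd; rewrite alternant_shift ?ssyt_nonincreasing //.
by case: agree => //=; case: agree.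
Qed.

End Kostka.

Lemma sum_by_content (V : nmodType) n R M (P : pred (array R M n))
    (F : (nat -> nat) -> array R M n -> V) :
  \sum_(c : composition n M | is_comp c)
    \sum_(d | P d && agree M (arr_content d) (part c)) F (part c) d =
  \sum_(d | P d && (\sum_(0 <= j < M) arr_content d j == n)%N) F (arr_content d) d.
Proof.
rewrite (exchange_big_dep (fun d => P d && (\sum_(0 <= j < M) arr_content d j == n)%N))
  /=; last first.
  by move=> c d /eqP sum_c /andP[-> /eq_sum_agree ->]; rewrite sum_c eqxx.
apply: eq_bigr => d /andP[Pd /eqP sum_d].
have part_d : part (comp_of n M (arr_content d)) = arr_content d.
  apply/funext => j; have [jM|Mj] := ltnP j M; last by rewrite part_out ?arr_content_out.
  exact: (agreeP _ _ _ (part_comp_of sum_d)).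
rewrite (big_pred1 (comp_of n M (arr_content d))) ?part_d // => c.
rewrite Pd /= eq_sym comp_ofE //; apply: andb_idl => /eq_sum_agree.
by rewrite sum_d /is_comp => <-.
Qed.

Lemma cfdot_schur_sum n N rho si :
  '[schur_char n N rho, schur_char n N si] =
  \sum_(d : array N N n | ssyt d && (\sum_(0 <= j < N) arr_content d j == n)%N)
    alternant N (shift N rho) (shift N (arr_content d)) *
    alternant N (shift N si) (shift N (arr_shape d)).
Proof.
pose F u (d : array N N n) :=
  alternant N (shift N rho) (shift N u) * alternant N (shift N si) (shift N (arr_shape d)).
rewrite -(sum_by_content (@ssyt N N n) F) schur_char_expand cfdot_suml.
apply: eq_bigr => c /eqP sum_c; by rewrite cfdotZl cfdot_word_schur // mulr_sumr.
Qed.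

Section DiagonalArray.

Variables (n N : nat) (rho : nat -> nat).
Hypotheses (sum_rho : (\sum_(0 <= i < N) rho i)%N = n) (dec_rho : nonincreasing N rho).

Definition diag_array : array N N n :=
  array_of N N n (fun r j => if r == j then rho r else 0%N).

Lemma entry_diag_array r j : (r < N)%N -> (j < N)%N ->
  entry diag_array r j = if r == j then rho r else 0%N.
Proof.
move=> rN jN; rewrite entry_array_of //; case: eqP => // _; rewrite -sum_rho.
by rewrite big_mkord (bigD1 (Ordinal rN)) //= leq_addr.
Qed.

Lemma subshape_diag_array j r : (j <= N)%N -> (r < N)%N ->
  subshape (entry diag_array) j r = if (r < j)%N then rho r else 0%N.
Proof.
move=> jN rN; have /= <- := big_nat1_eq addn (fun=> rho r) r 0 j.
rewrite [RHS]big_mkcond; apply: eq_big_nat => i /andP[_ ij].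
by rewrite entry_diag_array ?(leq_trans ij) // eq_sym.
Qed.

Lemma colsum_diag_array r j : (r <= N)%N -> (j < N)%N ->
  colsum r (entry diag_array) j = if (j < r)%N then rho j else 0%N.
Proof.
move=> rN jN; have /= <- := big_nat1_eq addn (fun=> rho j) j 0 r.
rewrite [RHS]big_mkcond; apply: eq_big_nat => i /andP[_ ir].
by rewrite entry_diag_array ?(leq_trans ir) //; case: eqP => // ->.
Qed.

Lemma diag_array_shape : agree N (arr_shape diag_array) rho.
Proof. by apply/agreeP => r rN; rewrite /arr_shape subshape_diag_array // rN. Qed.

Lemma diag_array_content : agree N (arr_content diag_array) rho.
Proof. by apply/agreeP => j jN; rewrite /arr_content colsum_diag_array // jN. Qed.

Lemma diag_array_ssyt : ssyt diag_array.
Proof.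
apply/ssytP => r j rN jN; rewrite !subshape_diag_array ?(ltnW jN) ?(ltnW rN) // ltnS.
by case: ltnP => // _; apply: (nonincreasingP _ _ dec_rho).
Qed.

Lemma diag_array_lattice : lattice 1 N diag_array.
Proof.
apply/latticeP => -[|//] r i _ rN iN.
rewrite /letters_read /letter_content !big_nil !add0n.
rewrite !colsum_diag_array ?(ltnW rN) ?(ltnW iN) // ltnS.
by case: ltnP => // _; apply: (nonincreasingP _ _ dec_rho).
Qed.

End DiagonalArray.

Lemma lattice_entry_lt N B (d : array N N B) r i : lattice 1 N d ->
  (r < N)%N -> (i < N)%N -> (r < i)%N -> entry d r i = 0%N.
Proof.
move/latticeP => lat_d rN iN ri.
have read_colsum s j : letters_read N N (entry d) 0 s j = colsum s (entry d) j.
  by rewrite /letters_read /letter_content big_nil add0n mul0n.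
suff: (colsum r.+1 (entry d) i <= 0)%N by rewrite colsumS; lia.
elim: r i rN iN ri => [|r IHr] [|i] // rN iN ri.
  have := lat_d 0%N 0%N i isT rN iN.
  by rewrite !read_colsum /colsum big_nil.
have := lat_d 0%N r.+1 i isT rN iN; rewrite !read_colsum => /leq_trans; apply.
by apply: IHr => //; apply: ltnW.
Qed.

Lemma ssyt_lattice_diagonal N B (d : array N N B) r j : ssyt d -> lattice 1 N d ->
  (r < N)%N -> (j < N)%N -> r != j -> entry d r j = 0%N.
Proof.
move=> ssd lat_d rN jN; case: ltngtP => // rj _.
  exact: lattice_entry_lt.
exact: ssyt_entry_lt.
Qed.

Lemma ssyt_lattice_shape N B (d : array N N B) i : ssyt d -> lattice 1 N d ->
  (i < N)%N -> arr_shape d i = entry d i i /\ arr_content d i = entry d i i.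
Proof.
move=> ssd lat_d iN; rewrite /arr_shape /arr_content /subshape /colsum !big_mkord.
rewrite !(big_only1 (Ordinal iN)) // => j; rewrite -val_eqE /= => ne_ji _.
  exact: ssyt_lattice_diagonal.
by rewrite ssyt_lattice_diagonal // eq_sym.
Qed.

Lemma ssyt_lattice_diag_array n N rho (d : array N N n) :
  (\sum_(0 <= i < N) rho i)%N = n -> ssyt d -> lattice 1 N d ->
  agree N (arr_shape d) rho = (d == diag_array n N rho).
Proof.
move=> sum_rho ssd lat_d; apply/idP/eqP => [/agreeP eq_rho|->]; last first.
  exact: diag_array_shape.
apply: array_ext => r j rN jN; rewrite entry_diag_array //.
case: eqP => [<-|/eqP ne_rj]; last exact: ssyt_lattice_diagonal.
by have [<- _] := ssyt_lattice_shape ssd lat_d rN; apply: eq_rho.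
Qed.

Lemma sum_lattice1 (K : numDomainType) R N n
    (A : (nat -> nat) -> (nat -> nat) -> K) :
  (forall shape, alternating N (A shape)) ->
  \sum_(d : array R N n | ssyt d && (\sum_(0 <= j < N) arr_content d j == n)%N)
     A (arr_shape d) (shift N (arr_content d)) =
  \sum_(d : array R N n |
      [&& ssyt d, (\sum_(0 <= j < N) arr_content d j == n)%N & lattice 1 N d])
     A (arr_shape d) (shift N (arr_content d)).
Proof.
move=> alt_A; have := @sum_lattice _ R 1 N N n (fun=> n) A (esym (mul1n N)).
rewrite big_nat1 => /(_ (leqnn n) alt_A).
have letter1 u : letter_content 1 N u = u.
  by apply/funext => i; rewrite /letter_content big_nat1.
have group1 u : agree 1 (group_content N u) (fun=> n) = (\sum_(0 <= j < N) u j == n)%N.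
  by apply/forallP/idP => [/(_ ord0)|sum_u i]; rewrite ?ord1.
under eq_bigl => d do rewrite group1.
under [in RHS]eq_bigl => d do rewrite group1.
under eq_bigr => d _ do rewrite letter1.
by under [in RHS]eq_bigr => d _ do rewrite letter1.
Qed.

Lemma cfdot_schur n N rho si :
  (\sum_(0 <= i < N) rho i)%N = n -> nonincreasing N rho -> nonincreasing N si ->
  '[schur_char n N rho, schur_char n N si] = (agree N rho si)%:R.
Proof.
move=> sum_rho dec_rho dec_si; rewrite cfdot_schur_sum.
pose A (a u : nat -> nat) :=
  alternant N (shift N rho) u * alternant N (shift N si) (shift N a).
rewrite (@sum_lattice1 _ N N n A) => [|a]; last first.
  have [local_alt swap_alt] := alternant_alternating N (shift N rho).
  by split=> [u u' eq_u|u i iN]; rewrite /A ?(local_alt _ _ eq_u) ?swap_alt ?mulNr.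
rewrite (eq_bigr (fun d => ((d == diag_array n N rho) && agree N rho si)%:R)); last first.
  move=> d /and3P[ssd _ lat_d].
  have eq_sc : agree N (arr_shape d) (arr_content d).
    by apply/agreeP => i iN; have [-> ->] := ssyt_lattice_shape ssd lat_d iN.
  have dec_d := ssyt_nonincreasing ssd.
  rewrite /A !alternant_shift // -?(eq_nonincreasing eq_sc) //.
  rewrite -(eq_agreel _ eq_sc) -natrM mulnb ssyt_lattice_diag_array //.
  congr (nat_of_bool _)%:R; case: eqP => //= ->.
  by apply: eq_agreel; apply: diag_array_shape.
rewrite (big_only1 (diag_array n N rho)) ?eqxx // => [|d /negbTE-> //].
rewrite diag_array_ssyt ?diag_array_lattice // andbT /=.
by rewrite (eq_sum_agree (diag_array_content sum_rho)) sum_rho.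
Qed.

Lemma cfdot_word_schur_gt0 n N rho :
  (\sum_(0 <= i < N) rho i)%N = n -> nonincreasing N rho ->
  0 < '[word_char n N rho, schur_char n N rho].
Proof.
move=> sum_rho dec_rho; rewrite cfdot_word_schur_nat // ltr0n.
apply/card_gt0P; exists (diag_array n N rho).
by rewrite inE diag_array_ssyt // diag_array_content // diag_array_shape.
Qed.

(** * Expansions in the alternating sums *)

Definition weight N (u : nat -> nat) := (\sum_(i < N) i * u i)%N.

Lemma eq_weight N u u' : agree N u u' -> weight N u = weight N u'.
Proof. by move/forallP => eq_u; apply: eq_bigr => i _; rewrite (eqP (eq_u i)). Qed.

Lemma weight_tperm_lt N (u : nat -> nat) (i i1 : 'I_N) : i1 = i.+1 :> nat -> (u i < u i1)%N ->
  (weight N (relabel (tperm i i1) u) < weight N u)%N.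
Proof.
move=> i1E lt_u; have ne_i : i1 != i by rewrite -val_eqE /= i1E gtn_eqF.
rewrite /weight (bigD1 i) //= (bigD1 i1) //= [X in (_ < X)%N](bigD1 i) //=.
rewrite [X in (_ < _ + X)%N](bigD1 i1) //= !relabelE tpermL tpermR /=.
rewrite [X in (_ + (_ + X) < _)%N](eq_bigr (fun j : 'I_N => j * u j)%N).
  by rewrite i1E in lt_u *; lia.
by move=> j /andP[ne_ji ne_ji1]; rewrite relabelE tpermD // eq_sym.
Qed.

Lemma sum_mul_perm_lt N (w : 'S_N) : w != 1%g ->
  (\sum_(i < N) i * w i < \sum_(i < N) i * i)%N.
Proof.
move=> w_neq1.
have Cauchy : (\sum_(i < N) 2 * (i * w i) <= \sum_(i < N) (i ^ 2 + w i ^ 2)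
    ?= iff [forall (i | true), nat_of_ord i == w i])%N.
  by apply: leqif_sum => i _; apply: nat_Cauchy.
have sum_squares : (\sum_(i < N) (i ^ 2 + w i ^ 2) = 2 * \sum_(i < N) i * i)%N.
  have -> : (2 * \sum_(i < N) i * i = \sum_(i < N) i ^ 2 + \sum_(i < N) i ^ 2)%N.
    by rewrite addnn -mul2n; congr (_ * _)%N; apply: eq_bigr => i _; rewrite mulnn.
  by rewrite big_split [X in (_ = _ + X)%N](reindex_inj (@perm_inj _ w)).
rewrite -(ltn_pmul2l (isT : (0 < 2)%N)) big_distrr -sum_squares (ltn_leqif Cauchy).
apply: contra w_neq1 => /forallP w_id; apply/eqP/permP => i; rewrite perm1.
exact/esym/val_inj/eqP/w_id.
Qed.

Lemma weight_relabel_lt N u v (w : 'S_N) : w != 1%g ->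
  (forall i : 'I_N, shift N v i = shift N u (w i)) ->
  (weight N (relabel w^-1%g v) < weight N u)%N.
Proof.
move=> w_neq1 v_uw; have winv_neq1 : (w^-1)%g != 1%g by rewrite invg_eq1.
have lt_w := sum_mul_perm_lt winv_neq1.
have eq_vu : (weight N (relabel w^-1%g v) + \sum_(i < N) i * (N - (w^-1)%g i) =
    weight N u + \sum_(i < N) i * (N - i))%N.
  rewrite -!big_split /=; apply: eq_bigr => i _; rewrite -!mulnDr relabelE.
  by have := v_uw ((w^-1)%g i); rewrite permKV /shift => ->.
have split_N (z : 'S_N) :
    (\sum_(i < N) i * (N - z i) + \sum_(i < N) i * z i = \sum_(i < N) i * N)%N.
  by rewrite -big_split /=; apply: eq_bigr => i _; rewrite -mulnDr subnK // ltnW.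
have split_id : (\sum_(i < N) i * (N - i) + \sum_(i < N) i * i = \sum_(i < N) i * N)%N.
  by rewrite -(split_N 1%g); congr (_ + _)%N; apply: eq_bigr => i _; rewrite perm1.
by have := split_N (w^-1)%g; move: lt_w eq_vu split_id; lia.
Qed.

Section SchurBasis.

Variables n N : nat.
Local Notation X := (schur_char n N).

Definition is_partition_comp (c : composition n N) := is_comp c && nonincreasing N (part c).

Definition schur_chars : seq 'CF([set: 'S_n]) :=
  [seq X (part c) | c <- enum is_partition_comp].

Lemma partition_comp_of u : (\sum_(0 <= i < N) u i)%N = n -> nonincreasing N u ->
  is_partition_comp (comp_of n N u).
Proof.
move=> sum_u dec_u; rewrite /is_partition_comp is_comp_of //=.
by rewrite (eq_nonincreasing (part_comp_of sum_u)).
Qed.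

Lemma schur_chars_orthonormal : orthonormal schur_chars.
Proof.
have dotE c d : is_partition_comp c -> is_partition_comp d ->
    '[X (part c), X (part d)] = (c == d)%:R.
  move=> /andP[/eqP sum_c dec_c] /andP[_ dec_d].
  by rewrite cfdot_schur // agree_part.
have inj : {in is_partition_comp &, injective (fun c => X (part c))}.
  move=> c d cP dP eq_cd; apply/eqP; have := dotE c d cP dP.
  by rewrite -eq_cd dotE // eqxx; case: eqP => // _ /eqP; rewrite oner_eq0.
apply/orthonormalP; split.
  by rewrite map_inj_in_uniq ?enum_uniq // => c d; rewrite !mem_enum; apply: inj.
move=> _ _ /mapP[c + ->] /mapP[d + ->]; rewrite !mem_enum => cP dP.
by rewrite dotE // (inj_in_eq inj).
Qed.

Lemma schur_char_span u : (\sum_(0 <= i < N) u i)%N = n -> nonincreasing N u ->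
  X u \in <<schur_chars>>%VS.
Proof.
move=> sum_u dec_u; apply/memv_span/mapP; exists (comp_of n N u).
  by rewrite mem_enum; apply: partition_comp_of.
by apply: eq_schur_char; rewrite agreeC part_comp_of.
Qed.

(* Triangularity: the terms of [X th] other than [word_char n N th] are, up to a
   relabeling, of strictly smaller weight. *)
Lemma word_char_span th : (\sum_(0 <= i < N) th i)%N = n ->
  word_char n N th \in <<schur_chars>>%VS.
Proof.
have [m] := ubnP (weight N th); elim: m th => // m IHm th; rewrite ltnS => th_m sum_th.
have span_relabel (w : 'S_N) u : (\sum_(0 <= i < N) u i)%N = n ->
    (weight N (relabel w u) < weight N th)%N -> word_char n N u \in <<schur_chars>>%VS.
  move=> sum_u lt_u; rewrite -(word_char_relabel _ w); apply: IHm.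
    exact: leq_trans lt_u th_m.
  rewrite -sum_u !big_mkord [RHS](reindex_inj (@perm_inj _ w)).
  by apply: eq_bigr => i _; rewrite relabelE.
have [dec_th|] := boolP (nonincreasing N th); last first.
  case/forallPn => i; rewrite negb_imply -ltnNge => /andP[iN lt_th].
  by apply: (span_relabel (tperm i (Ordinal iN))) => //; apply: weight_tperm_lt.
pose p := comp_of n N th; have p_th : agree N (part p) th := part_comp_of sum_th.
have -> : word_char n N th = X th - \sum_(c : composition n N | is_comp c && (c != p))
    alternant N (shift N th) (shift N (part c)) *: word_char n N (part c).
  rewrite schur_char_expand (bigD1 p) ?is_comp_of //= addrK.
  rewrite alternant_shift ?(eq_nonincreasing p_th) // p_th scale1r.
  by rewrite (eq_word_char _ p_th).
rewrite rpredB ?schur_char_span // rpred_sum // => c /andP[/eqP sum_c ne_cp].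
have [->|/alternant_neq0[w c_w]] :=
  eqVneq (alternant N (shift N th) (shift N (part c))) 0; first by rewrite scale0r rpred0.
apply/rpredZ/(span_relabel w^-1%g) => //; apply: weight_relabel_lt => //.
apply: contra ne_cp => /eqP w1; rewrite eq_sym comp_ofE // -agree_shift agreeC.
by apply/forallP => i; rewrite c_w w1 perm1.
Qed.

Lemma word_char_expand th : (\sum_(0 <= i < N) th i)%N = n ->
  word_char n N th = \sum_(d : array N N n | ssyt d && agree N (arr_content d) th)
    X (arr_shape d).
Proof.
move=> sum_th; have [z -> ->] :=
  orthonormal_span schur_chars_orthonormal (word_char_span sum_th).
have sum_shape (d : array N N n) : agree N (arr_content d) th ->
    (\sum_(0 <= i < N) arr_shape d i)%N = n.
  by move/eq_sum_agree; rewrite sum_arr_shape => ->.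
rewrite big_map big_enum [RHS](partition_big (fun d => comp_of n N (arr_shape d))
  is_partition_comp) /=; last first.
  move=> d /andP[ssd /sum_shape sum_d].
  by rewrite partition_comp_of ?ssyt_nonincreasing.
apply: eq_bigr => c /andP[_ dec_c]; rewrite cfdot_word_schur // scaler_suml.
rewrite [RHS]big_mkcondr; apply: eq_bigr => d /andP[ssd /sum_shape sum_d].
rewrite alternant_shift ?ssyt_nonincreasing // comp_ofE //.
case: ifP => [eq_dc|_]; last by rewrite scale0r.
by rewrite scale1r; apply: eq_schur_char; rewrite agreeC.
Qed.

End SchurBasis.

Lemma letter_content_read_all R L N v i :
  letter_content L N (colsum R v) i = letters_read R N v L 0 i.
Proof. by rewrite /letters_read /colsum [X in (_ + X)%N]big_nil addn0. Qed.

Lemma lattice_content_nonincreasing R L N M B (c : array R M B) : lattice L N c ->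
  nonincreasing N (letter_content L N (arr_content c)).
Proof.
move/latticeP => lat_c; apply/nonincreasingP => i iN.
case: L lat_c => [|L] lat_c; first by rewrite /letter_content !big_nil.
have [R0|R_gt0] := posnP R.
  by rewrite /letter_content !big1 // => k _; rewrite /arr_content /colsum big_geq ?R0.
have read_le := leq_letters_read N (entry c) i (ltnSn L) (leq_pred R).
apply: leq_trans read_le.
rewrite /arr_content letter_content_read_all letters_read_next_group.
by have := lat_c L R.-1 i (ltnSn L); rewrite prednK // => ->.
Qed.

Section KroneckerExpansion.

Variables (n L N : nat) (nu la : nat -> nat).
Hypotheses (sum_nu : (\sum_(0 <= k < L) nu k)%N = n) (dec_la : nonincreasing N la).
Local Notation M := (L * N)%N.

Definition kronecker_array (c : array M M n) :=
  [&& ssyt c, agree L (group_content N (arr_content c)) nu, lattice L N c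
    & agree N (letter_content L N (arr_content c)) la].

Lemma word_schur_mul :
  word_char n L nu * schur_char n N la =
  \sum_(c | kronecker_array c) schur_char n M (arr_shape c).
Proof.
set alt := alternant N (shift N la).
have alt_alternating : alternating N alt by exact: alternant_alternating.
have local_alt : local_below N (fun u => alt (shift N u)).
  by move=> u u' eq_u; apply: alt_alternating.1; rewrite agree_shift.
rewrite word_char_mul // content_sum_expand.
under eq_bigr => c /eqP sum_c do rewrite word_char_expand // scaler_sumr.
pose F u (d : array M M n) := ((agree L (group_content N u) nu)%:R *
  alt (shift N (letter_content L N u))) *: schur_char n M (arr_shape d).
rewrite (sum_by_content (@ssyt M M n) F) {}/F; apply/cfunP => s.
pose A (a u : nat -> nat) := alt u * schur_char n M a s.
transitivity (\sum_(c : array M M n |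
    ssyt c && agree L (group_content N (arr_content c)) nu)
    A (arr_shape c) (shift N (letter_content L N (arr_content c)))).
  rewrite sum_cfunE big_mkcond [RHS]big_mkcond; apply: eq_bigr => c _.
  case: (boolP (ssyt c)) => //= _; rewrite [_ s]cfunE.
  have [groups_c|_] := boolP (agree L _ nu); last by rewrite !mul0r if_same.
  by rewrite -sum_group_content (eq_sum_agree groups_c) sum_nu eqxx mul1r.
rewrite (@sum_lattice _ _ _ _ _ _ _ A) ?sum_nu // => [|a]; last first.
  split=> [u u' /alt_alternating.1 eq_alt|u i iN]; rewrite /A ?eq_alt //.
  by rewrite alt_alternating.2 ?mulNr.
rewrite sum_cfunE [RHS](eq_bigl (fun c => [&& ssyt c,
    agree L (group_content N (arr_content c)) nu & lattice L N c] &&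
    agree N (letter_content L N (arr_content c)) la)); last first.
  by move=> c; rewrite /kronecker_array -!andbA.
rewrite [RHS]big_mkcondr; apply: eq_bigr => c /and3P[_ _ lat_c].
rewrite /A /alt alternant_shift ?(lattice_content_nonincreasing lat_c) //.
by case: agree; rewrite ?mul1r ?mul0r.
Qed.

End KroneckerExpansion.

(** * Young subgroups *)

Lemma content_mkseq n M (f : word n M) (g : nat -> nat) i :
  (forall x : 'I_n, f x = g x :> nat) -> content f i = count_mem i (mkseq g n).
Proof.
move=> fg; rewrite /content -sum1_count [RHS]big_mkcond big_map.
rewrite -[n in iota 0 n]subn0 big_mkord; apply: eq_bigr => x _.
by rewrite /= -fg; case: eqP.
Qed.

Lemma mkseq_reshape_index sh : mkseq (reshape_index sh) (sumn sh) =
  flatten (mkseq (fun i => nseq (nth 0%N sh i) i) (size sh)).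
Proof.
have shapeE : shape (mkseq (fun i => nseq (nth 0%N sh i) i) (size sh)) = sh.
  rewrite /shape -map_comp (eq_map (g := nth 0%N sh)); first exact: mkseq_nth.
  by move=> i /=; rewrite size_nseq.
apply: (@eq_from_nth _ 0%N); first by rewrite size_mkseq size_flatten shapeE.
move=> x; rewrite size_mkseq => x_lt; rewrite nth_mkseq // nth_flatten shapeE.
by rewrite nth_mkseq ?reshape_indexP // nth_nseq reshape_offsetP.
Qed.

Lemma mkseq_reshape_offset sh :
  mkseq (reshape_offset sh) (sumn sh) = flatten [seq iota 0 a | a <- sh].
Proof.
have shapeE : shape [seq iota 0 a | a <- sh] = sh.
  by rewrite /shape -map_comp -[RHS]map_id; apply: eq_map => i /=; rewrite size_iota.
apply: (@eq_from_nth _ 0%N); first by rewrite size_mkseq size_flatten shapeE.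
move=> x; rewrite size_mkseq => x_lt; rewrite nth_mkseq // nth_flatten shapeE.
by rewrite (nth_map 0%N) ?reshape_indexP // nth_iota ?reshape_offsetP.
Qed.

Lemma sumn_map_index (f : nat -> nat) m :
  sumn (mkseq f m) = (\sum_(0 <= i < m) f i)%N.
Proof. by rewrite sumnE big_map /index_iota subn0. Qed.

Section YoungWord.

Variables (n N : nat) (rho : seq nat).
Hypotheses (sum_rho : sumn rho = n) (size_rho : (size rho <= N)%N).

Lemma reshape_index_lt (x : 'I_n) : (reshape_index rho x < N)%N.
Proof. by apply: leq_trans size_rho; rewrite reshape_indexP // sum_rho. Qed.

Definition young_word : word n N := [ffun x => Ordinal (reshape_index_lt x)].

Lemma content_young_word : content young_word = nth 0%N rho.
Proof.
apply/funext => i; rewrite (@content_mkseq _ _ _ (reshape_index rho)) => [|x]; last first.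
  by rewrite ffunE.
rewrite -[X in mkseq _ X]sum_rho mkseq_reshape_index count_flatten -map_comp.
rewrite sumn_map_index; have [i_lt|i_ge] := ltnP i (size rho).
  rewrite (@big_nat_only1 _ _ _ _ _ i) //= => [|j _ /negbTE ne_ji].
    by rewrite count_nseq /= eqxx mul1n.
  by rewrite count_nseq /= ne_ji.
rewrite nth_default // big_nat_cond big1 // => j; rewrite andbT => /andP[_ j_lt].
by rewrite /= count_nseq /= ltn_eqF // (leq_trans j_lt).
Qed.

Lemma mem_young s : (s \in young n rho) = fixed s young_word.
Proof. by rewrite inE; apply: eq_forallb => x; rewrite !ffunE -val_eqE. Qed.

Lemma cfInd_young :
  'Ind[[set: 'S_n]] (1 : 'CF(young n rho)) = word_char n N (nth 0%N rho).
Proof.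
apply/cfunP => s; rewrite cfIndE ?subsetT // word_charE.
rewrite (_ : \sum_(y in _) _ =
    \sum_(y : 'S_n | fixed s (permute young_word y)) 1); last first.
  rewrite [RHS]big_mkcond; apply: eq_big => y; first by rewrite inE.
  by rewrite cfun1E mem_young fixed_conj; case: fixed.
pose P (f : word n N) := fixed s f && agree N (content f) (nth 0%N rho).
rewrite (partition_big (permute young_word) P) /=; last first.
  by move=> y; rewrite /P content_permute content_young_word agreexx => ->.
rewrite (eq_bigr (fun=> #|young n rho|%:R)) => [|f /andP[fix_f f_rho]]; last first.
  have [t f_t] : exists t, f = permute young_word t.
    by apply: agree_content_permute; rewrite content_young_word agreeC.
  rewrite sumr_const f_t; congr _%:R.
  transitivity #|[set y | permute young_word y == permute young_word t]|.
    apply: eq_card => y; rewrite inE; apply: andb_idl => /eqP ->.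
    by rewrite -f_t.
  rewrite card_permute_fiber card_fixers_permute; apply: eq_card => y.
  by rewrite inE mem_young.
rewrite sumr_const mulrnAr mulVf; last first.
  by rewrite pnatr_eq0 -lt0n cardG_gt0.
by congr _%:R; apply: eq_card => f; rewrite inE.
Qed.

End YoungWord.

(** * The irreducible characters of the symmetric group *)

Lemma word_char_char n N th : (\sum_(0 <= i < N) th i)%N = n ->
  word_char n N th \is a character.
Proof.
move=> sum_th; rewrite (@eq_word_char _ _ _ (nth 0%N (mkseq th N))); last first.
  by apply/agreeP => i iN; rewrite nth_mkseq.
by rewrite -cfInd_young ?size_mkseq ?sumn_map_index // cfInd_char ?cfun1_char.
Qed.

Lemma schur_char_irr n N rho : (\sum_(0 <= i < N) rho i)%N = n ->
  nonincreasing N rho -> schur_char n N rho \in irr [set: 'S_n].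
Proof.
move=> sum_rho dec_rho.
have vchar : schur_char n N rho \in 'Z[irr [set: 'S_n]]%g.
  rewrite schur_char_expand; apply: rpred_sum => c /eqP sum_c.
  by apply: scale_zchar; rewrite ?alternant_int // char_vchar ?word_char_char.
have norm1 : '[schur_char n N rho] = 1 by rewrite cfdot_schur // agreexx.
have [[] [i schur_i]] := vchar_norm1P vchar norm1; last first.
  by rewrite schur_i scale1r mem_irr.
have := cfdot_word_schur_gt0 sum_rho dec_rho.
rewrite schur_i expr1 scaleN1r cfdotNr oppr_gt0.
have /natr_ge0 := Cnat_cfdot_char_irr i (word_char_char sum_rho).
by move=> dot_ge0 /(le_lt_trans dot_ge0); rewrite ltxx.
Qed.

Lemma sum_sign_stabiliser (K : numDomainType) n (T : eqType) (h : 'I_n -> T) :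
  \sum_(s : 'S_n | [forall x, h (s x) == h x]) (-1) ^+ odd_perm s =
  (injectiveb h)%:R :> K.
Proof.
have [/injectiveP inj_h|/injectivePn[x [y ne_xy h_xy]]] := boolP (injectiveb h).
  rewrite (big_only1 1%g) ?odd_perm1 //; first by apply/forallP => x; rewrite perm1.
  move=> s /eqP s_neq1 /forallP fix_h; case: s_neq1; apply/permP => x.
  by rewrite perm1; apply/inj_h/eqP.
apply: (@sum_sign_reversing _ _ _ _ (fun s => tperm x y * s)%g) => s /forallP fix_h.
split.
- apply/forallP => z; rewrite permM (eqP (fix_h _)).
  by case: tpermP => [->|->|//]; rewrite h_xy.
- by rewrite mulgA tperm2 mul1g.
- by rewrite odd_mul_tperm ne_xy /= signrN.
Qed.

Lemma sign_charE n s : sign_char n s = (-1) ^+ odd_perm s.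
Proof. by rewrite cfunElock. Qed.

Lemma sign_repr_subproof n :
  mx_repr [set: 'S_n] (fun s : 'S_n => ((-1) ^+ odd_perm s)%:M : 'M[algC]_1).
Proof.
split=> [|s t _ _]; first by rewrite odd_perm1.
by rewrite odd_permM signr_addb -scalar_mxM.
Qed.

Lemma sign_char_char n : sign_char n \is a character.
Proof.
have -> : sign_char n = cfRepr (MxRepresentation (sign_repr_subproof n)).
  apply/cfunP => s; rewrite sign_charE cfunE inE mulr1n /=.
  by rewrite mxtrace_scalar mulr1n.
exact: cfRepr_char.
Qed.

(* Such pairs of words are the 0-1 matrices with row sums th and column sums th'. *)
Definition separating_pairs n M M' th th' : {set word n M * word n M'} :=
  [set p | [&& agree M (content p.1) th, agree M' (content p.2) th' &
    injectiveb (fun x => (p.1 x, p.2 x))]].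

Lemma cfdot_word_sign n M M' th th' :
  '[word_char n M th, sign_char n * word_char n M' th'] =
  n`!%:R^-1 * #|separating_pairs n M M' th th'|%:R.
Proof.
rewrite cfdotE cardsT card_Sn; congr (_ * _).
pose P (p : word n M * word n M') :=
  agree M (content p.1) th && agree M' (content p.2) th'.
transitivity (\sum_(s : 'S_n) \sum_(p | P p && [forall x, (p.1 (s x), p.2 (s x)) ==
    (p.1 x, p.2 x)]) (-1) ^+ odd_perm s : algC).
  apply: eq_big => [s|s _]; first by rewrite inE.
  rewrite [X in _ * X^*]cfunE sign_charE !word_charE rmorphM rmorph_sign rmorph_nat mulrCA.
  rewrite -natrM -cardsX sumr_const mulr_natr; congr (_ *+ _).
  apply: eq_card => -[f g]; rewrite !inE /P /= andbACA andbC; congr (_ && _).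
  apply/andP/forallP => [[/forallP fix_f /forallP fix_g] x|fix_fg].
    by rewrite xpair_eqE fix_f fix_g.
  by split; apply/forallP => x; have := fix_fg x; rewrite xpair_eqE => /andP[].
rewrite (exchange_big_dep P) /=; last by move=> s p _ /andP[].
rewrite -sum1_card natr_sum [RHS](eq_bigl (fun p => P p &&
    injectiveb (fun x => (p.1 x, p.2 x)))); last by move=> p; rewrite inE andbA.
rewrite [RHS]big_mkcondr; apply: eq_bigr => p Pp.
rewrite (eq_bigl (fun s : 'S_n => [forall x, (p.1 (s x), p.2 (s x)) == (p.1 x, p.2 x)])).
  by rewrite (sum_sign_stabiliser _ (fun x => (p.1 x, p.2 x))); case: injectiveb.
by move=> s; rewrite Pp.
Qed.

Lemma geq_trans : transitive geq.
Proof. exact: rev_trans leq_trans. Qed.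

Lemma geq_total : total geq.
Proof. by move=> x y; apply: leq_total. Qed.

Lemma is_part_nth_le s i : is_part s -> (nth 0%N s i.+1 <= nth 0%N s i)%N.
Proof.
case/andP=> /(sortedP 0%N) sorted_s _; have [i_lt|i_ge] := ltnP i.+1 (size s).
  exact: sorted_s.
by rewrite nth_default.
Qed.

Lemma is_part_nonincreasing N s : is_part s -> nonincreasing N (nth 0%N s).
Proof. by move=> s_part; apply/nonincreasingP => i _; apply: is_part_nth_le. Qed.

Lemma sum_nth (s : seq nat) N : (size s <= N)%N ->
  (\sum_(0 <= i < N) nth 0 s i)%N = sumn s.
Proof.
move=> size_s; rewrite sumnE [RHS](big_nth 0%N) [RHS](big_nat_widen _ _ N) // [RHS]big_mkcond.
by apply: eq_bigr => i _; case: ltnP => // /(nth_default 0%N).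
Qed.

Lemma nth_le_sumn s i : (nth 0%N s i <= sumn s)%N.
Proof.
elim: s i => [|a s IHs] [|i] //=; first exact: leq_addr.
exact: leq_trans (IHs i) (leq_addl _ _).
Qed.

Lemma nth_le_head s i : is_part s -> (nth 0%N s i <= head 0%N s)%N.
Proof.
move=> s_part; elim: i => [|i IHi]; first by rewrite nth0.
exact: leq_trans (is_part_nth_le i s_part) IHi.
Qed.

Lemma ltn_count_geq s t j : sorted geq s ->
  (t < count (leq j.+1) s)%N = (j < nth 0 s t)%N.
Proof.
elim: s t => [|a s IHs] t sorted_s /=; first by rewrite nth_nil.
have [ja|aj] := ltnP j a; first by case: t => [|t] //=; rewrite -IHs ?(path_sorted sorted_s).
have s_le x : x \in s -> (x <= j)%N.
  by move=> /(allP (order_path_min geq_trans sorted_s)) /leq_trans; apply.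
rewrite (eq_in_count (a2 := pred0)) ?count_pred0 => [|x /s_le]; last first.
  by rewrite leqNgt => /negbTE.
case: t => [|t] /=; first by rewrite [RHS]ltnNge aj.
have [t_lt|t_ge] := ltnP t (size s); last by rewrite nth_default.
by rewrite [RHS]ltnNge s_le ?mem_nth.
Qed.

Lemma sum_ltn b J : (b <= J)%N -> (\sum_(0 <= j < J) (j < b))%N = b.
Proof.
move=> bJ; transitivity (\sum_(0 <= j < b) 1)%N; last first.
  by rewrite sum_nat_const_nat subn0 muln1.
rewrite [RHS](big_nat_widen _ _ J) // [RHS]big_mkcond.
by apply: eq_bigr => j _; case: ltnP.
Qed.

(* The cells of column j are in the rows i with [j < nth 0 rho i]. *)
Lemma sum_columns rho N (F : nat -> nat) : is_part rho -> (size rho <= N)%N ->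
  (\sum_(0 <= j < head 0 rho) \sum_(0 <= i < count (leq j.+1) rho) F i =
   \sum_(0 <= i < N) F i * nth 0 rho i)%N.
Proof.
move=> rho_part size_rho; have [sorted_rho _] := andP rho_part.
transitivity (\sum_(0 <= j < head 0 rho) \sum_(0 <= i < N) F i * (j < nth 0 rho i))%N.
  apply: eq_bigr => j _.
  rewrite (big_nat_widen _ _ N) ?(leq_trans (count_size _ _)) // big_mkcond.
  by apply: eq_bigr => i _; rewrite /= ltn_count_geq //; case: ltnP; rewrite ?muln1 ?muln0.
rewrite exchange_big; apply: eq_bigr => i _.
by rewrite -big_distrr /= sum_ltn // nth_le_head.
Qed.

Lemma sumn_conj_part rho : is_part rho -> sumn (conj_part rho) = sumn rho.
Proof.
move=> rho_part; rewrite /conj_part sumn_map_index -(sum_nth (leqnn (size rho))).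
under [RHS]eq_bigr => i _ do rewrite -[nth _ _ _]mul1n.
rewrite -sum_columns //; apply: eq_bigr => j _.
by rewrite sum_nat_const_nat subn0 muln1.
Qed.

Lemma nth_conj_part rho j : (j < head 0 rho)%N ->
  nth 0%N (conj_part rho) j = count (leq j.+1) rho.
Proof. by move=> j_lt; rewrite nth_mkseq. Qed.

Lemma sumn_uniq_ge (s : seq nat) : uniq s -> (\sum_(0 <= t < size s) t <= sumn s)%N.
Proof.
move=> uniq_s; have perm_s : perm_eq (sort leq s) s by rewrite perm_sort.
rewrite -(perm_sumn perm_s) -(perm_size perm_s).
have : sorted ltn (sort leq s).
  by rewrite ltn_sorted_uniq_leq sort_uniq uniq_s sort_sorted //; apply: leq_total.
move: (sort leq s) => t sorted_t; rewrite sumnE [leqRHS](big_nth 0%N) !big_nat.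
apply: leq_sum => i /andP[_]; elim: i => // i IHi i_lt.
by apply: leq_ltn_trans (IHi (ltnW i_lt)) _; move/(sortedP 0%N): sorted_t; apply.
Qed.

Lemma ssyt_weight N B (d : array N N B) : ssyt d ->
  (weight N (arr_content d) <= weight N (arr_shape d))%N ->
  agree N (arr_shape d) (arr_content d).
Proof.
move=> ssd.
have -> : weight N (arr_content d) = (\sum_(x : 'I_N * 'I_N) x.1 * entry d x.2 x.1)%N.
  rewrite -(pair_bigA _ (fun j r : 'I_N => j * entry d r j)%N); apply: eq_bigr => j _.
  by rewrite -big_distrr /= /arr_content /colsum big_mkord.
have -> : weight N (arr_shape d) = (\sum_(x : 'I_N * 'I_N) x.2 * entry d x.2 x.1)%N.
  rewrite -(pair_bigA _ (fun j r : 'I_N => r * entry d r j)%N) exchange_big.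
  by apply: eq_bigr => r _; rewrite -big_distrr /= /arr_shape /subshape big_mkord.
have row_le (x : 'I_N * 'I_N) : (x.2 * entry d x.2 x.1 <= x.1 * entry d x.2 x.1)%N.
  have [lt_x|le_x] := ltnP x.1 x.2; first by rewrite (ssyt_entry_lt ssd) ?muln0.
  by rewrite leq_mul2r le_x orbT.
have := @leqif_sum _ xpredT _ _ _ (fun x _ => leqif_eq (row_le x)).
move=> /geq_leqif-> /forallP row_eq.
have diagonal r j : (r < N)%N -> (j < N)%N -> j != r -> entry d r j = 0%N.
  move=> rN jN; case: ltngtP => // [lt_jr|lt_rj] _; first exact: ssyt_entry_lt.
  have := row_eq (Ordinal jN, Ordinal rN); rewrite /= eqn_mul2r => /orP[/eqP //|].
  by rewrite ltn_eqF.
apply/agreeP => i iN; rewrite /arr_shape /arr_content /subshape /colsum.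
rewrite !(@big_nat_only1 _ _ _ _ _ i) // => [r|j] /andP[_ lt_N] ne_i.
  by apply: diagonal => //; rewrite eq_sym.
exact: diagonal.
Qed.

Lemma cfInd_sign_young n N rho : sumn rho = n -> (size rho <= N)%N ->
  'Ind[[set: 'S_n]] ('Res[young n rho] (sign_char n)) =
  sign_char n * word_char n N (nth 0%N rho).
Proof.
move=> sum_rho size_rho.
by rewrite -['Res[_] _]mul1r cfIndM ?subsetT // (cfInd_young sum_rho size_rho) mulrC.
Qed.

Section IrreducibleCharacter.

Variables (n N : nat) (rho : seq nat).
Hypotheses (rho_part : is_part rho) (sum_rho : sumn rho = n) (size_rho : (size rho <= N)%N).

Let rho' := conj_part rho.
Let rho'_n : sumn rho' = n. Proof. by rewrite sumn_conj_part. Qed.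
Let rho_n : (\sum_(0 <= i < N) nth 0 rho i)%N = n. Proof. by rewrite sum_nth. Qed.
Let size_rho' : size rho' = head 0%N rho. Proof. by rewrite size_mkseq. Qed.

Lemma reshape_offset_lt (x : 'I_n) : (reshape_offset rho x < size rho')%N.
Proof.
have x_lt : (x < sumn rho)%N by rewrite sum_rho.
by rewrite size_rho'; apply: leq_trans (reshape_offsetP x_lt) (nth_le_head _ rho_part).
Qed.

Definition column_word : word n (size rho') := [ffun x => Ordinal (reshape_offset_lt x)].

Lemma content_column_word : agree (size rho') (content column_word) (nth 0%N rho').
Proof.
apply/agreeP => j j_lt.
rewrite (@content_mkseq _ _ _ (reshape_offset rho)) => [|x]; last by rewrite ffunE.
rewrite -[X in mkseq _ X]sum_rho mkseq_reshape_offset count_flatten -map_comp sumnE big_map.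
rewrite nth_conj_part -?size_rho' // -sum1_count [RHS]big_mkcond; apply: eq_bigr => a _.
by rewrite /= count_uniq_mem ?iota_uniq // mem_iota; case: ltnP.
Qed.

Lemma separating_pairs_conj :
  (0 < #|separating_pairs n N (size rho') (nth 0%N rho) (nth 0%N rho')|)%N.
Proof.
apply/card_gt0P; exists (young_word sum_rho size_rho, column_word).
rewrite inE /= content_young_word agreexx content_column_word /=.
apply/injectiveP => x y; rewrite !ffunE => -[eq_row eq_col]; apply: val_inj => /=.
by rewrite -(reshape_indexK rho x) -(reshape_indexK rho y) eq_row eq_col.
Qed.

(* The words of a separating pair place distinct letters in each column, so the
   letters of column j sum to at least 0 + 1 + ... + (nth 0 rho' j - 1). *)
Lemma separating_pairs_weight u :
  (0 < #|separating_pairs n N (size rho') u (nth 0%N rho')|)%N ->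
  (weight N (nth 0%N rho) <= weight N u)%N.
Proof.
case/card_gt0P => -[f g]; rewrite inE => /and3P[/= /eq_weight <- /agreeP g_rho'].
move/injectiveP => inj_fg.
have -> : weight N (content f) = (\sum_(x < n) f x)%N.
  rewrite /weight; under eq_bigr => i _ do rewrite big_distrr /=.
  rewrite exchange_big /=; apply: eq_bigr => x _.
  rewrite (big_only1 (f x)) ?eqxx ?muln1 // => i ne_i _.
  by rewrite eq_sym val_eqE (negbTE ne_i) muln0.
rewrite /weight -(big_mkord xpredT (fun i => i * nth 0 rho i)%N) -sum_columns //.
rewrite big_mkord [leqRHS](partition_big (fun x => cast_ord size_rho' (g x)) xpredT) //=.
apply: leq_sum => j _; pose column := [seq val (f x) | x <- enum [pred x | g x == j :> nat]].
have -> : count (leq j.+1) rho = size column.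
  rewrite size_map -cardE -nth_conj_part // -g_rho' ?size_rho' //.
  by rewrite -sum1_card [RHS]big_mkcond; apply: eq_bigr => x _; rewrite inE; case: eqP.
apply: leq_trans (sumn_uniq_ge _) _; last first.
  by rewrite sumnE big_map big_enum.
rewrite map_inj_in_uniq ?enum_uniq // => x y; rewrite !mem_enum !inE.
move=> /eqP g_x /eqP g_y f_xy; apply: inj_fg; congr pair; first exact: val_inj.
by apply: val_inj; rewrite /= g_x g_y.
Qed.

Local Notation sgn_young := ('Ind[[set: 'S_n]] ('Res[young n rho'] (sign_char n))).

Lemma cfdot_word_sgn_young u :
  ('[word_char n N u, sgn_young] != 0) =
  (0 < #|separating_pairs n N (size rho') u (nth 0%N rho')|)%N.
Proof.
rewrite (cfInd_sign_young rho'_n (leqnn _)) cfdot_word_sign.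
by rewrite mulf_eq0 negb_or invr_eq0 !pnatr_eq0 -!lt0n fact_gt0.
Qed.

Lemma irr_constt_word_char i th : (\sum_(0 <= i < N) th i)%N = n ->
  i \in irr_constt (word_char n N th) -> exists d : array N N n,
    [/\ ssyt d, agree N (arr_content d) th & 'chi_i = schur_char n N (arr_shape d)].
Proof.
move=> sum_th; rewrite irr_consttE word_char_expand // cfdot_suml => dot_neq0.
have [d /andP[ssd d_th] dot_d] : exists2 d : array N N n,
    ssyt d && agree N (arr_content d) th & '[schur_char n N (arr_shape d), 'chi_i] != 0.
  apply/exists_inP; apply: contraNT dot_neq0 => /exists_inPn all0; apply/eqP.
  by apply: big1 => d /all0; rewrite negbK => /eqP.
exists d; split=> //.
have sum_d : (\sum_(0 <= r < N) arr_shape d r)%N = n.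
  by rewrite sum_arr_shape (eq_sum_agree d_th).
have /irrP[j schur_j] := schur_char_irr sum_d (ssyt_nonincreasing ssd).
move: dot_d; rewrite schur_j cfdot_irr.
by have [-> //|_] := eqVneq j i; rewrite eqxx.
Qed.

Lemma common_constituent i :
  i \in irr_constt (word_char n N (nth 0%N rho)) -> i \in irr_constt sgn_young ->
  'chi_i = schur_char n N (nth 0%N rho).
Proof.
move=> /(irr_constt_word_char rho_n)[d [ssd d_rho chi_d]] i_sgn.
have sum_d : (\sum_(0 <= r < N) arr_shape d r)%N = n.
  by rewrite sum_arr_shape (eq_sum_agree d_rho).
have i_word : i \in irr_constt (word_char n N (arr_shape d)).
  by rewrite irr_consttE chi_d gt_eqF // cfdot_word_schur_gt0 ?ssyt_nonincreasing.
have : '[word_char n N (arr_shape d), sgn_young] != 0.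
  have sgn_char : sgn_young \is a character by exact/cfInd_char/cfRes_char/sign_char_char.
  apply/eqP => /(constt_ortho_char (word_char_char sum_d) sgn_char i_word i_sgn)/eqP.
  by rewrite cfdot_irr eqxx oner_eq0.
rewrite cfdot_word_sgn_young => /separating_pairs_weight; rewrite -(eq_weight d_rho).
move/(ssyt_weight ssd) => shape_d; rewrite chi_d; apply: eq_schur_char.
by rewrite (eq_agreel _ shape_d).
Qed.

Lemma chi_schur : chi n rho = schur_char n N (nth 0%N rho).
Proof.
rewrite /chi (cfInd_young sum_rho size_rho).
case: pickP => [i /andP[i_word i_sgn]|no_constt]; first exact: common_constituent.
have := separating_pairs_conj; rewrite -cfdot_word_sgn_young cfdot_sum_irr.
rewrite big1 ?eqxx // => i _; have := no_constt i; rewrite !irr_consttE.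
case: eqP => [->|_] /=; first by rewrite mul0r.
by move/negbFE/eqP ->; rewrite conjC0 mulr0.
Qed.

End IrreducibleCharacter.

(** * Coefficients of symmetric functions *)

Fact partition_of_subproof (s : seq nat) : is_part (sort geq (filter (leq 1) s)).
Proof. by rewrite /is_part (sort_sorted geq_total) mem_sort mem_filter. Qed.

Definition partition_of s := IntPart (partition_of_subproof s).

Lemma eq_partition_of s t : perm_eq (filter (leq 1) s) (filter (leq 1) t) ->
  partition_of s = partition_of t.
Proof.
move=> st; apply: val_inj => /=; apply/perm_sortP => //.
- exact: geq_total.
- exact: geq_trans.
- by move=> x y /=; rewrite andbC -eqn_leq => /eqP.
Qed.

Lemma intpartP (ka : intpart) : is_part ka.
Proof. by case: ka. Qed.

Lemma intpart_sorted (ka : intpart) : sorted geq ka.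
Proof. by have /andP[] := intpartP ka. Qed.

Lemma intpart_gt0 (ka : intpart) : all (leq 1) ka.
Proof.
have /andP[_ ka0] := intpartP ka; apply/allP => x x_ka; rewrite lt0n.
by apply: contraNneq ka0 => <-.
Qed.

Lemma filter_intpart (ka : intpart) : filter (leq 1) ka = ka.
Proof. exact/all_filterP/intpart_gt0. Qed.

Lemma partition_ofK (ka : intpart) : partition_of ka = ka.
Proof.
apply: val_inj; rewrite /= filter_intpart.
exact: (sorted_sort geq_trans (intpart_sorted ka)).
Qed.

Lemma partition_ofE s (ka : intpart) :
  (partition_of s == ka) = perm_eq (filter (leq 1) s) ka.
Proof.
apply/eqP/idP => [<-|s_ka]; first by rewrite perm_sym /= perm_sort.
by rewrite -[RHS]partition_ofK; apply: eq_partition_of; rewrite filter_intpart.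
Qed.

Lemma sumn_partition_of s : sumn (partition_of s) = sumn s.
Proof.
rewrite /= (@perm_sumn _ (filter (leq 1) s)); last by rewrite perm_sort.
by elim: s => //= -[|x] s /= ->.
Qed.

Lemma size_intpart_le (ka : intpart) : (size ka <= sumn ka)%N.
Proof.
have := intpart_gt0 ka; elim: (val ka) => //= x s IHs /andP[x_gt0 /IHs].
by rewrite -add1n; apply: leq_add.
Qed.

Lemma mkseq_nth_wide (T : Type) (x0 : T) (s : seq T) m : (size s <= m)%N ->
  mkseq (nth x0 s) m = s ++ nseq (m - size s) x0.
Proof.
move=> size_s; apply: (@eq_from_nth _ x0) => [|i].
  by rewrite size_mkseq size_cat size_nseq subnKC.
rewrite size_mkseq => i_lt; rewrite nth_mkseq // nth_cat nth_nseq if_same.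
by case: ltnP => // /(nth_default x0).
Qed.

Definition parts d : seq intpart := undup
  [seq ka <- [seq partition_of (map val t) | t : d.-tuple 'I_d] | (sumn (part_val ka) < d)%N].

Lemma parts_uniq d : uniq (parts d).
Proof. exact: undup_uniq. Qed.

Lemma mem_parts d (ka : intpart) : (ka \in parts d) = (sumn ka < d)%N.
Proof.
rewrite mem_undup mem_filter andb_idr // => ka_lt.
have nth_lt (i : 'I_d) : (nth 0%N ka i < d)%N := leq_ltn_trans (nth_le_sumn _ _) ka_lt.
apply/imageP; exists [tuple Ordinal (nth_lt i) | i < d] => //.
have -> : map val [tuple Ordinal (nth_lt i) | i < d] = mkseq (nth 0%N ka) d.
  apply: (@eq_from_nth _ 0%N) => [|i]; first by rewrite size_map size_tuple size_mkseq.
  rewrite size_map size_tuple => i_lt.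
  by rewrite (nth_map (Ordinal i_lt)) ?size_tuple // (nth_mktuple _ _ (Ordinal i_lt)) nth_mkseq.
apply/esym/eqP; rewrite partition_ofE mkseq_nth_wide.
  rewrite filter_cat filter_intpart [X in _ ++ X](_ : _ = [::]) ?cats0 //.
  by apply/eqP; rewrite -size_eq0 size_filter count_nseq.
exact: leq_trans (size_intpart_le ka) (ltnW ka_lt).
Qed.

Lemma mdeg_sumn n (m : 'X_{1..n}) : mdeg m = sumn m.
Proof. by rewrite sumnE. Qed.

Lemma mcoeff_kill_last n (p : {mpoly algC[n.+1]}) (k : 'X_{1..n}) :
  (kill_last p)@_k = p@_(mnmwiden k).
Proof.
rewrite {1 2}(mpolyE p) /kill_last (raddf_sum (comp_mpoly _)) !raddf_sum /=.
apply: eq_bigr => m _.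
by rewrite comp_mpolyZ !mcoeffZ -/(kill_last _) kill_lastX mcoeffX.
Qed.

Lemma mcoeff_mnmwiden (f : symfun) n (k : 'X_{1..n}) :
  (f n.+1)@_(mnmwiden k) = (f n)@_k.
Proof.
by have [_ kill_f _] := sf_poly_axiom f; rewrite -(kill_f n) mcoeff_kill_last.
Qed.

Lemma mcoeff_perm (f : symfun) n (m m' : 'X_{1..n}) : perm_eq m m' ->
  (f n)@_m = (f n)@_m'.
Proof.
have [/(_ n)/issymP sym_f _ _] := sf_poly_axiom f; case/tuple_permP => s m_s.
rewrite -[in RHS](sym_f s) mcoeff_sym; congr (_ @_ _).
apply/mnmP => i; rewrite mnmE mnm_tnth (tnth_nth 0%N) m_s -tnth_nth tnth_mktuple.
by rewrite -mnm_tnth.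
Qed.

Definition sf_coef (f : symfun) (ka : seq nat) : algC :=
  (f (size ka))@_[multinom nth 0%N ka i | i < size ka].

Lemma multinom_val n (s : seq nat) : size s = n ->
  [multinom nth 0%N s i | i < n] = s :> seq nat.
Proof.
move=> size_s; apply: (@eq_from_nth _ 0%N) => [|i]; first by rewrite size_tuple.
rewrite size_tuple => i_lt; rewrite -[i]/(val (Ordinal i_lt)) -tnth_nth.
by rewrite -mnm_tnth mnmE.
Qed.

Lemma mcoeff_sf_coef (f : symfun) n (m : 'X_{1..n}) :
  (f n)@_m = sf_coef f (partition_of m).
Proof.
elim: n m => [|n IHn] m.
  have -> : partition_of m = partition_of [::].
    by apply: eq_partition_of; case: m => m; rewrite (tuple0 m).
  by rewrite /sf_coef; congr (_ @_ _); apply/mnmP; case.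
have [m_gt0|/allPn[z z_m]] := boolP (all (leq 1) m).
  have perm_m : perm_eq m (partition_of m).
    by rewrite /= (all_filterP m_gt0) perm_sym perm_sort.
  have size_m : size (partition_of m) = n.+1 by rewrite -(perm_size perm_m) size_tuple.
  rewrite /sf_coef; move: (val (partition_of m)) perm_m size_m => s /= perm_m size_s.
  move: (perm_m); rewrite -[X in perm_eq _ X](multinom_val (erefl (size s))).
  by rewrite size_s; apply: mcoeff_perm.
rewrite -leqNgt leqn0 => /eqP z0; rewrite {z}z0 in z_m.
have perm_m : perm_eq m (rcons (rem 0%N m) 0%N).
  by rewrite perm_sym perm_rcons perm_sym perm_to_rem.
have size_rem_m : size (rem 0%N m) == n by rewrite size_rem // size_tuple.
pose k := Multinom (Tuple size_rem_m).
rewrite (mcoeff_perm f (m' := mnmwiden k)) // mcoeff_mnmwiden IHn.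
congr (sf_coef f _); congr part_val; apply: eq_partition_of => /=.
by have := perm_filter (leq 1) perm_m; rewrite filter_rcons perm_sym.
Qed.

Lemma sf_coef_partition_of f s : sf_coef f s = sf_coef f (partition_of s).
Proof. by rewrite {1}/sf_coef mcoeff_sf_coef multinom_val. Qed.

Lemma sf_coef_deg (f : symfun) d ka : (forall n, msize (f n) <= d)%N ->
  (d <= sumn ka)%N -> sf_coef f ka = 0.
Proof.
move=> size_f d_le; apply: memN_msupp_eq0; apply/negP => /msize_mdeg_lt.
apply/negP; rewrite -leqNgt (leq_trans (size_f _)) // (leq_trans d_le) //.
by rewrite mdeg_sumn multinom_val.
Qed.

Lemma sf_poly_sum (I : Type) (r : seq I) (P : pred I) (F : I -> symfun) n :
  (\sum_(i <- r | P i) F i) n = \sum_(i <- r | P i) F i n.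
Proof. by apply: (big_morph (fun f : symfun => f n)). Qed.

Lemma sf_poly_prod (I : Type) (r : seq I) (P : pred I) (F : I -> symfun) n :
  (\prod_(i <- r | P i) F i) n = \prod_(i <- r | P i) F i n.
Proof. by apply: (big_morph (fun f : symfun => f n)). Qed.

Lemma monomial_expansion (f : symfun) d : (forall n, msize (f n) <= d)%N ->
  f = \sum_(ka <- parts d) sf_coef f ka *: monomial ka.
Proof.
move=> size_f; apply: sf_ext => n; apply/mpolyP => m.
rewrite sf_poly_sum raddf_sum mcoeff_sf_coef /=.
have termE (ka : intpart) : (sf_coef f ka *: monomial ka n)@_m =
    if ka == partition_of m then sf_coef f (partition_of m) else 0.
  rewrite mcoeffZ monos_polyE /mono_pred -partition_ofE eq_sym.
  case: eqP => [->|_]; last by rewrite mulr0.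
  by rewrite sumn_partition_of mdeg_sumn ltnSn mulr1.
rewrite (eq_bigr _ (fun ka _ => termE ka)) -big_mkcond /=.
have [d_le|lt_d] := leqP d (sumn (partition_of m)).
  by rewrite (sf_coef_deg size_f d_le) big1.
rewrite -big_filter (_ : filter _ _ = [:: partition_of m]) ?big_seq1 //.
by rewrite filter_pred1_uniq ?parts_uniq // mem_parts.
Qed.

Lemma hall_hsym (hall : {bilinear symfun -> symfun -> algC | *%R & *%R}) :
  is_hall hall -> forall (ka : intpart) f, hall (hsym ka) f = sf_coef f ka.
Proof.
move=> hallP ka f; have [_ _ [d size_f]] := sf_poly_axiom f.
pose d' := maxn d (sumn ka).+1.
have size_f' n : (msize (f n) <= d')%N by rewrite (leq_trans (size_f n)) // leq_maxl.
rewrite {1}(monomial_expansion size_f') linear_sum /=.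
under eq_bigr => la _ do rewrite linearZ /= hallP.
have ka_d' : ka \in parts d' by rewrite mem_parts leq_max ltnSn orbT.
rewrite (bigD1_seq ka) ?parts_uniq //= eqxx mulr1 big1 ?addr0 // => la /negbTE ne_la.
by rewrite eq_sym ne_la mulr0.
Qed.

(** * Evaluation at roots of unity *)

Lemma sf_evalD f g X : sf_eval (f + g) X = sf_eval f X + sf_eval g X.
Proof. exact: mevalD. Qed.

Lemma sf_evalM f g X : sf_eval (f * g) X = sf_eval f X * sf_eval g X.
Proof. exact: mevalM. Qed.

Lemma sf_evalZ a f X : sf_eval (a *: f) X = a * sf_eval f X.
Proof. exact: mevalZ. Qed.

Lemma sf_eval0 X : sf_eval 0 X = 0.
Proof. exact: meval0. Qed.

Lemma sf_eval1 X : sf_eval 1 X = 1.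
Proof. exact: meval1. Qed.

Lemma sf_evalB f g X : sf_eval (f - g) X = sf_eval f X - sf_eval g X.
Proof. by rewrite sf_evalD -scaleN1r sf_evalZ mulN1r. Qed.

Lemma sf_eval_sum (I : Type) (r : seq I) (P : pred I) (F : I -> symfun) X :
  sf_eval (\sum_(i <- r | P i) F i) X = \sum_(i <- r | P i) sf_eval (F i) X.
Proof.
apply: (big_morph (fun f => sf_eval f X)) => [f g|]; last exact: sf_eval0.
exact: sf_evalD.
Qed.

Lemma sf_evalX f k X : sf_eval (f ^+ k) X = sf_eval f X ^+ k.
Proof.
by elim: k => [|k IHk]; rewrite ?expr0 ?sf_eval1 // !exprS sf_evalM IHk.
Qed.

Lemma poly_nat_roots (K : numDomainType) (p : {poly K}) c m0 :
  (forall m, (m0 <= m)%N -> p.[c + m%:R] = 0) -> p = 0.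
Proof.
move=> roots_p; apply/eqP; apply: contraT => p_neq0.
have := @max_poly_roots _ p [seq c + m%:R | m <- iota m0 (size p)] p_neq0.
rewrite size_map size_iota ltnn; apply.
  apply/allP => x /mapP[m]; rewrite mem_iota => /andP[m_ge _] ->.
  by rewrite /root roots_p.
rewrite map_inj_uniq ?iota_uniq // => a b /addrI /eqP.
by rewrite eqr_nat => /eqP.
Qed.

Definition truncated_geometric (K : nzRingType) J (x : K) : {poly K} := \poly_(a < J.+1) x ^+ a.

Definition truncated_hom_series J (X : seq algC) : {poly algC} :=
  \prod_(x <- X) truncated_geometric J x.

Lemma hom_polyE j J n : (j <= J)%N ->
  Defs.hom j n = \sum_(g : {ffun 'I_n -> 'I_J.+1} | (\sum_(i < n) g i)%N == j)
    'X_[[multinom nat_of_ord (g i) | i < n]].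
Proof.
move=> jJ; apply/mpolyP => m; rewrite monos_polyE raddf_sum /= /hom_pred -mdeg_sumn.
have exponentsE (g : {ffun 'I_n -> 'I_J.+1}) :
    ('X_[[multinom nat_of_ord (g i) | i < n]] : {mpoly algC[n]})@_m =
    [forall i, g i == m i :> nat]%:R.
  rewrite mcoeffX; congr (nat_of_bool _)%:R; apply/eqP/forallP => [<- i|eq_gm].
    by rewrite mnmE.
  by apply/mnmP => i; rewrite mnmE; apply/eqP.
under eq_bigr => g _ do rewrite exponentsE.
have [m_j|ne_j] := eqVneq (mdeg m) j; last first.
  rewrite big1 // => g /eqP g_j; case: forallP => // eq_gm; case/eqP: ne_j.
  by rewrite mdegE -g_j; apply: eq_bigr => i _; rewrite (eqP (eq_gm i)).
have m_lt i : (m i < J.+1)%N.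
  by rewrite ltnS (leq_trans _ jJ) // -m_j mdegE (bigD1 i) //= leq_addr.
rewrite m_j ltnSn (big_only1 [ffun i => Ordinal (m_lt i)]).
- by rewrite (_ : [forall i, _]) //; apply/forallP => i; rewrite ffunE.
- by rewrite -m_j mdegE; apply/eqP/eq_bigr => i _; rewrite ffunE.
- move=> g ne_g _; case: forallP => // eq_gm; case/eqP: ne_g.
  by apply/ffunP => i; apply: val_inj; rewrite ffunE /=; apply/eqP.
Qed.

Lemma hom_eval j J X : (j <= J)%N ->
  sf_eval (Defs.hom j) X = (truncated_hom_series J X)`_j.
Proof.
move=> jJ; rewrite /sf_eval /truncated_hom_series (big_nth 0) big_mkord.
rewrite (hom_polyE _ jJ) (raddf_sum (meval _)) /=.
under [in RHS]eq_bigr => i _ do rewrite /truncated_geometric poly_def.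
rewrite bigA_distr_bigA coef_sum big_mkcond; apply: eq_bigr => g _.
rewrite scaler_prod prodrXr coefZ coefXn mevalX eq_sym.
by case: eqP => _; rewrite ?mulr0 // mulr1; apply: eq_bigr => i _; rewrite mnmE.
Qed.

Lemma mul_truncated_geometric (K : comNzRingType) J (x : K) :
  (1 - x *: 'X) * truncated_geometric J x = 1 - x ^+ J.+1 *: 'X^(J.+1).
Proof.
apply/polyP => i; rewrite mulrBl mul1r -scalerAl coefB coefZ coefXM !coef_poly.
rewrite coefB coef1 coefZ coefXn.
case: i => [|i] /=; first by rewrite mulr0 subr0 expr0 mulr0 subr0.
rewrite add0r ltnS eqSS; have [->|ne_iJ] := eqVneq i J.
  by rewrite ltnn ltnSn !sub0r mulr1 -exprS.
rewrite mulr0 oppr0 ltnS [in X in _ * X]leq_eqVlt (negbTE ne_iJ) /=.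
by case: ltnP => _; rewrite ?mulr0 ?subr0 // -exprS subrr.
Qed.

Lemma roots_of_unity_factor d : (0 < d)%N ->
  'X^d - 1 = \prod_(x <- roots_of_unity d) ('X - x%:P) :> {poly algC}.
Proof.
move=> d_gt0; rewrite /roots_of_unity; case: closed_field_poly_normal => r /= {1}->.
have monic_d : ('X^d - 1 : {poly algC}) \is monic by rewrite monicXnsubC.
by rewrite (monicP monic_d) scale1r.
Qed.

(* The two sides are the reversals of the two sides of [roots_of_unity_factor]. *)
Lemma prod_roots_of_unity d : (0 < d)%N ->
  \prod_(x <- roots_of_unity d) (1 - x *: 'X) = 1 - 'X^d :> {poly algC}.
Proof.
move=> d_gt0; have factor_d := roots_of_unity_factor d_gt0.
have size_d : size (roots_of_unity d) = d.
  by have := size_XnsubC (1 : algC) d_gt0; rewrite factor_d size_prod_XsubC => -[].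
apply/eqP; rewrite -subr_eq0; apply/eqP; apply: (@poly_nat_roots algC _ 1 0) => m _.
have t_neq0 : 1 + m%:R != 0 :> algC by rewrite -[1]/(1%:R) -natrD pnatr_eq0.
move: (1 + m%:R) t_neq0 => t t_neq0; rewrite hornerD hornerN horner_prod.
have -> : \prod_(x <- roots_of_unity d) (1 - x *: 'X).[t] = t ^+ d * ('X^d - 1).[t^-1].
  rewrite factor_d horner_prod -[in t ^+ d]size_d; elim: (roots_of_unity d) => [|x r IHr].
    by rewrite !big_nil expr0 mulr1.
  rewrite !big_cons IHr exprS mulrACA; congr (_ * _).
  by rewrite !hornerE mulrBr divff // mulrC.
by rewrite !hornerE /= mulrBr mulr1 -exprMn divff // expr1n subrr.
Qed.

Lemma hom_roots_cat K X j : (0 < K)%N ->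
  sf_eval (Defs.hom j) (roots_of_unity K ++ X) = sf_eval (Defs.hom j) X +
  (if (K <= j)%N then sf_eval (Defs.hom (j - K)) (roots_of_unity K ++ X) else 0).
Proof.
move=> K_gt0; rewrite !(@hom_eval _ j) // ?leq_subr //.
set Y := roots_of_unity K ++ X.
have seriesE : truncated_hom_series j Y * (1 - 'X^K) =
    (\prod_(x <- roots_of_unity K) (1 - x ^+ j.+1 *: 'X^(j.+1))) *
    truncated_hom_series j X.
  rewrite -(prod_roots_of_unity K_gt0) /truncated_hom_series big_cat mulrAC; congr (_ * _).
  by rewrite -big_split /=; apply: eq_bigr => x _; rewrite mulrC mul_truncated_geometric.
have coef_j (s : seq algC) (p : {poly algC}) :
    (\prod_(x <- s) (1 - x ^+ j.+1 *: 'X^(j.+1)) * p)`_j = p`_j.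
  elim: s => [|x s IHs]; first by rewrite big_nil mul1r.
  rewrite big_cons -mulrA mulrBl mul1r coefB IHs -scalerAl coefZ coefXnM ltnSn.
  by rewrite mulr0 subr0.
move/(congr1 (fun p : {poly algC} => p`_j)): seriesE; rewrite coef_j => <-.
rewrite mulrBr mulr1 coefB coefMXn ltnNge.
by case: (K <= j)%N => /=; rewrite ?subr0 ?addr0 // subrK.
Qed.

Lemma hom0 : Defs.hom 0 = 1.
Proof.
apply: sf_ext => n; apply/mpolyP => m; rewrite monos_polyE /= /hom_pred.
by rewrite -mdeg_sumn mcoeff1 mdeg_eq0; case: eqP => // ->; rewrite mdeg0.
Qed.

Lemma Xi_nseq_cat m K nu :
  Xi (nseq m.+1 K ++ nu) = roots_of_unity K ++ Xi (nseq m K ++ nu).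
Proof. by []. Qed.

Lemma hom_Xi_small m K nu j : (j <= K)%N ->
  sf_eval (Defs.hom j) (Xi (nseq m K.+1 ++ nu)) = sf_eval (Defs.hom j) (Xi nu).
Proof.
move=> jK; elim: m => // m IHm; rewrite -[RHS]IHm Xi_nseq_cat.
by rewrite hom_roots_cat // ltnNge jK addr0.
Qed.

Lemma hom_Xi_big m K nu :
  sf_eval (Defs.hom K.+1) (Xi (nseq m K.+1 ++ nu)) =
  sf_eval (Defs.hom K.+1) (Xi nu) + m%:R.
Proof.
elim: m => [|m IHm]; first by rewrite addr0.
rewrite Xi_nseq_cat hom_roots_cat // leqnn subnn hom0 sf_eval1 IHm -addrA.
by rewrite natr1.
Qed.

(** * Separation of symmetric functions by the multisets Xi *)

(* The subalgebra generated by the complete homogeneous functions of degree at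
   most K. *)
Fixpoint hom_generated K (f : symfun) : Prop :=
  if K is K'.+1 then
    exists P : {poly symfun}, (forall i, hom_generated K' P`_i) /\ f = P.[Defs.hom K]
  else exists a : algC, f = a%:A.

Lemma hom_generated_closed K :
  [/\ forall a, hom_generated K a%:A,
      forall f g, hom_generated K f -> hom_generated K g -> hom_generated K (f + g)
    & forall f g, hom_generated K f -> hom_generated K g -> hom_generated K (f * g)].
Proof.
elim: K => [|K [genA genD genM]] /=.
  split=> [a|_ _ [a ->] [b ->]|_ _ [a ->] [b ->]]; first by exists a.
    by exists (a + b); rewrite scalerDl.
  by exists (a * b); rewrite -scalerAl mul1r scalerA.
have gen0 : hom_generated K 0 by rewrite -(scale0r (1 : symfun)).
split=> [a|_ _ [P [PP ->]] [Q [QP ->]]|_ _ [P [PP ->]] [Q [QP ->]]].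
- by exists (a%:A)%:P; split=> [i|]; rewrite ?hornerC // coefC; case: eqP.
- by exists (P + Q); split=> [i|]; rewrite ?hornerD // coefD; apply: genD.
- exists (P * Q); split=> [i|]; rewrite ?hornerM // coefM.
  by elim/big_ind: _ => // j _; apply: genM.
Qed.

Lemma hom_generated0 K : hom_generated K 0.
Proof. by rewrite -(scale0r (1 : symfun)); case: (hom_generated_closed K). Qed.

Lemma hom_generated1 K : hom_generated K 1.
Proof. by rewrite -(scale1r (1 : symfun)); case: (hom_generated_closed K). Qed.

Lemma hom_generated_sum K (I : Type) (r : seq I) (P : pred I) (a : I -> algC)
    (F : I -> symfun) : (forall i, P i -> hom_generated K (F i)) ->
  hom_generated K (\sum_(i <- r | P i) a i *: F i).
Proof.
move=> genF; have [genA genD genM] := hom_generated_closed K.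
elim/big_ind: _ => [|f g|i Pi]; [exact: hom_generated0|exact: genD|].
by rewrite -mulr_algl; apply: genM => //; apply: genF.
Qed.

Lemma hom_generatedS K f : hom_generated K f -> hom_generated K.+1 f.
Proof.
move=> gen_f; exists f%:P; split=> [i|]; last by rewrite hornerC.
by rewrite coefC; case: eqP => // _; apply: hom_generated0.
Qed.

Lemma hom_generated_hom K j : (j <= K)%N -> hom_generated K (Defs.hom j).
Proof.
elim: K => [|K IHK]; first by rewrite leqn0 => /eqP ->; rewrite hom0; apply: hom_generated1.
rewrite leq_eqVlt => /orP[/eqP ->|jK]; last exact/hom_generatedS/IHK.
exists 'X; split=> [i|]; last by rewrite hornerX.
by rewrite coefX; case: eqP => _; [apply: hom_generated1|apply: hom_generated0].
Qed.

Lemma hom_generated_hsym K (ka : seq nat) : (sumn ka <= K)%N -> hom_generated K (hsym ka).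
Proof.
rewrite /hsym; elim: ka => [|k ka IHka] /=.
  by rewrite big_nil => _; apply: hom_generated1.
move=> ka_K; rewrite big_cons; have [_ _ genM] := hom_generated_closed K.
apply: genM; last exact/IHka/(leq_trans (leq_addl _ _) ka_K).
exact/hom_generated_hom/(leq_trans (leq_addr _ _) ka_K).
Qed.

Lemma hom_generated_eval K f X Y : hom_generated K f ->
  (forall j, (j <= K)%N -> sf_eval (Defs.hom j) X = sf_eval (Defs.hom j) Y) ->
  sf_eval f X = sf_eval f Y.
Proof.
elim: K f => [|K IHK] f /=; first by case=> a -> _; rewrite !sf_evalZ !sf_eval1.
case=> P [PP ->] eq_hom; rewrite horner_coef !sf_eval_sum; apply: eq_bigr => i _.
rewrite !sf_evalM !sf_evalX eq_hom //; congr (_ * _); apply: IHK; first exact: PP.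
by move=> j jK; apply: eq_hom; apply: leqW.
Qed.

Lemma is_part_nseq_cat m K nu : is_part nu -> all (leq^~ K) nu ->
  is_part (nseq m K.+1 ++ nu).
Proof.
case/andP=> sorted_nu nu0 nu_K.
rewrite /is_part mem_cat negb_or mem_nseq /= andbF nu0 !andbT; elim: m => //= m IHm.
rewrite path_sortedE; last exact: geq_trans.
rewrite IHm andbT all_cat all_nseq /= leqnn orbT /=.
by apply: sub_all nu_K => x; apply: leqW.
Qed.

(* Adding m cycles of length K + 1 shifts the value of the generator of degree
   K + 1 by m and fixes those of smaller degree, so each coefficient of a
   polynomial in that generator vanishes at nu. *)
Lemma hom_generated_coef_eval K m0 (P : {poly symfun}) nu i :
  (forall i, hom_generated K P`_i) -> is_part nu -> all (leq^~ K) nu ->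
  (forall ka, is_part ka -> all (leq^~ K.+1) ka -> (m0 <= sumn ka)%N ->
     sf_eval P.[Defs.hom K.+1] (Xi ka) = 0) ->
  sf_eval P`_i (Xi nu) = 0.
Proof.
move=> gen_P nu_part nu_K vanish_P.
pose Q := \poly_(k < size P) sf_eval P`_k (Xi nu).
suff Q0 : Q = 0.
  have := congr1 (fun q : {poly algC} => q`_i) Q0; rewrite coef_poly coef0.
  by case: ltnP => // i_ge _; rewrite nth_default ?sf_eval0.
apply: (@poly_nat_roots _ _ (sf_eval (Defs.hom K.+1) (Xi nu)) m0) => m m_ge.
rewrite -hom_Xi_big horner_poly -[RHS](vanish_P (nseq m K.+1 ++ nu)).
- rewrite horner_coef sf_eval_sum; apply: eq_bigr => k _.
  rewrite sf_evalM sf_evalX; congr (_ * _).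
  by apply: (hom_generated_eval (gen_P k)) => j jK; rewrite hom_Xi_small.
- exact: is_part_nseq_cat.
- rewrite all_cat all_nseq leqnn orbT.
  by apply: sub_all nu_K => x; apply: leqW.
- rewrite sumn_cat sumn_nseq; apply: leq_trans (leq_addr _ _).
  by apply: leq_trans m_ge _; rewrite mulSn leq_addr.
Qed.

Lemma hom_generated_separation K f m0 : hom_generated K.+1 f ->
  (forall nu, is_part nu -> (m0 <= sumn nu)%N -> sf_eval f (Xi nu) = 0) -> f = 0.
Proof.
move=> gen_f vanish_f.
have {vanish_f} : forall nu, is_part nu -> all (leq^~ K.+1) nu -> (m0 <= sumn nu)%N ->
    sf_eval f (Xi nu) = 0 by move=> nu nu_part _; apply: vanish_f.
elim: K f m0 gen_f => [|K IHK] f m0 [P [gen_P ->]] vanish_P;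
  suff -> : P = 0 by rewrite horner0.
- apply/polyP => i; rewrite coef0; have [a Pa] := gen_P i.
  have := @hom_generated_coef_eval 0 _ _ [::] i gen_P isT isT vanish_P.
  by rewrite Pa sf_evalZ sf_eval1 mulr1 => ->; rewrite scale0r.
- apply/polyP => i; rewrite coef0; apply: (IHK _ 0%N (gen_P i)) => nu nu_part nu_K _.
  exact: (@hom_generated_coef_eval K.+1 m0 P nu i gen_P nu_part nu_K vanish_P).
Qed.

Lemma hom_homog k n : Defs.hom k n \is k.-homog.
Proof.
apply/dhomogP => m; rewrite mcoeff_msupp monos_polyE /hom_pred.
case: (sumn m =P k) => [m_k _|_]; last by rewrite eqxx.
exact: etrans (mdeg_sumn m) m_k.
Qed.

Lemma msize_hsym ka n : (msize (hsym ka n) <= (sumn ka).+1)%N.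
Proof.
suff homog_ka : hsym ka n \is (sumn ka).-homog.
  rewrite msizeE; apply/bigmax_leqP_seq => m supp_m _.
  by move/dhomogP: homog_ka => /(_ m supp_m) /= ->.
rewrite /hsym sf_poly_prod; elim: ka => [|k ka IHka] /=.
  by rewrite big_nil; apply: dhomog1.
by rewrite big_cons; apply: dhomogM => //; apply: hom_homog.
Qed.

Section HallForm.

Variables (hall : {bilinear symfun -> symfun -> algC | *%R & *%R}) (d : nat).
Hypothesis hallP : is_hall hall.

Let part_at (i : 'I_(size (parts d))) := tnth (in_tuple (parts d)) i.

Let sumn_part_at i : (sumn (part_at i) < d)%N.
Proof. by rewrite -mem_parts mem_tnth. Qed.

Let monomial_expansion_parts (f : symfun) : (forall n, msize (f n) <= d)%N ->
  f = \sum_i sf_coef f (part_at i) *: monomial (part_at i).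
Proof. by move/monomial_expansion => {1}->; rewrite big_tnth. Qed.

Let hsym_matrix : 'M[algC]_(size (parts d)) :=
  \matrix_(i, j) sf_coef (hsym (part_at i)) (part_at j).

Lemma hsym_monomial i : hsym (part_at i) = \sum_j hsym_matrix i j *: monomial (part_at j).
Proof.
rewrite {1}(@monomial_expansion_parts (hsym (part_at i))).
  by apply: eq_bigr => j _; rewrite mxE.
by move=> n; apply: leq_trans (msize_hsym _ _) (sumn_part_at i).
Qed.

(* A linear relation between the hsym is trivial, as pairing it with a monomial
   function under the Hall form extracts a coefficient. *)
Lemma hsym_matrix_unit : hsym_matrix \in unitmx.
Proof.
rewrite -row_free_unit -kermx_eq0; apply/eqP/row_matrixP => k.
set v := row k _; have ker_v : v *m hsym_matrix = 0 by rewrite -row_mul mulmx_ker row0.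
have relation : \sum_i v 0 i *: hsym (part_at i) = 0.
  under eq_bigr => i _ do rewrite hsym_monomial scaler_sumr.
  rewrite exchange_big big1 //= => j _; under eq_bigr => i _ do rewrite scalerA.
  rewrite -scaler_suml; move/matrixP/(_ 0 j): ker_v; rewrite !mxE => ->.
  by rewrite scale0r.
apply/rowP => j; rewrite row0 [RHS]mxE.
have := linear0l hall (monomial (part_at j)); rewrite -relation linear_sumlz /= => <-.
rewrite (big_only1 j) // => [|i ne_ij _]; rewrite linearZl_LR hallP.
  by rewrite eqxx mulr1.
rewrite (inj_eq (_ : injective part_at)) ?(negbTE ne_ij) ?mulr0 // => a b /eqP.
by rewrite /part_at !(tnth_nth (part_at a)) nth_uniq ?parts_uniq // => /eqP/val_inj.
Qed.

Lemma hom_generated_monomial j : hom_generated d (monomial (part_at j)).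
Proof.
have -> : monomial (part_at j) = \sum_i invmx hsym_matrix j i *: hsym (part_at i).
  under eq_bigr => i _ do rewrite hsym_monomial scaler_sumr.
  rewrite exchange_big /=.
  transitivity (\sum_k (j == k)%:R *: monomial (part_at k)).
    rewrite (big_only1 j) ?eqxx ?scale1r // => k /negbTE ne_kj _.
    by rewrite eq_sym ne_kj scale0r.
  apply: eq_bigr => k _; under eq_bigr => i _ do rewrite scalerA.
  rewrite -scaler_suml; congr (_ *: _).
  by have /matrixP/(_ j k) := mulVmx hsym_matrix_unit; rewrite !mxE.
by apply: hom_generated_sum => i _; apply/hom_generated_hsym/ltnW.
Qed.

Lemma hom_generated_msize (f : symfun) : (forall n, msize (f n) <= d)%N -> hom_generated d f.
Proof.
by move/monomial_expansion_parts ->; apply: hom_generated_sum => i _; apply: hom_generated_monomial.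
Qed.

End HallForm.

Lemma sf_separation (hall : {bilinear symfun -> symfun -> algC | *%R & *%R}) f m0 :
  is_hall hall ->
  (forall nu, is_part nu -> (m0 <= sumn nu)%N -> sf_eval f (Xi nu) = 0) -> f = 0.
Proof.
move=> hallP; have [_ _ [d size_f]] := sf_poly_axiom f.
exact/hom_generated_separation/hom_generatedS/(hom_generated_msize hallP size_f).
Qed.

(** * Power sums and cycle types *)

Section PowerSums.

Variables (n M : nat) (s : 'S_n).

Lemma fixed_porbit (f : word n M) x y : fixed s f -> y \in porbit s x -> f y = f x.
Proof.
move=> /forallP fix_f /porbitP[k ->].
elim: k => [|k IHk]; first by rewrite expg0 perm1.
by rewrite expgSr permM (eqP (fix_f _)).
Qed.

Lemma mpolyX_content (f : word n M) :
  \prod_(x < n) 'X_(f x) = 'X_[[multinom content f i | i < M]] :> {mpoly algC[M]}.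
Proof.
rewrite (mprodXE algC (fun x => U_(f x)%MM)); congr 'X_[_].
by apply/mnmP => i; rewrite mnm_sumE mnmE; apply: eq_bigr => x _; rewrite mnmE.
Qed.

(* A word fixed by s is a choice of one letter for each cycle of s. *)
Lemma prod_porbits (j0 : 'I_M) :
  \prod_(c in porbits s) \sum_(i < M) 'X_i ^+ #|c| =
  \sum_(f : word n M | fixed s f) \prod_(x < n) 'X_(f x) :> {mpoly algC[M]}.
Proof.
rewrite (big_distr_big j0) /=.
pose choice_of (f : word n M) : {ffun {set 'I_n} -> 'I_M} :=
  [ffun c => if c \in porbits s then
     if [pick x in c] is Some x then f x else j0 else j0].
pose word_of (g : {ffun {set 'I_n} -> 'I_M}) : word n M := [ffun x => g (porbit s x)].
have choiceE f x : fixed s f -> choice_of f (porbit s x) = f x.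
  move=> fix_f; rewrite ffunE; have -> : porbit s x \in porbits s by apply: imset_f.
  case: pickP => [y y_x|/(_ x)]; first exact: fixed_porbit.
  by rewrite porbit_id.
rewrite (reindex_onto word_of choice_of) /=; last first.
  by move=> f fix_f; apply/ffunP => x; rewrite ffunE choiceE.
apply: eq_big => [g|g _].
  apply/idP/andP => [/pfamilyP[supp_g _]|[fix_g /eqP <-]]; last first.
    apply/pfamilyP; split=> [|//].
    by apply/supportP => c c_notin; rewrite ffunE (negbTE c_notin).
  have fix_g : fixed s (word_of g).
    apply/forallP => x; rewrite !ffunE; apply/eqP; congr (g _).
    by apply/eqP; rewrite eq_porbit_mem; have := mem_porbit s 1 x; rewrite expg1.
  split=> //; apply/eqP/ffunP => c.
  have [/imsetP[x _ ->]|c_notin] := boolP (c \in porbits s).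
    by rewrite choiceE // ffunE.
  by rewrite ffunE (negbTE c_notin) (supportP supp_g).
rewrite [RHS](partition_big (porbit s) (mem (porbits s))) /=; last first.
  by move=> x _; apply: imset_f.
apply: eq_bigr => c /imsetP[x0 _ ->].
rewrite (eq_bigr (fun _ => 'X_(g (porbit s x0)))) => [|x /eqP <-]; last by rewrite ffunE.
by rewrite prodr_const; congr (_ ^+ _); apply: eq_card => x; rewrite -eq_porbit_mem.
Qed.

End PowerSums.

Lemma psym_porbits n (s : 'S_n) (nu : intpart) M : cycle_type s = nu ->
  psym nu M = \prod_(c in porbits s) \sum_(i < M) 'X_i ^+ #|c|.
Proof.
move=> s_nu; rewrite /psym sf_poly_prod -s_nu.
rewrite (perm_big [seq #|pred_of_set c| | c <- enum (porbits s)]) /=; last first.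
  by rewrite perm_sort.
rewrite big_map big_enum /=; apply: eq_bigr => c /imsetP[x _ ->].
have card_gt0 : (0 < #|porbit s x|)%N by apply/card_gt0P; exists x; apply: porbit_id.
by apply: eq_bigr => i _; rewrite prednK.
Qed.

Lemma psym_coef n (s : 'S_n) (nu : intpart) (ka : seq nat) :
  (0 < size ka)%N -> cycle_type s = nu ->
  sf_coef (psym nu) ka = word_char n (size ka) (nth 0%N ka) s.
Proof.
move=> ka_gt0 s_nu; rewrite /sf_coef (psym_porbits _ s_nu).
rewrite (prod_porbits s (Ordinal ka_gt0)) raddf_sum /= content_sumE.
apply: eq_bigr => f _; rewrite mpolyX_content mcoeffX; congr (nat_of_bool _)%:R.
apply/eqP/agreeP => [/mnmP eq_f i iM|eq_f].
  by have := eq_f (Ordinal iM); rewrite !mnmE.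
by apply/mnmP => i; rewrite !mnmE eq_f.
Qed.

Section CycleType.

Variables (n : nat) (nu : intpart).
Hypothesis nun : sumn nu = n.

Local Notation index x := (reshape_index nu x).
Local Notation offset x := (reshape_offset nu x).

Lemma offset_lt (x : 'I_n) : (offset x < nth 0%N nu (index x))%N.
Proof. by apply: reshape_offsetP; rewrite nun. Qed.

Lemma rotate_offset_lt (x : 'I_n) :
  ((offset x).+1 %% nth 0%N nu (index x) < nth 0%N nu (index x))%N.
Proof. by rewrite ltn_mod; apply: leq_ltn_trans (offset_lt x). Qed.

Lemma rotate_lt (x : 'I_n) :
  (flatten_index nu (index x) ((offset x).+1 %% nth 0%N nu (index x))%N < n)%N.
Proof. by rewrite -[X in (_ < X)%N]nun; apply/flatten_indexP/rotate_offset_lt. Qed.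

Definition rotate (x : 'I_n) : 'I_n := Ordinal (rotate_lt x).

Lemma rotate_index x : index (rotate x) = index x.
Proof. by rewrite flatten_indexKl // rotate_offset_lt. Qed.

Lemma rotate_offset x : offset (rotate x) = ((offset x).+1 %% nth 0%N nu (index x))%N.
Proof. by rewrite flatten_indexKr // rotate_offset_lt. Qed.

Lemma modnS_inj m a b : (a < m)%N -> (b < m)%N -> (a.+1 %% m = b.+1 %% m)%N -> a = b.
Proof.
move=> am bm /eqP; rewrite -[a.+1]addn1 -[b.+1]addn1 eqn_modDr !modn_small //.
by move/eqP.
Qed.

Lemma rotate_inj : injective rotate.
Proof.
move=> x y eq_xy; have eq_index : index x = index y by rewrite -rotate_index eq_xy rotate_index.
apply: val_inj => /=; rewrite -(reshape_indexK nu x) -(reshape_indexK nu y) eq_index.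
congr flatten_index; apply: (@modnS_inj (nth 0%N nu (index y))); rewrite ?offset_lt //.
  by rewrite -eq_index offset_lt.
by rewrite -rotate_offset -eq_xy rotate_offset eq_index.
Qed.

Definition rotation := perm rotate_inj.

Lemma rotation_expg_index k (x : 'I_n) : index ((rotation ^+ k)%g x) = index x.
Proof.
elim: k => [|k IHk]; first by rewrite expg0 perm1.
by rewrite expgSr permM permE rotate_index.
Qed.

Lemma rotation_expg_offset k (x : 'I_n) : (offset x + k < nth 0%N nu (index x))%N ->
  offset ((rotation ^+ k)%g x) = (offset x + k)%N.
Proof.
elim: k => [|k IHk]; first by rewrite expg0 perm1 addn0.
rewrite addnS => k_lt; rewrite expgSr permM permE rotate_offset rotation_expg_index.
by rewrite IHk ?modn_small // ltnW.
Qed.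

Lemma porbit_rotation (x : 'I_n) : porbit rotation x = [set y : 'I_n | index y == index x].
Proof.
have reach (y z : 'I_n) : index y = index z -> (offset y <= offset z)%N ->
    z \in porbit rotation y.
  move=> eq_index le_offset.
  have -> : z = (rotation ^+ (offset z - offset y))%g y; last exact: mem_porbit.
  apply: val_inj; rewrite /= -[LHS](reshape_indexK nu) -[RHS](reshape_indexK nu).
  rewrite rotation_expg_index eq_index rotation_expg_offset subnKC //.
  by rewrite eq_index offset_lt.
apply/setP => y; rewrite inE; apply/idP/eqP => [/porbitP[k ->]|eq_index].
  exact: rotation_expg_index.
have [le_offset|/ltnW le_offset] := leqP (offset x) (offset y); first exact: reach.
by rewrite porbit_sym; apply: reach.
Qed.

Definition block (r : 'I_(size nu)) := [set y : 'I_n | index y == r :> nat].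

Lemma card_block r : #|block r| = nth 0%N nu r.
Proof.
rewrite -(content_young_word nun (leqnn (size nu))) /content -sum1_card big_mkcond /=.
by apply: eq_bigr => x _; rewrite inE ffunE /=; case: eqP.
Qed.

Lemma block_neq0 r : exists x, x \in block r.
Proof. by apply/card_gt0P; rewrite card_block (allP (intpart_gt0 nu)) ?mem_nth. Qed.

Lemma block_inj : injective block.
Proof.
move=> r r' eq_block; have [x x_r] := block_neq0 r.
have := x_r; rewrite eq_block !inE; move: x_r; rewrite inE => /eqP -> /eqP.
exact: val_inj.
Qed.

Lemma porbits_rotation : porbits rotation = [set block r | r : 'I_(size nu)].
Proof.
apply/setP => c; apply/imsetP/imsetP => [[x _ ->]|[r _ ->]].
  have index_x : (index x < size nu)%N by rewrite reshape_indexP // nun.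
  by exists (Ordinal index_x) => //; rewrite porbit_rotation.
have [x x_r] := block_neq0 r; exists x => //; move: x_r; rewrite inE => /eqP index_x.
by rewrite porbit_rotation index_x.
Qed.

Lemma cycle_type_rotation : cycle_type rotation = nu.
Proof.
rewrite /cycle_type; apply: (sorted_eq geq_trans).
- by move=> x y; rewrite /= andbC -eqn_leq => /eqP.
- exact: (sort_sorted geq_total).
- exact: intpart_sorted.
rewrite perm_sort.
have -> : nu = [seq #|pred_of_set c| | c <- [seq block r | r : 'I_(size nu)]] :> seq nat.
  rewrite -map_comp; apply: (@eq_from_nth _ 0%N) => [|i i_lt].
    by rewrite size_map -cardE card_ord.
  rewrite (nth_map (Ordinal i_lt)) /=; last by rewrite -cardE card_ord.
  by rewrite card_block nth_enum_ord.
apply: perm_map; apply: uniq_perm; rewrite ?enum_uniq //.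
  by rewrite map_inj_uniq ?enum_uniq //; apply: block_inj.
by move=> c; rewrite mem_enum porbits_rotation; apply/imsetP/imageP => -[r _ ->]; exists r.
Qed.

End CycleType.

Lemma exists_cycle_type (nu : intpart) : exists s : 'S_(sumn nu), cycle_type s = nu.
Proof. by exists (rotation (erefl (sumn nu))); apply: cycle_type_rotation. Qed.

Lemma cycle_type_is_part n (s : 'S_n) : is_part (cycle_type s).
Proof.
rewrite /is_part (sort_sorted geq_total) mem_sort; apply/mapP => -[c].
rewrite mem_enum => /imsetP[x _ ->] /esym/eqP; apply/negP; rewrite -lt0n.
by apply/card_gt0P; exists x; apply: porbit_id.
Qed.

(** * Lattice words *)

Lemma sum_count_mem_gtn t j : (\sum_(0 <= a < j) count_mem a t = count (gtn j) t)%N.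
Proof.
elim: t => [|x t IHt] /=; first by rewrite big1.
rewrite big_split /= IHt; congr (_ + _)%N; have [xj|jx] := ltnP x j.
  by rewrite (@big_nat_only1 _ _ _ _ _ x) ?eqxx // => a _ /negbTE; rewrite eq_sym => ->.
rewrite big_nat_cond big1 // => a; rewrite andbT => /andP[_ aj].
by rewrite gtn_eqF // (leq_trans aj).
Qed.

Lemma big_count_mem (F : nat -> nat) M t : all (gtn M) t ->
  (\sum_(x <- t) F x = \sum_(0 <= a < M) F a * count_mem a t)%N.
Proof.
elim: t => [|x t IHt] /=; first by rewrite big_nil big1 // => a _; rewrite muln0.
case/andP=> xM tM; rewrite big_cons IHt //.
under [RHS]eq_bigr => a _ do rewrite mulnDr.
rewrite big_split /=; congr (_ + _)%N.
rewrite (@big_nat_only1 _ _ _ _ _ x) ?eqxx ?muln1 // => a _ /negbTE.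
by rewrite eq_sym => ->; rewrite muln0.
Qed.

Lemma nth_lt_count i s x : sorted leq s -> (i < size s)%N ->
  (nth 0 s i < x)%N = (i < count (gtn x) s)%N.
Proof.
have countE : count (gtn x) s = count (< x)%O s by apply: eq_count => y; rewrite /= ltEnat.
move=> sorted_s i_lt; rewrite countE.
have [i_count|count_i] := ltnP i (count (< x)%O s).
  by have := nth_count_lt 0%N sorted_s i_count; rewrite ltEnat.
apply/negbTE; rewrite -leqNgt.
have := @nth_count_ge _ _ x 0%N s i sorted_s; rewrite leEnat count_i; exact.
Qed.

Lemma column_strictP a b M : sorted leq a -> sorted leq b -> (size b <= size a)%N ->
  all (gtn M) b ->
  (forall j, (j < size b)%N -> (nth 0 a j < nth 0 b j)%N) <->
  (forall t, (t < M)%N -> (count (gtn t.+1) b <= count (gtn t) a)%N).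
Proof.
move=> sorted_a sorted_b size_ba bM; split=> [lt_ab t tM|count_ba j j_lt].
  rewrite leqNgt; apply/negP => lt_count; set i := count (gtn t) a in lt_count.
  have i_b : (i < size b)%N := leq_trans lt_count (count_size _ _).
  have := lt_ab i i_b; move: lt_count; rewrite -nth_lt_count // ltnS => b_t a_b.
  by have := leq_trans a_b b_t; rewrite nth_lt_count ?ltnn // (leq_trans i_b).
have t_M : (nth 0 b j < M)%N := allP bM _ (mem_nth _ j_lt).
rewrite nth_lt_count //; last exact: leq_trans j_lt size_ba.
by apply: leq_trans (count_ba _ t_M); rewrite -nth_lt_count.
Qed.

Lemma take_sorted_geq d i : sorted geq d ->
  take (count (leq i) d) d = filter (leq i) d.
Proof.
elim: d => //= x d IHd path_d; have [ix|xi] /= := leqP i x.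
  by congr (_ :: _); rewrite add0n; apply/IHd/(path_sorted path_d).
have none_ge : ~~ has (leq i) d.
  apply/hasPn => y /(allP (order_path_min geq_trans path_d)) yx.
  by rewrite -ltnNge; apply: leq_ltn_trans xi.
have /eqP -> : filter (leq i) d == [::] by rewrite -(negbK (_ == _)) -has_filter.
by move: none_ge; rewrite has_count -leqNgt leqn0 add0n => /eqP ->; rewrite take0.
Qed.

Lemma lattice_word_cat u d : sorted geq d ->
  lattice_word (u ++ d) <-> lattice_word u /\
  (forall i, (0 < i)%N -> (count_mem i.+1 (u ++ d) <= count_mem i u)%N).
Proof.
move=> sorted_d; split=> [lat_ud|[lat_u lat_d] t i i_gt0].
  split=> [t i i_gt0|i i_gt0].
    have [tu|ut] := leqP t (size u).
      by have := lat_ud t i i_gt0; rewrite takel_cat.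
    have := lat_ud (size u) i i_gt0; rewrite take_size_cat // take_oversize //; exact: ltnW.
  have := lat_ud (size u + count (leq i.+1) d)%N i i_gt0.
  rewrite take_cat ltnNge leq_addr /= addKn take_sorted_geq // !count_cat.
  have -> : count_mem i.+1 [seq x <- d | (i < x)%N] = count_mem i.+1 d.
    by rewrite count_filter; apply: eq_count => x /=; case: eqP => // ->; rewrite leqnn.
  rewrite [count_mem i (filter _ _)](_ : _ = 0%N) ?addn0 //.
  by rewrite count_filter (@eq_count _ _ pred0) ?count_pred0 // => x /=; lia.
have [tu|ut] := leqP t (size u); first by rewrite takel_cat //; apply: lat_u.
rewrite take_cat ltnNge (ltnW ut) /= !count_cat.
have := lat_d i i_gt0; rewrite count_cat -{1}(cat_take_drop (t - size u) d) count_cat addnA.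
move=> /(leq_trans (leq_addr _ _)) /leq_trans; apply; exact: leq_addr.
Qed.

Lemma lattice_word_blocks (block : nat -> seq nat) m : (forall b, sorted geq (block b)) ->
  lattice_word (flatten (mkseq block m)) <->
  (forall b i, (b < m)%N -> (0 < i)%N ->
    (\sum_(0 <= b' < b.+1) count_mem i.+1 (block b') <=
     \sum_(0 <= b' < b) count_mem i (block b'))%N).
Proof.
move=> sorted_block.
have countE i m' : count_mem i (flatten (mkseq block m')) =
    (\sum_(0 <= b < m') count_mem i (block b))%N.
  by rewrite count_flatten -map_comp sumn_map_index.
elim: m => [|m IHm]; first by split=> // _ t i _; rewrite /mkseq /= !count_mem_nil.
rewrite mkseqS flatten_rcons; split.
  case/(lattice_word_cat _ (sorted_block m)) => /IHm lat_m lat_last b i.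
  rewrite ltnS leq_eqVlt => /orP[/eqP ->|bm] i_gt0; last exact: lat_m.
  by rewrite -!countE mkseqS flatten_rcons; apply: lat_last.
move=> lat_blocks; apply/lattice_word_cat => //; split.
  by apply/IHm => b i bm; apply: lat_blocks; apply: ltnW.
by move=> i i_gt0; rewrite -flatten_rcons -mkseqS !countE; apply: lat_blocks.
Qed.

Lemma flatten_mkseq_wide (T : Type) (f : nat -> seq T) m m' : (m <= m')%N ->
  (forall r, (m <= r)%N -> f r = [::]) ->
  flatten (mkseq f m') = flatten (mkseq f m).
Proof.
move=> mm' f_nil; rewrite -(subnKC mm').
elim: (m' - m)%N => [|d IHd]; first by rewrite addn0.
by rewrite addnS mkseqS flatten_rcons IHd f_nil ?cats0 // leq_addr.
Qed.

Lemma flatten_mkseq_mul (T : Type) (g : nat -> seq T) L R :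
  flatten (mkseq (fun k => flatten (mkseq (fun r => g (k * R + r)%N) R)) L) =
  flatten (mkseq g (L * R)).
Proof.
elim: L => [|L IHL] //; rewrite mkseqS flatten_rcons IHL mulSn addnC.
rewrite /mkseq iotaD map_cat flatten_cat add0n; congr (_ ++ flatten _).
by rewrite -[in RHS](addn0 (L * R)%N) iotaDl -map_comp.
Qed.

Lemma flatten_map_filter (T S : Type) (p : pred T) (f : T -> seq S) s :
  (forall x, ~~ p x -> f x = [::]) ->
  flatten (map f (filter p s)) = flatten (map f s).
Proof.
move=> f_nil; elim: s => //= x s IHs; case: (boolP (p x)) => px /=; rewrite IHs //.
by rewrite (f_nil _ px).
Qed.

Lemma sum_mul_add (F : nat -> nat) k r R :
  (\sum_(0 <= b < k * R + r) F b =
   \sum_(0 <= k' < k) group_content R F k' + \sum_(0 <= r' < r) F (k * R + r'))%N.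
Proof.
rewrite sum_group_content (@big_cat_nat _ _ _ (k * R)%N) ?leq_addr //=; congr (_ + _)%N.
rewrite -{1}[(k * R)%N]add0n big_addn addKn.
by apply: eq_bigr => i _; rewrite addnC.
Qed.

(** * Labels and codes *)

Lemma count_letters b b' al m : count_mem ((b, m) : letter) (letters b' al) =
  if (b == b') && (0 < m)%N then nth 0%N al m.-1 else 0%N.
Proof.
rewrite /letters count_flatten -map_comp sumn_map_index.
under eq_bigr => i _.
  rewrite /= count_nseq /= xpair_eqE eq_sym [i.+1 == m]eq_sym.
  over.
case: (b == b'); last by rewrite big1.
case: m => [|m]; first by rewrite big1.
have [m_al|al_m] := ltnP m (size al).
  rewrite (@big_nat_only1 _ _ _ _ _ m) //= ?eqxx ?mul1n // => j _ /negbTE.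
  by rewrite eqSS eq_sym => ->.
rewrite nth_default // big_nat_cond big1 // => i; rewrite andbT => /andP[_ i_al].
by rewrite eqSS gtn_eqF // (leq_trans i_al).
Qed.

Lemma size_letters b (al : seq nat) : size (letters b al) = sumn al.
Proof.
rewrite /letters size_flatten /shape -map_comp -[RHS](congr1 sumn (mkseq_nth 0%N al)).
by congr sumn; apply: eq_map => i /=; rewrite size_nseq.
Qed.

(* The label with the unbarred letter k and the barred letter i, where 0 stands
   for no letter. *)
Definition pair_label (k i : nat) : label :=
  (if k is k'.+1 then [:: (true, k) : letter] else [::]) ++
  (if i is i'.+1 then [:: (false, i) : letter] else [::]).

Lemma pair_label_lt k i k' i' :
  label_lt (pair_label k i) (pair_label k' i') =
  (k < k')%N || (k == k') && (i < i')%N.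
Proof.
case: k k' i i' => [|k] [|k'] [|i] [|i'];
  rewrite /label_lt /pair_label /= ?ltxi0s ?ltxis0 //.
all: rewrite ?Order.SeqLexiOrder.ltxi_cons.
all: rewrite ?Order.ProdLexiOrder.leEprodlexi /=.
all: rewrite ?Order.SeqLexiOrder.ltxis0 ?Order.SeqLexiOrder.ltxi0s ?leEnat /=; lia.
Qed.

Lemma unbarred_part_pair_label k i : unbarred_part (pair_label k i) = pair_label k 0.
Proof. by case: k i => [|k] [|i]. Qed.

Lemma barred_pair_label k i : [seq x.2 | x <- filter barred (pair_label k i)] =
  if (0 < i)%N then [:: i] else [::].
Proof. by case: k i => [|k] [|i]. Qed.

Lemma has_unbarred_pair_label k i : has unbarred (pair_label k i) = (0 < k)%N.
Proof. by case: k i => [|k] [|i]. Qed.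

Lemma pair_label0_eq k k' : (pair_label k 0 == pair_label k' 0) = (k == k').
Proof. by case: k k' => [|k] [|k'] //=; apply/eqP/eqP => [[->]|->]. Qed.

Lemma is_label_pair_label k i : (0 < k + i)%N ->
  is_label (pair_label k i) && set_label (pair_label k i).
Proof. by case: k i => [|k] [|i]. Qed.

Lemma pair_labelP (S : label) : is_label S -> set_label S ->
  {in S, forall x, 0 < x.2}%N ->
  exists k i, [/\ (0 < k + i)%N, S = pair_label k i, (0 < k)%N -> (true, k) \in S
    & (0 < i)%N -> (false, i) \in S].
Proof.
move=> /and3P[S_neq0 sorted_S _] /and3P[_ unbarred_S barred_S].
case: S S_neq0 sorted_S unbarred_S barred_S => [|[b a] [|[c d] [|[e f] S]]] // _.
- move=> _ _ _ /(_ _ (mem_head _ _)); case: b a => -[|a] // _.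
    by exists a.+1, 0%N; split; rewrite // inE.
  by exists 0%N, a.+1; split; rewrite // inE.
- case: b c => -[] sorted_S unbarred_S barred_S S_gt0.
  + by move: unbarred_S => /=; lia.
  + have := S_gt0 _ (mem_head _ _); have := S_gt0 (false, d).
    rewrite !inE eqxx orbT => /(_ isT).
    case: a d {sorted_S unbarred_S barred_S S_gt0} => [|a] [|d] // _ _.
    by exists a.+1, d.+1; split; rewrite // !inE eqxx ?orbT.
  + by move: sorted_S.
  + by move: barred_S => /=; lia.
- by case: b c e => -[] [] /=; lia.
Qed.

Lemma count_pair_label k i (b : bool) m : (0 < m)%N ->
  count_mem ((b, m) : letter) (pair_label k i) = (m == if b then k else i) :> nat.
Proof.
case: m b k i => // m [] [|k] [|i] _ //=; rewrite ?addn0 ?add0n.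
all: by rewrite ?xpair_eqE /= ?andbT ?eqSS ?[k == _]eq_sym ?[i == _]eq_sym ?addn0.
Qed.

Definition code_label N j := pair_label (j %/ N) (j %% N).

Lemma ltn_divmod N j j' : (0 < N)%N ->
  (j < j')%N = (j %/ N < j' %/ N)%N || (j %/ N == j' %/ N)%N && (j %% N < j' %% N)%N.
Proof.
move=> N_gt0; case: (ltngtP (j %/ N) (j' %/ N)) => [lt_div|lt_div|eq_div] /=.
- by rewrite ltnNge; apply: contraTN lt_div => /(leq_div2r N); rewrite -leqNgt.
- by apply/negbTE; apply: contraTN lt_div => /ltnW/(leq_div2r N); rewrite -leqNgt.
- by rewrite {1}(divn_eq j N) {1}(divn_eq j' N) eq_div ltn_add2l.
Qed.

Lemma code_label_mul_add N k i : (i < N)%N -> code_label N (k * N + i) = pair_label k i.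
Proof. by move=> iN; rewrite /code_label divn_mul_add // modn_mul_add. Qed.

Lemma code_label_lt N j j' : (0 < N)%N ->
  label_lt (code_label N j) (code_label N j') = (j < j')%N.
Proof. by move=> N_gt0; rewrite pair_label_lt [RHS](@ltn_divmod N). Qed.

Lemma code_label_le N j j' : (0 < N)%N ->
  label_le (code_label N j) (code_label N j') = (j <= j')%N.
Proof. by move=> N_gt0; rewrite leqNgt -(code_label_lt _ _ N_gt0) /label_le leNgt. Qed.

Lemma code_label_inj N : (0 < N)%N -> injective (code_label N).
Proof.
move=> N_gt0 j j' eq_jj'; apply/eqP.
by rewrite eqn_leq -!(code_label_le _ _ N_gt0) eq_jj' /label_le lexx.
Qed.

(** * Coded tableaux *)

Definition decode N (U : seq (seq nat)) : tableau := map (map (code_label N)) U.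

Definition coded_row M t := sorted leq t && all (fun j => 0 < j < M)%N t.

Definition multiplicity (U : seq (seq nat)) (r j : nat) : nat := count_mem j (nth [::] U r).

Lemma coded_row_lt M t : coded_row M t -> all (gtn M) t.
Proof. by case/andP=> _; apply: sub_all => j /andP[]. Qed.

Lemma nth_decode N U r : nth [::] (decode N U) r = map (code_label N) (nth [::] U r).
Proof.
have [r_lt|r_ge] := ltnP r (size U); first by rewrite (nth_map [::]).
by rewrite !nth_default ?size_map.
Qed.

Lemma nth_coded_row M U r : all (coded_row M) U -> coded_row M (nth [::] U r).
Proof.
move=> /allP rows_U; have [r_lt|r_ge] := ltnP r (size U); last by rewrite nth_default.
exact/rows_U/mem_nth.
Qed.

(* The entries j with [j %% N = 0] have no barred letter. *)
Definition group_word N k (s : seq nat) :=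
  filter (leq 1) [seq j %% N | j <- s & j %/ N == k]%N.

Section CodedTableaux.

Variables L N : nat.
Hypotheses (N_gt0 : (0 < N)%N) (L_gt0 : (0 < L)%N).
Local Notation M := (L * N)%N.
Implicit Types (U : seq (seq nat)) (t : seq nat).

Lemma group_word_flatten k ss :
  group_word N k (flatten ss) = flatten (map (group_word N k) ss).
Proof. by rewrite /group_word filter_flatten map_flatten filter_flatten -!map_comp. Qed.

Lemma group_word_rev k s : group_word N k (rev s) = rev (group_word N k s).
Proof. by rewrite /group_word filter_rev map_rev filter_rev. Qed.

Lemma group_word_sorted k t : sorted leq t -> sorted geq (rev (group_word N k t)).
Proof.
move=> sorted_t; rewrite rev_sorted; apply: sorted_filter; first exact: leq_trans.
have := sorted_filter leq_trans (fun j => j %/ N == k)%N sorted_t.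
apply: (homo_sorted_in (P := fun j => j %/ N == k)%N); last exact: filter_all.
move=> x y /eqP x_k /eqP y_k; rewrite {1}(divn_eq x N) {1}(divn_eq y N).
by rewrite x_k y_k leq_add2l.
Qed.

Lemma count_group_word k t i : (0 < i)%N -> (i < N)%N ->
  count_mem i (group_word N k t) = count_mem (k * N + i)%N t.
Proof.
move=> i_gt0 iN; rewrite /group_word count_filter count_map count_filter.
apply: eq_count => j /=.
apply/andP/eqP => [[/andP[/eqP <- _] /eqP <-]|->]; first by rewrite -divn_eq.
by rewrite modn_mul_add // divn_mul_add // !eqxx.
Qed.

Lemma count_group_word_out k t i : (N <= i)%N -> count_mem i (group_word N k t) = 0%N.
Proof.
move=> Ni; apply/count_memPn; rewrite mem_filter; apply/negP => /andP[_ /mapP[j _ i_j]].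
by move: Ni; rewrite i_j leqNgt ltn_pmod.
Qed.

Lemma reading_decode U : reading (decode N U) = map (code_label N) (flatten (map rev U)).
Proof.
rewrite /reading /decode map_flatten -!map_comp; congr flatten; apply: eq_map => t /=.
by rewrite map_rev.
Qed.

Lemma read_word_decode U k :
  read_word (decode N U) (pair_label k 0) = group_word N k (flatten (map rev U)).
Proof.
rewrite /read_word reading_decode filter_map -map_comp /group_word.
rewrite (eq_filter (a2 := fun j => j %/ N == k)%N); last first.
  by move=> j /=; rewrite unbarred_part_pair_label pair_label0_eq.
elim: (filter _ _) => //= j s IHs; rewrite /code_label barred_pair_label IHs.
by case: posnP.
Qed.

Lemma unbarred_parts_decode U : all (coded_row M) U ->
  unbarred_parts (decode N U) = [seq pair_label k 0 | k <- iota 1 L.-1 &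
    has (fun j => j %/ N == k)%N (flatten (map rev U))].
Proof.
move=> rows_U; rewrite /unbarred_parts reading_decode -map_comp.
set W := flatten _.
have W_lt j : j \in W -> (j %/ N < L)%N.
  case/flattenP => t /mapP[t' t'U ->]; rewrite mem_rev => j_t; rewrite ltn_divLR //.
  exact: (allP (coded_row_lt (allP rows_U _ t'U))).
apply: (sorted_eq (leT := label_le)).
- by move=> x y z; apply: le_trans.
- by move=> x y; apply: le_anti.
- by apply: sort_sorted => x y; apply: le_total.
- rewrite sorted_map; apply: (sub_sorted (e := ltn)) => [a b /= ab|].
    by apply: ltW; have := pair_label_lt a 0 b 0; rewrite /label_lt ab.
  by apply: (sorted_filter ltn_trans); apply: iota_ltn_sorted.
rewrite perm_sort; apply: uniq_perm; first exact: undup_uniq.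
  rewrite map_inj_uniq ?filter_uniq ?iota_uniq // => a b /eqP.
  by rewrite pair_label0_eq => /eqP.
move=> S; rewrite mem_undup mem_filter; apply/andP/mapP.
  case=> S_neq0 /mapP[j j_W S_j]; move: S_neq0; rewrite S_j /= unbarred_part_pair_label.
  have [-> //|k_gt0 _] := posnP (j %/ N)%N; exists (j %/ N)%N => //.
  rewrite mem_filter mem_iota k_gt0 add1n prednK // W_lt // andbT.
  by rewrite andbT; apply/hasP; exists j.
case=> k; rewrite mem_filter mem_iota => /andP[/hasP[j j_W /eqP j_k] /andP[k_gt0 _]] ->.
split; first by case: k k_gt0 {j_k}.
by apply/mapP; exists j => //=; rewrite unbarred_part_pair_label j_k.
Qed.

Definition row_word R U b := rev (group_word N (b %/ R)%N (nth [::] U (b %% R)%N)).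

Lemma reading_blocks U R : all (coded_row M) U -> (size U <= R)%N ->
  flatten (map (read_word (decode N U)) ([::] :: unbarred_parts (decode N U))) =
  flatten (mkseq (row_word R U) (L * R)).
Proof.
move=> rows_U size_U; rewrite unbarred_parts_decode //; set W := flatten (map rev U).
rewrite /= -map_comp (eq_map (g := fun k => group_word N k W)) => [|k]; last first.
  exact: read_word_decode.
rewrite flatten_map_filter => [|k /hasPn no_k]; last first.
  rewrite /group_word (_ : filter _ W = [::]) //.
  by apply/eqP; rewrite -(negbK (_ == _)) -has_filter; apply/hasPn.
rewrite -[[::] : label]/(pair_label 0 0) read_word_decode -/W.
have -> : group_word N 0 W ++ flatten [seq group_word N k W | k <- iota 1 L.-1] =
    flatten (mkseq (fun k => group_word N k W) L) by rewrite -[in RHS](prednK L_gt0).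
rewrite -flatten_mkseq_mul; congr flatten; apply/eq_in_map => k _.
have -> : group_word N k W =
    flatten (mkseq (fun r => rev (group_word N k (nth [::] U r))) (size U)).
  rewrite /W group_word_flatten -map_comp; congr flatten.
  rewrite -{1}(mkseq_nth [::] U) -map_comp; apply: eq_map => r /=.
  by rewrite group_word_rev.
rewrite -(flatten_mkseq_wide size_U) => [|r r_ge]; last by rewrite nth_default.
congr flatten; apply/eq_in_map => r; rewrite mem_iota add0n => /andP[_ rR].
by rewrite /row_word modn_mul_add // divn_mul_add.
Qed.

Lemma count_row_word R U k r i : (r < R)%N -> (0 < i)%N -> (i < N)%N ->
  count_mem i (row_word R U (k * R + r)) = multiplicity U r (k * N + i).
Proof.
move=> rR i_gt0 iN.
by rewrite /row_word count_rev modn_mul_add // divn_mul_add // count_group_word.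
Qed.

Lemma sum_count_row_word R U k r i : (r <= R)%N -> (0 < i)%N -> (i < N)%N ->
  (\sum_(0 <= b < k * R + r) count_mem i (row_word R U b))%N =
  letters_read R N (multiplicity U) k r i.
Proof.
move=> rR i_gt0 iN; rewrite sum_mul_add; congr (_ + _)%N.
  apply: eq_bigr => k' _; apply: eq_big_nat => r' /andP[_ r'R].
  exact: count_row_word.
apply: eq_big_nat => r' /andP[_ r'r]; apply: count_row_word => //.
exact: leq_trans r'r rR.
Qed.

Lemma is_lattice_decode U R : all (coded_row M) U -> (size U <= R)%N ->
  is_lattice (decode N U) <->
  (forall k r i, (k < L)%N -> (r < R)%N -> (0 < i)%N -> (i.+1 < N)%N ->
   letters_read R N (multiplicity U) k r.+1 i.+1 <=
   letters_read R N (multiplicity U) k r i)%N.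
Proof.
move=> rows_U size_U; rewrite /is_lattice (reading_blocks rows_U size_U).
have sorted_row_word b : sorted geq (row_word R U b).
  by apply: group_word_sorted; case/andP: (nth_coded_row (b %% R)%N rows_U).
split.
  move/(lattice_word_blocks _ sorted_row_word) => lat_U k r i kL rR i_gt0 iN.
  rewrite -!sum_count_row_word // ?(ltnW iN) // ?(ltnW rR) // addnS.
  by apply: lat_U => //; apply: ltn_mul_add.
move=> lat_U; apply/lattice_word_blocks => // b i bLR i_gt0.
have [iN|Ni] := ltnP i.+1 N; last first.
  by rewrite big1 // => b' _; rewrite /row_word count_rev count_group_word_out.
case: (ltn_mul_split bLR) => k [r [kL rR ->]].
by rewrite -addnS !sum_count_row_word // ?(ltnW iN) // ?(ltnW rR) //; apply: lat_U.
Qed.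

Lemma count_decode U R b m : all (coded_row M) U -> (size U <= R)%N -> (0 < m)%N ->
  count_mem ((b, m) : letter) (flatten (flatten (decode N U))) =
  (\sum_(0 <= k < L) \sum_(0 <= i < N)
     (m == if b then k else i) * colsum R (multiplicity U) (k * N + i))%N.
Proof.
move=> rows_U size_U m_gt0; rewrite !count_flatten.
have -> : flatten (decode N U) = map (code_label N) (flatten U) by rewrite /decode map_flatten.
rewrite -map_comp sumnE big_map big_flatten (big_nth [::]).
transitivity (\sum_(0 <= r < R) \sum_(0 <= j < M)
    count_mem ((b, m) : letter) (code_label N j) * multiplicity U r j)%N.
  rewrite [LHS](big_nat_widen _ _ R) // big_mkcond; apply: eq_bigr => r _.
  have row_lt := coded_row_lt (nth_coded_row r rows_U).
  rewrite -(big_count_mem (fun j => count_mem ((b, m) : letter) (code_label N j)) row_lt).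
  by case: ltnP => // r_ge; rewrite nth_default // big_nil.
rewrite exchange_big -sum_group_content; apply: eq_bigr => k _.
apply: eq_big_nat => i /andP[_ iN]; rewrite big_distrr; apply: eq_bigr => r _.
by rewrite code_label_mul_add // count_pair_label.
Qed.

Lemma count_decode_barred U R i : all (coded_row M) U -> (size U <= R)%N ->
  (0 < i)%N -> count_mem ((false, i) : letter) (flatten (flatten (decode N U))) =
  if (i < N)%N then letter_content L N (colsum R (multiplicity U)) i else 0%N.
Proof.
move=> rows_U size_U i_gt0; rewrite (@count_decode U R) //; case: ltnP => [iN|Ni].
  apply: eq_bigr => k _; rewrite (@big_nat_only1 _ _ _ _ _ i) ?eqxx ?mul1n //.
  by move=> j _ /negbTE; rewrite eq_sym => ->.
rewrite big1 // => k _; rewrite big_nat_cond big1 // => j; rewrite andbT => /andP[_ jN].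
by rewrite gtn_eqF // (leq_trans jN).
Qed.

Lemma count_decode_unbarred U R k : all (coded_row M) U -> (size U <= R)%N ->
  (0 < k)%N -> count_mem ((true, k) : letter) (flatten (flatten (decode N U))) =
  if (k < L)%N then group_content N (colsum R (multiplicity U)) k else 0%N.
Proof.
move=> rows_U size_U k_gt0; rewrite (@count_decode U R) //; case: ltnP => [kL|Lk].
  rewrite (@big_nat_only1 _ _ _ _ _ k) //.
    by apply: eq_bigr => i _; rewrite eqxx mul1n.
  by move=> j _ /negbTE ne_jk; rewrite big1 // => i _; rewrite eq_sym ne_jk.
rewrite big_nat_cond big1 // => j; rewrite andbT => /andP[_ jL].
by rewrite big1 // => i _; rewrite gtn_eqF // (leq_trans jL).
Qed.

Lemma count_decode0 U b : count_mem ((b, 0%N) : letter) (flatten (flatten (decode N U))) = 0%N.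
Proof.
apply/count_memPn/flattenP => -[S /flattenP[_ /mapP[t _ ->] /mapP[j _ ->]]].
by rewrite /code_label; case: (j %/ N)%N (j %% N)%N b => [|k] [|i] [].
Qed.

Lemma content_decode U R (la al : seq nat) : all (coded_row M) U -> (size U <= R)%N ->
  (size la < N)%N -> (size al < L)%N ->
  perm_eq (flatten (flatten (decode N U))) (letters false la ++ letters true al) <->
  (forall i, (0 < i)%N -> (i < N)%N ->
     letter_content L N (colsum R (multiplicity U)) i = nth 0%N la i.-1) /\
  (forall k, (0 < k)%N -> (k < L)%N ->
     group_content N (colsum R (multiplicity U)) k = nth 0%N al k.-1).
Proof.
move=> rows_U size_U la_N al_L.
have count_rhs b m : count_mem ((b, m) : letter) (letters false la ++ letters true al) =
    if (0 < m)%N then nth 0%N (if b then al else la) m.-1 else 0%N.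
  by rewrite count_cat !count_letters; case: b; case: m => [|m]; rewrite /= ?addn0.
split=> [/seq.permP eq_count|[letters_U groups_U]].
  split=> [i i_gt0 iN|k k_gt0 kL].
    by have := eq_count (pred1 (false, i)); rewrite count_rhs (count_decode_barred _ size_U)
      // i_gt0 iN.
  by have := eq_count (pred1 (true, k)); rewrite count_rhs (count_decode_unbarred _ size_U)
    // k_gt0 kL.
apply/allP => -[b m] _ /=; apply/eqP; rewrite count_rhs.
have [->|m_gt0] := posnP m; first exact: count_decode0.
case: b; rewrite ?(count_decode_unbarred _ size_U) ?(count_decode_barred _ size_U) //.
  by case: ltnP => [|L_m]; [apply: groups_U|rewrite nth_default //; lia].
by case: ltnP => [|N_m]; [apply: letters_U|rewrite nth_default //; lia].
Qed.

End CodedTableaux.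

Lemma map_preimage (A : eqType) (B : Type) (f : B -> A) (P : pred B) (s : seq A) :
  (forall x, x \in s -> exists2 y, P y & x = f y) -> exists2 t, all P t & s = map f t.
Proof.
elim: s => [|x s IHs] preim; first by exists [::].
have [|t Pt ->] := IHs; first by move=> z z_s; apply: preim; rewrite inE z_s orbT.
have [y Py ->] := preim x (mem_head _ _).
by exists (y :: t); rewrite //= Py.
Qed.

Lemma sorted_eq_count (s t : seq nat) : sorted leq s -> sorted leq t ->
  (forall j, count_mem j s = count_mem j t) -> s = t.
Proof.
move=> sorted_s sorted_t eq_count; apply: (sorted_eq leq_trans anti_leq) => //.
by apply/allP => j _; apply/eqP/eq_count.
Qed.

Lemma mem_letters b b' al m : ((b, m) : letter) \in letters b' al ->
  (b == b') && (0 < m <= size al)%N.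
Proof.
rewrite -has_pred1 has_count count_letters; case: (b == b') => //=; case: m => //= m.
by case: (ltnP m (size al)) => // al_m; rewrite nth_default.
Qed.

Lemma size_flatten_labels (T : tableau) : all (all is_label) T ->
  (size (flatten T) <= size (flatten (flatten T)))%N.
Proof.
move=> labels_T; have : all is_label (flatten T).
  by apply/allP => S /flattenP[t tT St]; apply: (allP (allP labels_T _ tT)).
elim: (flatten T) => //= S s IHs /andP[/andP[S_neq0 _] /IHs le_s].
rewrite size_cat; case: S S_neq0 => //= a S _.
by rewrite addSn ltnS (leq_trans le_s) ?leq_addl.
Qed.

(** * Lattice tableaux and their codes *)

Definition lattice_tableau (la al ga : seq nat) (T : tableau) : Prop :=
  [/\ is_mct ga la al T, all (all set_label) T & is_lattice T].

Lemma size_lattice_tableau la al ga T : lattice_tableau la al ga T ->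
  (size (flatten T) <= sumn la + sumn al)%N.
Proof.
case=> -[_ _ labels_T _ _ content_T _] _ _; apply: leq_trans (size_flatten_labels labels_T) _.
by rewrite (perm_size content_T) size_cat !size_letters.
Qed.

Lemma lattice_tableau_sumn la al ga T : lattice_tableau la al ga T ->
  (sumn ga <= sumn la + sumn al)%N.
Proof.
move=> lat_T; apply: leq_trans (size_lattice_tableau lat_T).
case: lat_T => -[_ <- _ _ _ _ _] _ _; rewrite -size_flatten.
by case: T => //= t T; rewrite size_cat leq_addl.
Qed.

Section CodedLatticeTableaux.

Variables (la al ga : seq nat) (L N : nat).
Hypotheses (ga_part : is_part ga) (la_N : (size la < N)%N) (al_L : (size al < L)%N).
Local Notation M := (L * N)%N.
Implicit Types U : seq (seq nat).

Record coded_tableau U : Prop := CodedTableau {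
  coded_tableau_shape : shape (behead U) = ga;
  coded_tableau_columns : forall r t, (t < M)%N ->
    (subshape (multiplicity U) t.+1 r.+2 <= subshape (multiplicity U) t r.+1)%N;
  coded_tableau_letters : forall i, (0 < i)%N -> (i < N)%N ->
    letter_content L N (colsum M (multiplicity U)) i = nth 0%N la i.-1;
  coded_tableau_groups : forall k, (0 < k)%N -> (k < L)%N ->
    group_content N (colsum M (multiplicity U)) k = nth 0%N al k.-1;
  coded_tableau_row1 : forall i, (0 < i)%N -> (i < N)%N -> multiplicity U 0 i = 0%N;
  coded_tableau_lattice : forall k r i, (k < L)%N -> (r < M)%N -> (0 < i)%N ->
    (i.+1 < N)%N -> (letters_read M N (multiplicity U) k r.+1 i.+1 <=
                     letters_read M N (multiplicity U) k r i)%N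
}.

Let N_gt0 : (0 < N)%N. Proof. exact: leq_trans la_N. Qed.
Let L_gt0 : (0 < L)%N. Proof. exact: leq_trans al_L. Qed.

Lemma subshape_multiplicity U j r :
  subshape (multiplicity U) j r = count (gtn j) (nth [::] U r).
Proof. exact: sum_count_mem_gtn. Qed.

Lemma nth_shape_behead U r : nth 0%N (shape (behead U)) r = size (nth [::] U r.+1).
Proof. by rewrite nth_shape nth_behead. Qed.

Lemma shape_decode U : shape (behead (decode N U)) = shape (behead U).
Proof.
rewrite /decode behead_map /shape -map_comp; apply: eq_map => t /=.
by rewrite size_map.
Qed.

Lemma labels_decode U : all (coded_row M) U ->
  all (all is_label) (decode N U) /\ all (all set_label) (decode N U).
Proof.
move=> rows_U; have label_code t j : t \in U -> j \in t ->
    is_label (code_label N j) && set_label (code_label N j).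
  move=> t_U j_t; apply: is_label_pair_label; rewrite lt0n addn_eq0 negb_and -!lt0n.
  have /andP[_ /allP/(_ _ j_t)/andP[j_gt0 _]] := allP rows_U _ t_U.
  by rewrite {1}(divn_eq j N) in j_gt0; move: j_gt0; case: (j %/ N)%N.
by split; apply/allP => _ /mapP[t t_U ->]; apply/allP => _ /mapP[j j_t ->];
  case/andP: (label_code _ _ t_U j_t).
Qed.

Lemma rows_decode U : all (coded_row M) U -> all (sorted label_le) (decode N U).
Proof.
move=> rows_U; apply/allP => _ /mapP[t t_U ->]; rewrite sorted_map.
have /andP[sorted_t _] := allP rows_U _ t_U.
by apply: sub_sorted sorted_t => i j /=; rewrite code_label_le.
Qed.

Lemma row1_decode U : all (coded_row M) U ->
  all (has unbarred) (head [::] (decode N U)) <->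
  (forall i, (0 < i)%N -> (i < N)%N -> multiplicity U 0 i = 0%N).
Proof.
move=> rows_U; have -> : head [::] (decode N U) = map (code_label N) (nth [::] U 0).
  by rewrite -nth_decode nth0.
rewrite all_map (eq_all (a2 := fun j => 0 < j %/ N)%N) => [|j]; last first.
  exact: has_unbarred_pair_label.
split=> [/allP unbarred_row i i_gt0 iN|no_barred].
  by apply/count_memPn/negP => /unbarred_row; rewrite divn_small.
apply/allP => j j_row; rewrite divn_gt0 // leqNgt; apply/negP => jN.
have /andP[_ /allP/(_ _ j_row)/andP[j_gt0 _]] := nth_coded_row 0 rows_U.
by have /count_memPn := no_barred j j_gt0 jN; rewrite j_row.
Qed.

Lemma columns_decode U : all (coded_row M) U -> shape (behead U) = ga ->
  (forall i j, (j < nth 0%N ga i.+1)%N ->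
     label_lt (nth [::] (nth [::] (behead (decode N U)) i) j)
              (nth [::] (nth [::] (behead (decode N U)) i.+1) j)) <->
  (forall r t, (t < M)%N ->
     (subshape (multiplicity U) t.+1 r.+2 <= subshape (multiplicity U) t r.+1)%N).
Proof.
move=> rows_U shape_U; have sizeE r : size (nth [::] U r.+1) = nth 0%N ga r.
  by rewrite -nth_shape_behead shape_U.
have ltE i j : (j < nth 0%N ga i.+1)%N ->
    label_lt (nth [::] (nth [::] (behead (decode N U)) i) j)
             (nth [::] (nth [::] (behead (decode N U)) i.+1) j) =
    (nth 0 (nth [::] U i.+1) j < nth 0 (nth [::] U i.+2) j)%N.
  move=> j_ga; rewrite !nth_behead !nth_decode !(nth_map 0%N) ?sizeE ?code_label_lt //.
  exact: leq_trans j_ga (is_part_nth_le i ga_part).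
have strict i : (forall j, (j < nth 0%N ga i.+1)%N ->
      (nth 0 (nth [::] U i.+1) j < nth 0 (nth [::] U i.+2) j)%N) <->
    (forall t, (t < M)%N ->
      (subshape (multiplicity U) t.+1 i.+2 <= subshape (multiplicity U) t i.+1)%N).
  have sorted_row r : sorted leq (nth [::] U r) by case/andP: (nth_coded_row r rows_U).
  have := @column_strictP _ _ M (sorted_row i.+1) (sorted_row i.+2).
  rewrite !sizeE is_part_nth_le // => /(_ isT (coded_row_lt (nth_coded_row _ rows_U))) ->.
  by split=> cols t tM; have := cols t tM; rewrite !subshape_multiplicity.
split=> [lt_cols r|le_cols i j j_ga].
  by apply/strict => j j_ga; rewrite -ltE //; apply: lt_cols.
by rewrite ltE //; apply: (strict i).2 => // t; apply: le_cols.
Qed.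

Lemma size_coded U : U != [::] -> shape (behead U) = ga -> size U = (size ga).+1.
Proof. by move=> + <-; rewrite size_map size_behead; case: U. Qed.

Lemma lattice_tableau_decode U : (size ga < M)%N -> all (coded_row M) U -> U != [::] ->
  lattice_tableau la al ga (decode N U) <-> coded_tableau U.
Proof.
move=> ga_M rows_U U_neq0; have [labels_U set_labels_U] := labels_decode rows_U.
have size_le : shape (behead U) = ga -> (size U <= M)%N.
  by move=> shape_U; rewrite (size_coded U_neq0 shape_U).
split.
  case=> -[_ shape_U _ _ columns_U content_U row1_U] _ lattice_U.
  rewrite shape_decode in shape_U; have size_U := size_le shape_U.
  have [letters_U groups_U] :=
    (content_decode N_gt0 L_gt0 rows_U size_U la_N al_L).1 content_U.
  split=> //; first exact/columns_decode.
    exact/row1_decode.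
  exact: (is_lattice_decode N_gt0 L_gt0 rows_U size_U).1 lattice_U.
case=> shape_U columns_U letters_U groups_U row1_U lattice_U; have size_U := size_le shape_U.
split=> //; last exact: (is_lattice_decode N_gt0 L_gt0 rows_U size_U).2 lattice_U.
split=> //.
- by case: (U) U_neq0.
- by rewrite shape_decode.
- exact: rows_decode.
- exact/columns_decode.
- exact: (content_decode N_gt0 L_gt0 rows_U size_U la_N al_L).2 (conj letters_U groups_U).
- exact/row1_decode.
Qed.

Lemma code_label_onto T S : lattice_tableau la al ga T -> S \in flatten T ->
  exists2 j, (0 < j < M)%N & S = code_label N j.
Proof.
case=> -[_ _ labels_T _ _ content_T _] set_labels_T _ /flattenP[t t_T S_t].
have letter_S b m : ((b, m) : letter) \in S ->
    (0 < m)%N && (if b then m < L else m < N)%N.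
  move=> x_S; have : ((b, m) : letter) \in flatten (flatten T).
    by apply/flattenP; exists S => //; apply/flattenP; exists t.
  rewrite (perm_mem content_T) mem_cat => /orP[] /mem_letters /andP[/eqP -> /andP[-> m_le]] /=.
    exact: leq_ltn_trans m_le la_N.
  exact: leq_ltn_trans m_le al_L.
have S_gt0 : {in S, forall x, 0 < x.2}%N by move=> [b m] /(letter_S b m)/andP[].
have [k [i [ki_gt0 def_S k_S i_S]]] := pair_labelP (allP (allP labels_T _ t_T) _ S_t)
  (allP (allP set_labels_T _ t_T) _ S_t) S_gt0.
have kL : (k < L)%N by have [->|/k_S/letter_S/andP[]] := posnP k.
have iN : (i < N)%N by have [->|/i_S/letter_S/andP[]] := posnP i.
exists (k * N + i)%N; last by rewrite code_label_mul_add.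
by rewrite ltn_mul_add // andbT; move: ki_gt0; rewrite !addn_gt0 muln_gt0 N_gt0 andbT.
Qed.

Lemma decode_onto T : lattice_tableau la al ga T ->
  exists U, [/\ all (coded_row M) U, U != [::] & T = decode N U].
Proof.
move=> lat_T; have [[T_neq0 _ _ rows_T _ _ _] _ _] := lat_T.
have [t t_T|U rows_U defT] := @map_preimage _ _ (map (code_label N)) (coded_row M) T.
  have [S S_t|u codes_u def_t] := @map_preimage _ _ (code_label N) (fun j => 0 < j < M)%N t.
    by apply: (code_label_onto lat_T); apply/flattenP; exists t.
  exists u => //; apply/andP; split=> //.
  have := allP rows_T _ t_T; rewrite def_t sorted_map; apply: sub_sorted => i j /=.
  by rewrite code_label_le.
by exists U; split=> //; apply: contraNneq T_neq0 => U_nil; rewrite defT U_nil.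
Qed.

End CodedLatticeTableaux.

(** * Tableaux and Kronecker arrays *)

Definition padded n (x : seq nat) := (n - sumn x)%N :: x.

Lemma sumn_padded n x : (sumn x <= n)%N -> sumn (padded n x) = n.
Proof. by move=> x_n; rewrite /= subnK. Qed.

Lemma sum_padded n x N : (sumn x <= n)%N -> (size x < N)%N ->
  (\sum_(0 <= i < N) nth 0 (padded n x) i)%N = n.
Proof. by move=> x_n xN; rewrite sum_nth ?sumn_padded. Qed.

Lemma agree_padded n x N u : (sumn x <= n)%N -> (size x < N)%N ->
  (\sum_(0 <= i < N) u i)%N = n ->
  agree N u (nth 0%N (padded n x)) <->
  (forall i, (0 < i)%N -> (i < N)%N -> u i = nth 0%N x i.-1).
Proof.
move=> x_n xN sum_u; split=> [/agreeP agree_u i i_gt0 iN|eq_u].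
  by rewrite agree_u //; case: i i_gt0 iN.
have N_gt0 : (0 < N)%N := leq_trans (ltn0Sn _) xN.
have eq_u' i : (0 < i < N)%N -> u i = nth 0%N (padded n x) i.
  by case/andP=> i_gt0 iN; rewrite eq_u //; case: i i_gt0 iN.
apply/agreeP => i iN; have [->|i_gt0] := posnP i; last by rewrite eq_u' ?i_gt0.
have := sum_padded x_n xN; rewrite -[RHS]sum_u !(big_ltn N_gt0) => sum_eq.
by move: sum_eq; rewrite -(eq_big_nat _ _ eq_u') => /addIn.
Qed.

Definition kronecker_arrays n L N (la al ga : seq nat) :
    {set array (L * N) (L * N) n} :=
  [set c | kronecker_array (nth 0%N (padded n al)) (nth 0%N (padded n la)) c &&
    agree (L * N) (arr_shape c) (nth 0%N (padded n ga))].

(* The entries equal to 0 stand for the cells of row 1 without a letter, which a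
   tableau does not contain; they can only occur in row 0. *)
Definition agree_off_corner M B (c : array M M B) (U : seq (seq nat)) :=
  forall r j, (0 < r + j)%N -> entry c r j = multiplicity U r j.

Section AgreeOffCorner.

Variables (M B : nat) (c : array M M B) (U : seq (seq nat)).
Hypotheses (agree_c : agree_off_corner c U) (rows_U : all (coded_row M) U).

Lemma multiplicity0 r : multiplicity U r 0 = 0%N.
Proof.
apply/count_memPn/negP => row_0.
by have /andP[_ /allP/(_ _ row_0)] := nth_coded_row r rows_U.
Qed.

Lemma multiplicity_out r j : (M <= j)%N -> multiplicity U r j = 0%N.
Proof.
move=> Mj; apply/count_memPn/negP => /(allP (coded_row_lt (nth_coded_row r rows_U))).
by rewrite /= ltnNge Mj.
Qed.

Lemma sum_multiplicity r : (\sum_(0 <= j < M) multiplicity U r j)%N = size (nth [::] U r).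
Proof.
rewrite sum_count_mem_gtn; apply/eqP; rewrite -all_count.
exact/coded_row_lt/nth_coded_row.
Qed.

Lemma subshape_off_corner j r : (0 < r)%N ->
  subshape (entry c) j r = subshape (multiplicity U) j r.
Proof. by move=> r_gt0; apply: eq_bigr => j' _; rewrite agree_c // addn_gt0 r_gt0. Qed.

Lemma arr_shape_off_corner r : (0 < r)%N -> arr_shape c r = size (nth [::] U r).
Proof. by move=> r_gt0; rewrite /arr_shape subshape_off_corner // -sum_multiplicity. Qed.

Lemma arr_shape_corner : (0 < M)%N -> arr_shape c 0 = (entry c 0 0 + size (nth [::] U 0))%N.
Proof.
move=> M_gt0; rewrite -sum_multiplicity /arr_shape /subshape !(big_ltn M_gt0).
rewrite multiplicity0 add0n; congr (_ + _)%N; apply: eq_big_nat => j /andP[j_gt0 _].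
exact: agree_c.
Qed.

Lemma arr_content_off_corner j : (0 < j)%N -> arr_content c j = colsum M (multiplicity U) j.
Proof. by move=> j_gt0; apply: eq_bigr => r _; rewrite agree_c // addn_gt0 j_gt0 orbT. Qed.

Lemma letter_content_off_corner L N i : (0 < i)%N ->
  letter_content L N (arr_content c) i = letter_content L N (colsum M (multiplicity U)) i.
Proof.
move=> i_gt0; apply: eq_bigr => k _; rewrite arr_content_off_corner //.
by rewrite addn_gt0 i_gt0 orbT.
Qed.

Lemma group_content_off_corner N k : (0 < N)%N -> (0 < k)%N ->
  group_content N (arr_content c) k = group_content N (colsum M (multiplicity U)) k.
Proof.
move=> N_gt0 k_gt0; apply: eq_bigr => i _; rewrite arr_content_off_corner //.
by rewrite addn_gt0 muln_gt0 k_gt0 N_gt0.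
Qed.

Lemma letters_read_off_corner N k r i : (0 < i)%N ->
  letters_read M N (entry c) k r i = letters_read M N (multiplicity U) k r i.
Proof.
move=> i_gt0; congr (_ + _)%N; first exact: letter_content_off_corner.
by apply: eq_bigr => r' _; rewrite agree_c // !addn_gt0 i_gt0 !orbT.
Qed.

End AgreeOffCorner.

Section ArraysAndTableaux.

Variables (n L N : nat) (la al ga : seq nat).
Local Notation M := (L * N)%N.
Hypotheses (ga_part : is_part ga) (la_N : (size la < N)%N) (al_L : (size al < L)%N)
  (ga_M : (size ga < M)%N) (la_n : (sumn la <= n)%N) (al_n : (sumn al <= n)%N)
  (ga_n : (sumn ga <= n)%N).
Implicit Types (c : array M M n) (U : seq (seq nat)).

Let N_gt0 : (0 < N)%N. Proof. exact: leq_trans la_N. Qed.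
Let L_gt0 : (0 < L)%N. Proof. exact: leq_trans al_L. Qed.
Let M_gt0 : (0 < M)%N. Proof. exact: leq_trans ga_M. Qed.

Lemma shape_off_corner c U : agree_off_corner c U -> all (coded_row M) U ->
  size U = (size ga).+1 -> (\sum_(0 <= r < M) arr_shape c r)%N = n ->
  agree M (arr_shape c) (nth 0%N (padded n ga)) <-> shape (behead U) = ga.
Proof.
move=> agree_c rows_U size_U sum_shape; rewrite (agree_padded ga_n ga_M sum_shape).
split=> [shape_c|shape_U [//|r] _ rM]; last first.
  by rewrite (arr_shape_off_corner agree_c rows_U) // -shape_U nth_shape_behead.
have size_shape : size (shape (behead U)) = size ga by rewrite size_map size_behead size_U.
apply: (@eq_from_nth _ 0%N) => // r; rewrite size_shape => r_ga.
rewrite nth_shape_behead -(arr_shape_off_corner agree_c rows_U) // shape_c //.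
exact: leq_ltn_trans r_ga ga_M.
Qed.

Lemma sum_content_padded c : agree M (arr_shape c) (nth 0%N (padded n ga)) ->
  (\sum_(0 <= k < L) group_content N (arr_content c) k)%N = n /\
  (\sum_(0 <= i < N) letter_content L N (arr_content c) i)%N = n.
Proof.
move=> /eq_sum_agree; rewrite sum_padded // sum_arr_shape => sum_c.
by rewrite sum_group_content sum_letter_content.
Qed.

Lemma kronecker_array_coded c U : agree_off_corner c U -> all (coded_row M) U ->
  size U = (size ga).+1 -> c \in kronecker_arrays n L N la al ga ->
  coded_tableau la al ga L N U.
Proof.
move=> agree_c rows_U size_U; rewrite inE.
case/andP=> /and4P[ss_c groups_c /latticeP lattice_c letters_c] shape_c.
have [sum_groups sum_letters] := sum_content_padded shape_c.
have sum_shape : (\sum_(0 <= r < M) arr_shape c r)%N = n.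
  by rewrite (eq_sum_agree shape_c) sum_padded.
split.
- exact/(shape_off_corner agree_c rows_U size_U sum_shape).
- move=> r t tM; rewrite -!(subshape_off_corner agree_c) //.
  have [rM|Mr] := ltnP r.+2 M; first exact: (ssytP _ ss_c).
  by rewrite {1}/subshape big1 // => j _; rewrite entry_out_row.
- move=> i i_gt0 iN; rewrite -(letter_content_off_corner agree_c) //.
  exact: (agree_padded la_n la_N sum_letters).1 letters_c _ i_gt0 iN.
- move=> k k_gt0 kL; rewrite -(group_content_off_corner agree_c) //.
  exact: (agree_padded al_n al_L sum_groups).1 groups_c _ k_gt0 kL.
- case=> // i _ iN; rewrite -agree_c //; apply/eqP; rewrite -leqn0.
  have := lattice_c 0%N 0%N i L_gt0 M_gt0 iN.
  by rewrite letters_readS /letters_read /letter_content /colsum !big_geq.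
- move=> k r i kL rM i_gt0 iN; rewrite -!(letters_read_off_corner agree_c) //.
  exact: lattice_c.
Qed.

Lemma coded_ssyt c U : agree_off_corner c U -> all (coded_row M) U ->
  coded_tableau la al ga L N U -> (sumn ga <= entry c 0 0)%N -> ssyt c.
Proof.
move=> agree_c rows_U [shape_U columns_U _ _ _ _] corner_c.
apply/ssytP => -[|r] j rM jM; last first.
  by rewrite !(subshape_off_corner agree_c) //; apply: columns_U.
case: j jM => [|j] jM; first by rewrite /subshape big_nat1 agree_c // (multiplicity0 rows_U).
apply: leq_trans (leq_subshape _ _ jM) _.
rewrite -/(arr_shape c 1) (arr_shape_off_corner agree_c rows_U) // -nth_shape_behead shape_U.
apply: leq_trans (nth_le_sumn _ _) (leq_trans corner_c _).
by rewrite /subshape big_ltn // leq_addr.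
Qed.

Lemma corner_le_letters_read c k r : (k < L)%N -> (r <= M)%N -> (0 < k + r)%N ->
  (entry c 0 0 <= letters_read M N (entry c) k r 0)%N.
Proof.
move=> kL rM; case: k kL => [|k] kL.
  case: r rM => // r rM _; apply: leq_trans (leq_addl _ _).
  by rewrite /colsum big_ltn // leq_addr.
move=> _; apply: leq_trans (leq_addr _ _); rewrite /letter_content big_ltn //.
by apply: leq_trans (leq_addr _ _); rewrite /colsum big_ltn // leq_addr.
Qed.

Lemma coded_lattice c U : agree_off_corner c U ->
  coded_tableau la al ga L N U -> (sumn la <= entry c 0 0)%N -> lattice L N c.
Proof.
move=> agree_c [_ _ letters_U _ row1_U lattice_U] corner_c.
apply/latticeP => k r [|i] kL rM iN; last first.
  by rewrite !(letters_read_off_corner agree_c) //; apply: lattice_U.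
have [|kr_gt0] := posnP (k + r).
  move/eqP; rewrite addn_eq0 => /andP[/eqP -> /eqP ->].
  by rewrite letters_readS /letters_read /letter_content /colsum !big_geq // agree_c // row1_U.
apply: leq_trans (leq_letters_read _ _ _ kL rM) _.
rewrite (letter_content_off_corner agree_c) // letters_U //.
apply: leq_trans (nth_le_sumn _ _) (leq_trans corner_c _).
exact: corner_le_letters_read (ltnW rM) kr_gt0.
Qed.

Lemma coded_kronecker_array c U : agree_off_corner c U -> all (coded_row M) U ->
  size U = (size ga).+1 -> coded_tableau la al ga L N U ->
  (\sum_(0 <= r < M) arr_shape c r)%N = n ->
  (sumn la <= entry c 0 0)%N -> (sumn ga <= entry c 0 0)%N ->
  c \in kronecker_arrays n L N la al ga.
Proof.
move=> agree_c rows_U size_U coded_U sum_shape la_corner ga_corner.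
have [shape_U _ letters_U groups_U _ _] := coded_U.
have shape_c := (shape_off_corner agree_c rows_U size_U sum_shape).2 shape_U.
have [sum_groups sum_letters] := sum_content_padded shape_c.
rewrite inE shape_c andbT; apply/and4P; split.
- exact: coded_ssyt coded_U _.
- apply/(agree_padded al_n al_L sum_groups) => k k_gt0 kL.
  by rewrite (group_content_off_corner agree_c) // groups_U.
- exact: coded_lattice coded_U _.
- apply/(agree_padded la_n la_N sum_letters) => i i_gt0 iN.
  by rewrite (letter_content_off_corner agree_c) // letters_U.
Qed.

Definition row_of c r : seq nat :=
  sort leq (flatten (mkseq (fun j => nseq (entry c r j.+1) j.+1) M.-1)).

Definition rows_of c := mkseq (row_of c) (size ga).+1.

Lemma count_row_of c r j :
  count_mem j (row_of c r) = if (0 < j)%N then entry c r j else 0%N.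
Proof.
rewrite count_sort count_flatten -map_comp sumn_map_index.
under eq_bigr => a _ do rewrite /= count_nseq /=.
case: j => [|j] /=; first by rewrite big1.
have [jM|Mj] := ltnP j M.-1.
  by rewrite (@big_nat_only1 _ _ _ _ _ j) ?eqxx ?mul1n // => a _ /negbTE; rewrite eqSS => ->.
rewrite big_nat_cond big1 => [|a]; last first.
  by rewrite andbT eqSS => /andP[_ aM]; rewrite ltn_eqF // (leq_trans aM).
by rewrite entry_out_col //; move: Mj M_gt0; lia.
Qed.

Lemma row_of_coded c r : coded_row M (row_of c r).
Proof.
rewrite /coded_row sort_sorted /=; last exact: leq_total.
apply/allP => j; rewrite -has_pred1 has_count count_row_of; case: ifP => // _ entry_gt0.
by rewrite /= ltnNge; apply: contraTN entry_gt0 => Mj; rewrite entry_out_col.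
Qed.

Lemma rows_of_coded c : all (coded_row M) (rows_of c).
Proof. by apply/allP => t /mapP[r _ ->]; apply: row_of_coded. Qed.

Lemma rows_of_agree c : c \in kronecker_arrays n L N la al ga ->
  agree_off_corner c (rows_of c).
Proof.
rewrite inE => /andP[/and4P[ss_c _ _ _] /agreeP shape_c] r j rj_gt0.
have [rM|Mr] := ltnP r M; last first.
  rewrite entry_out_row // /multiplicity nth_default // size_mkseq.
  exact: leq_trans ga_M Mr.
have [r_ga|ga_r] := ltnP r (size ga).+1.
  rewrite /multiplicity nth_mkseq // count_row_of; have [j0|//] := posnP j.
  by rewrite j0 addn0 in rj_gt0 *; apply: ssyt_entry_lt.
rewrite /multiplicity nth_default ?size_mkseq //=.
have [jM|Mj] := ltnP j M; last by rewrite entry_out_col.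
have := shape_c r rM; rewrite nth_default //.
by move/eqP; rewrite sum_nat_seq_eq0 => /allP/(_ j); rewrite mem_index_iota => /(_ jM)/eqP.
Qed.

Lemma rows_of_inj : {in kronecker_arrays n L N la al ga &, injective rows_of}.
Proof.
move=> c d kron_c kron_d eq_rows.
have agree_c := rows_of_agree kron_c; have agree_d := rows_of_agree kron_d.
rewrite eq_rows in agree_c; apply: array_ext => r j _ _.
have [/eqP|rj_gt0] := posnP (r + j); last by rewrite agree_c // agree_d.
rewrite addn_eq0 => /andP[/eqP -> /eqP ->].
have := arr_shape_corner agree_c (rows_of_coded d) M_gt0.
have := arr_shape_corner agree_d (rows_of_coded d) M_gt0.
move: kron_c kron_d; rewrite !inE => /andP[_ /agreeP -> //] /andP[_ /agreeP -> //] ->.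
by move/addIn.
Qed.

Lemma rows_of_kronecker_array c : c \in kronecker_arrays n L N la al ga ->
  lattice_tableau la al ga (decode N (rows_of c)).
Proof.
move=> kron_c; have agree_c := rows_of_agree kron_c.
apply/(lattice_tableau_decode ga_part la_N al_L ga_M (rows_of_coded c)) => //.
by apply: kronecker_array_coded agree_c _ _ kron_c; rewrite ?rows_of_coded ?size_mkseq.
Qed.

(* The corner is the number of letterless cells that brings the size to n. *)
Definition array_of_rows U : array M M n := array_of M M n (fun r j =>
  if (r + j == 0)%N then (n - sumn ga - size (nth [::] U 0))%N else multiplicity U r j).

Section ArrayOfRows.

Variable U : seq (seq nat).
Hypotheses (rows_U : all (coded_row M) U) (size_U : size U = (size ga).+1)
  (coded_U : coded_tableau la al ga L N U)
  (row1_n : (sumn ga + size (nth [::] U 0) <= n)%N).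

Lemma multiplicity_le r j : (multiplicity U r j <= n)%N.
Proof.
apply: leq_trans (count_size _ _) _; case: r => [|r].
  exact: leq_trans (leq_addl _ _) row1_n.
rewrite -nth_shape_behead (coded_tableau_shape coded_U).
exact: leq_trans (nth_le_sumn _ _) ga_n.
Qed.

Lemma entry_array_of_rows r j : (r < M)%N -> (j < M)%N -> entry (array_of_rows U) r j =
  if (r + j == 0)%N then (n - sumn ga - size (nth [::] U 0))%N else multiplicity U r j.
Proof.
move=> rM jM; rewrite entry_array_of //; case: ifP => _; last exact: multiplicity_le.
exact: leq_trans (leq_subr _ _) (leq_subr _ _).
Qed.

Lemma array_of_rows_agree : agree_off_corner (array_of_rows U) U.
Proof.
move=> r j rj_gt0; have [rM|Mr] := ltnP r M; last first.
  rewrite entry_out_row // /multiplicity nth_default // size_U.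
  exact: leq_trans ga_M Mr.
have [jM|Mj] := ltnP j M; last by rewrite entry_out_col // (multiplicity_out rows_U).
by rewrite entry_array_of_rows // gtn_eqF.
Qed.

Lemma sum_shape_array_of_rows : (\sum_(0 <= r < M) arr_shape (array_of_rows U) r)%N = n.
Proof.
rewrite -[RHS](sum_padded ga_n ga_M); apply: eq_big_nat => -[|r] /andP[_ rM].
  rewrite (arr_shape_corner array_of_rows_agree rows_U) // entry_array_of_rows //=.
  by rewrite subnK // leq_subRL // addnC.
rewrite (arr_shape_off_corner array_of_rows_agree rows_U) // -nth_shape_behead.
by rewrite (coded_tableau_shape coded_U).
Qed.

Lemma array_of_rowsK : rows_of (array_of_rows U) = U.
Proof.
apply: (@eq_from_nth _ [::]) => [|r]; rewrite size_mkseq ?size_U // => r_ga.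
have /andP[sorted_U _] := nth_coded_row r rows_U.
rewrite nth_mkseq //; apply: sorted_eq_count => // [|j].
  exact/sort_sorted/leq_total.
rewrite count_row_of; have [->|j_gt0] := posnP j; first exact/esym/(multiplicity0 rows_U).
by rewrite array_of_rows_agree // addn_gt0 j_gt0 orbT.
Qed.

End ArrayOfRows.

Local Notation s0 := (sumn la + sumn al)%N.
Hypotheses (ga_s0 : (sumn ga <= s0)%N) (s0_n : (3 * s0 < n)%N).

Lemma lattice_tableau_array T : lattice_tableau la al ga T ->
  exists2 c, c \in kronecker_arrays n L N la al ga & T = decode N (rows_of c).
Proof.
move=> lat_T; have [U [rows_U U_neq0 defT]] := decode_onto la_N al_L lat_T.
have row1_U : (size (nth [::] U 0) <= s0)%N.
  apply: leq_trans (size_lattice_tableau lat_T); rewrite defT.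
  by case: (U) => //= t U'; rewrite size_cat size_map leq_addr.
rewrite defT in lat_T.
move/(lattice_tableau_decode ga_part la_N al_L ga_M rows_U U_neq0) in lat_T.
have size_U := size_coded U_neq0 (coded_tableau_shape lat_T).
have row1_n : (sumn ga + size (nth [::] U 0) <= n)%N by move: ga_s0 s0_n row1_U; lia.
exists (array_of_rows U); last by rewrite defT array_of_rowsK.
have agree_U := array_of_rows_agree rows_U size_U lat_T row1_n.
apply: (coded_kronecker_array agree_U) => //.
- exact: sum_shape_array_of_rows.
- by rewrite entry_array_of_rows //=; move: ga_s0 s0_n row1_U; lia.
- by rewrite entry_array_of_rows //=; move: ga_s0 s0_n row1_U; lia.
Qed.

Lemma card_lattice_tableaux : exists S : {fset tableau},
  (forall T, T \in S <-> lattice_tableau la al ga T) /\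
  #|` S| = #|kronecker_arrays n L N la al ga|.
Proof.
exists [fset decode N (rows_of c) | c in kronecker_arrays n L N la al ga]%fset; split.
  move=> T; split=> [/imfsetP[c /= kron_c ->]|/lattice_tableau_array[c kron_c ->]].
    exact: rows_of_kronecker_array.
  by apply/imfsetP; exists c.
rewrite card_in_imfset /= => [|c d kron_c kron_d eq_decode]; first by rewrite -cardE.
have inj_code_row : injective (map (code_label N)) := inj_map (code_label_inj N_gt0).
by apply: rows_of_inj => //; apply: (inj_map inj_code_row).
Qed.

End ArraysAndTableaux.

(** * The expansion *)

Lemma head_le_sumn (s : seq nat) : (head 0%N s <= sumn s)%N.
Proof. by rewrite -nth0 nth_le_sumn. Qed.

Lemma is_part_padded n (x : intpart) : (sumn x + head 0%N x <= n)%N -> (0 < n)%N ->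
  is_part (padded n x).
Proof.
have := intpartP x; rewrite /is_part /padded; case: (part_val x) => [|a s] /=.
  by move=> _ _ n_gt0; rewrite inE subn0 eq_sym -lt0n.
case/andP=> path_s x_gt0 x_n _; rewrite inE negb_or x_gt0 path_s !andbT.
have a_gt0 : (0 < a)%N by move: x_gt0; rewrite inE negb_or eq_sym -lt0n => /andP[].
by rewrite eq_sym -lt0n; apply/andP; split; move: x_n a_gt0; lia.
Qed.

Lemma nth_partition_of t r : sorted geq t -> nth 0%N (partition_of t) r = nth 0%N t r.
Proof.
move=> sorted_t.
have -> : partition_of t = take (count (leq 1) t) t :> seq nat.
  rewrite take_sorted_geq //.
  exact: (sorted_sort geq_trans (sorted_filter geq_trans _ sorted_t)).
have [r_lt|r_ge] := ltnP r (count (leq 1) t); first by rewrite nth_take.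
rewrite nth_default; last by rewrite size_take_min (leq_trans (geq_minl _ _)).
by move: r_ge; rewrite leqNgt ltn_count_geq // lt0n negbK => /eqP.
Qed.

Lemma eq_intpart (x y : intpart) : (forall r, nth 0%N x r = nth 0%N y r) -> x = y.
Proof.
move=> eq_xy; rewrite -[x]partition_ofK -[y]partition_ofK; apply: eq_partition_of.
have wide m (z : intpart) : (size z <= m)%N ->
    filter (leq 1) (mkseq (nth 0%N z) m) = filter (leq 1) z.
  by move=> z_m; rewrite mkseq_nth_wide // filter_cat filter_nseq cats0.
rewrite -(wide _ _ (leq_maxl (size x) (size y))) -(wide _ _ (leq_maxr (size x) (size y))).
by rewrite (eq_mkseq eq_xy).
Qed.

Lemma agree_padded_intpart n N (x y : intpart) : (size x < N)%N -> (size y < N)%N ->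
  agree N (nth 0%N (padded n x)) (nth 0%N (padded n y)) = (x == y).
Proof.
move=> xN yN; apply/agreeP/eqP => [eq_xy|-> //]; apply: eq_intpart => r.
have [rN|Nr] := ltnP r.+1 N; first exact: (eq_xy r.+1).
by rewrite !nth_default // -ltnS; apply: leq_trans Nr.
Qed.

Lemma chi_padded n N (x : intpart) : (sumn x + head 0%N x <= n)%N -> (0 < n)%N ->
  (size x < N)%N -> chi n (padded n x) = schur_char n N (nth 0%N (padded n x)).
Proof.
move=> x_n n_gt0 xN; apply: chi_schur => //; first exact: is_part_padded.
by apply: sumn_padded; apply: leq_trans x_n; apply: leq_addr.
Qed.

Definition linearly_independent (b : intpart -> symfun) :=
  forall (A : seq intpart) (a : intpart -> algC), uniq A ->
  \sum_(x <- A) a x *: b x = 0 -> {in A, forall x, a x = 0}.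

Lemma stilde_linearly_independent (stilde : intpart -> symfun) :
  (forall x, is_stilde x (stilde x)) -> linearly_independent stilde.
Proof.
move=> stildeP A a uniq_A sum0; pose n := (\max_(x <- A) (sumn (part_val x)).*2).+1.
have x_n x : x \in A -> (sumn x + head 0%N x < n)%N.
  move=> x_A; rewrite ltnS; apply: leq_trans (leq_bigmax_seq _ x_A isT).
  by rewrite -addnn leq_add2l head_le_sumn.
have n_gt0 : (0 < n)%N by []; clearbody n.
have sum_n x : x \in A -> (sumn x < n)%N by move/x_n; apply: leq_trans; rewrite ltnS leq_addr.
have size_n x : x \in A -> (size x < n)%N.
  by move/sum_n; apply: leq_trans; rewrite ltnS size_intpart_le.
pose X (x : intpart) := schur_char n n (nth 0%N (padded n x)).
have cfdotX x y : x \in A -> y \in A -> '[X x, X y] = (x == y)%:R.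
  move=> x_A y_A; rewrite -(agree_padded_intpart n (size_n x x_A) (size_n y y_A)).
  apply: cfdot_schur; first by apply: sum_padded; [apply/ltnW/sum_n|apply: size_n].
    by apply/is_part_nonincreasing/is_part_padded => //; apply/ltnW/x_n.
  by apply/is_part_nonincreasing/is_part_padded => //; apply/ltnW/x_n.
have sumX0 : \sum_(x <- A) a x *: X x = 0.
  apply/cfunP => s; rewrite sum_cfunE cfunE; pose nu := IntPart (cycle_type_is_part s).
  rewrite -[RHS](sf_eval0 (Xi nu)) -sum0 sf_eval_sum; apply: eq_big_seq => x x_A.
  rewrite cfunE sf_evalZ (stildeP x n nu s) ?(ltnW (x_n _ x_A)) //.
  by rewrite -/(padded n x) (@chi_padded n n) ?size_n ?(ltnW (x_n _ x_A)).
move=> y y_A; have : '[\sum_(x <- A) a x *: X x, X y] = 0 by rewrite sumX0 cfdot0l.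
rewrite cfdot_suml (bigD1_seq y) //= cfdotZl cfdotX // eqxx mulr1.
rewrite big1_seq ?addr0 // => x /andP[x_y x_A].
by rewrite cfdotZl cfdotX // (negbTE x_y) mulr0.
Qed.

Section KroneckerArrays.

Variables (n L N : nat) (la al : seq nat).
Hypotheses (la_N : (size la < N)%N) (al_L : (size al < L)%N)
  (la_n : (sumn la <= n)%N) (al_n : (sumn al <= n)%N).
Local Notation M := (L * N)%N.
Local Notation s0 := (sumn la + sumn al)%N.
Local Notation kronecker :=
  (kronecker_array (nth 0%N (padded n al)) (nth 0%N (padded n la))).
Implicit Types c : array M M n.

Let N_gt0 : (0 < N)%N. Proof. exact: leq_trans la_N. Qed.
Let L_gt0 : (0 < L)%N. Proof. exact: leq_trans al_L. Qed.

Lemma sum_arr_shape_kronecker c : kronecker c -> (\sum_(0 <= r < M) arr_shape c r)%N = n.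
Proof.
case/and4P => _ groups_c _ _.
by rewrite sum_arr_shape -sum_group_content (eq_sum_agree groups_c) sum_padded.
Qed.

Lemma kronecker_corner c : kronecker c -> (n - s0 <= entry c 0 0)%N.
Proof.
case/and4P => ss_c groups_c _ letters_c.
have := agreeP _ _ _ groups_c 0%N L_gt0; rewrite /group_content big_ltn //=.
have -> : arr_content c (0 * N + 0) = entry c 0 0.
  have M_gt0 : (0 < M)%N by rewrite muln_gt0 L_gt0.
  apply: (@big_nat_only1 _ _ _ _ _ 0%N) => // r /andP[_ rM] r_neq0.
  by rewrite mul0n; apply: ssyt_entry_lt => //; rewrite lt0n.
move=> group0; suff : (\sum_(1 <= i < N) arr_content c (0 * N + i) <= sumn la)%N.
  by move: group0; lia.
have := sum_padded la_n la_N; rewrite (big_ltn N_gt0) /= => sum_la.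
rewrite -(leq_add2l (n - sumn la)) subnK // -[X in (_ <= X)%N]sum_la leq_add2l.
rewrite !big_nat; apply: leq_sum => i /andP[_ iN]; rewrite -(agreeP _ _ _ letters_c i iN).
by rewrite /letter_content (big_ltn L_gt0) leq_addr.
Qed.

Definition behead_shape c := partition_of (mkseq (fun r => arr_shape c r.+1) M.-1).

Lemma nth_behead_shape c r : ssyt c -> nth 0%N (behead_shape c) r = arr_shape c r.+1.
Proof.
move=> ss_c; rewrite nth_partition_of.
  have [rM|Mr] := ltnP r M.-1; first by rewrite nth_mkseq.
  by rewrite nth_default ?size_mkseq // arr_shape_out //; move: Mr; lia.
apply/(sortedP 0%N) => r'; rewrite size_mkseq => r'M.
by rewrite !nth_mkseq ?(ltnW r'M) //; apply: ssyt_shape_le.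
Qed.

Lemma sum_behead_shape c : kronecker c -> (arr_shape c 0 + sumn (behead_shape c))%N = n.
Proof.
move=> kron_c; have M_gt0 : (0 < M)%N by rewrite muln_gt0 L_gt0.
rewrite sumn_partition_of sumn_map_index -[RHS](sum_arr_shape_kronecker kron_c).
by rewrite [RHS]big_ltn // big_add1.
Qed.

Lemma behead_shape_small c : kronecker c -> (s0 <= n)%N -> (sumn (behead_shape c) <= s0)%N.
Proof.
move=> kron_c s0_n; have := sum_behead_shape kron_c; have := kronecker_corner kron_c.
have M_gt0 : (0 < M)%N by rewrite muln_gt0 L_gt0.
by rewrite [arr_shape c 0]/arr_shape /subshape big_ltn //; lia.
Qed.

Lemma agree_behead_shape c (x : intpart) : kronecker c -> (sumn x <= n)%N ->
  (size x < M)%N -> agree M (arr_shape c) (nth 0%N (padded n x)) = (x == behead_shape c).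
Proof.
move=> kron_c x_n xM; have ss_c : ssyt c by case/and4P: kron_c.
apply/idP/eqP => [/(agree_padded x_n xM (sum_arr_shape_kronecker kron_c)) shape_c|def_x].
  apply: eq_intpart => r; rewrite nth_behead_shape //.
  have [rM|Mr] := ltnP r.+1 M; first by rewrite shape_c.
  by rewrite arr_shape_out // nth_default // -ltnS (leq_trans xM).
apply/(agree_padded x_n xM (sum_arr_shape_kronecker kron_c)) => -[//|r] _ _.
by rewrite def_x nth_behead_shape.
Qed.

Lemma sum_kronecker_behead_shape (V : nmodType) (F : array M M n -> V) :
  (s0 < N)%N -> (s0 <= n)%N ->
  \sum_(c | kronecker c) F c =
  \sum_(x <- parts s0.+1) \sum_(c in kronecker_arrays n L N la al x) F c.
Proof.
move=> s0_N s0_n; rewrite (exchange_big_dep kronecker) => [|x c _] /=; last first.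
  by rewrite inE => /andP[].
apply: eq_bigr => c kron_c; rewrite -big_filter (_ : filter _ _ = [:: behead_shape c]).
  by rewrite big_seq1.
rewrite -(filter_pred1_uniq (parts_uniq s0.+1)) => [|].
  apply: eq_in_filter => x; rewrite mem_parts ltnS inE kron_c => x_s0.
  rewrite agree_behead_shape //; first exact: leq_trans s0_n.
  apply: leq_ltn_trans (size_intpart_le x) (leq_ltn_trans x_s0 _).
  exact: leq_trans s0_N (leq_pmull N L_gt0).
by rewrite mem_parts ltnS behead_shape_small.
Qed.

End KroneckerArrays.

Lemma word_chi_mul n L N (la : intpart) (al : seq nat) (s : 'S_n) :
  (size al < L)%N -> (sumn la + sumn al < N)%N -> (2 * (sumn la + sumn al) < n)%N ->
  word_char n L (nth 0%N (padded n al)) s * chi n (padded n la) s =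
  \sum_(x <- parts (sumn la + sumn al).+1)
    #|kronecker_arrays n L N la al x|%:R * chi n (padded n x) s.
Proof.
set s0 := (sumn la + sumn al)%N => al_L s0_N s0_n.
have n_gt0 : (0 < n)%N := leq_trans (ltn0Sn _) s0_n.
have small (x : intpart) : (sumn x <= s0)%N ->
    [/\ (sumn x <= n)%N, (sumn x + head 0%N x <= n)%N & (size x < N)%N].
  by have := head_le_sumn x; have := size_intpart_le x; split; lia.
have [la_n la_head_n la_N] := small _ (leq_addr _ _ : (sumn la <= s0)%N).
have al_n : (sumn al <= n)%N by rewrite /s0 in s0_n; lia.
rewrite (chi_padded la_head_n n_gt0 la_N).
transitivity ((word_char n L (nth 0%N (padded n al)) *
  schur_char n N (nth 0%N (padded n la))) s); first by rewrite [RHS]cfunE.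
rewrite word_schur_mul ?sum_padded //; last first.
  exact/is_part_nonincreasing/is_part_padded.
rewrite sum_cfunE sum_kronecker_behead_shape -/s0 //; last by lia.
apply: eq_big_seq => x; rewrite mem_parts ltnS => /small[_ x_n xN].
have xM : (size x < L * N)%N.
  by apply: leq_trans xN (leq_pmull N _); apply: leq_trans al_L.
rewrite (chi_padded x_n n_gt0 xM) mulr_natl -sumr_const; apply: eq_bigr => c.
by rewrite inE => /andP[_ shape_c]; rewrite (eq_schur_char _ shape_c).
Qed.

Lemma partition_of_padded n (al : seq nat) (mu : intpart)
    (padded_part : is_part (padded n mu)) :
  0%N \notin al -> perm_eq mu al -> partition_of (padded n al) = IntPart padded_part.
Proof.
move=> al_gt0 mu_al; apply/eqP; rewrite partition_ofE /padded -(perm_sumn mu_al) /=.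
have -> : filter (leq 1) al = al.
  by apply/all_filterP/allP => x x_al; rewrite lt0n; apply: contraNneq al_gt0 => <-.
have := padded_part; rewrite /is_part inE negb_or eq_sym -lt0n => /and3P[_ -> _].
by rewrite perm_cons perm_sym.
Qed.

Lemma htilde_eval (hall : {bilinear symfun -> symfun -> algC | *%R & *%R}) (htilde : symfun)
    n (nu mu : intpart) (al : seq nat) (s : 'S_n) :
  is_hall hall -> is_htilde hall mu htilde -> 0%N \notin al -> perm_eq mu al ->
  (0 < n)%N -> (sumn mu + head 0%N mu <= n)%N -> cycle_type s = nu -> sumn nu = n ->
  sf_eval htilde (Xi nu) = word_char n (size al).+1 (nth 0%N (padded n al)) s.
Proof.
move=> hallP htildeP al_gt0 mu_al n_gt0 mu_n cycle_s sum_nu.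
rewrite (htildeP n nu) //; have padded_part := is_part_padded mu_n n_gt0.
rewrite -[_ :: _]/(part_val (IntPart padded_part)) (hall_hsym hallP).
rewrite -(partition_of_padded padded_part al_gt0 mu_al) -sf_coef_partition_of.
exact: psym_coef cycle_s.
Qed.

Lemma htilde_stilde_mul (hall : {bilinear symfun -> symfun -> algC | *%R & *%R})
    (stilde htilde : intpart -> symfun) (la mu : intpart) (al : seq nat)
    (a : intpart -> nat) :
  is_hall hall -> (forall x, is_stilde x (stilde x)) -> is_htilde hall mu (htilde mu) ->
  0%N \notin al -> perm_eq mu al ->
  (forall (x : intpart) n, (sumn x <= sumn la + sumn al)%N ->
     (3 * (sumn la + sumn al) < n)%N ->
     a x = #|kronecker_arrays n (size al).+1 (sumn la + sumn al).+1 la al x|) ->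
  htilde mu * stilde la = \sum_(x <- parts (sumn la + sumn al).+1) (a x)%:R *: stilde x.
Proof.
set s0 := (sumn la + sumn al)%N => hallP stildeP htildeP al_gt0 mu_al count_a.
apply/eqP; rewrite -subr_eq0; apply/eqP.
apply: (sf_separation (m0 := (3 * s0).+1) hallP) => nu nu_part nu_n.
have [s cycle_s] := exists_cycle_type (IntPart nu_part).
set n := sumn _ in s cycle_s; have n_gt0 : (0 < n)%N by apply: leq_trans nu_n.
have small (x : intpart) : (sumn x <= s0)%N -> (sumn x + head 0%N x <= n)%N.
  by have := head_le_sumn x; move: nu_n; rewrite -/n; lia.
have mu_n : (sumn mu + head 0%N mu <= n)%N.
  by apply: small; rewrite (perm_sumn mu_al) leq_addl.
rewrite sf_evalB sf_evalM sf_eval_sum -[nu]/(part_val (IntPart nu_part)).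
rewrite (htilde_eval hallP htildeP al_gt0 mu_al n_gt0 mu_n cycle_s) //.
rewrite (stildeP la n _ s) ?small ?leq_addr //.
rewrite (word_chi_mul s (N := s0.+1)) //; last by move: nu_n; rewrite -/n /s0; lia.
apply/eqP; rewrite subr_eq0; apply/eqP; apply: eq_big_seq => x; rewrite mem_parts => x_s0.
by rewrite sf_evalZ (stildeP x n _ s) ?small // (count_a x n).
Qed.

Lemma coef_in_unique (b : intpart -> symfun) f (G : seq intpart) (a : intpart -> algC) ga t :
  linearly_independent b -> uniq G ->
  f = \sum_(x <- G) a x *: b x -> (forall x, x \notin G -> a x = 0) ->
  coef_in b f ga t <-> t = a ga.
Proof.
move=> free_b uniq_G expand_f a_out.
pose a0 : {fsfun intpart -> algC with 0} := [fsfun x in [fset x in G]%fset => a x].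
have a0E x : a0 x = a x by rewrite fsfunE inE; case: ifP => // /negbT/a_out.
have widen (c : {fsfun intpart -> algC with 0}) (A : {fset intpart}) :
    (finsupp c `<=` A)%fset ->
    \sum_(x <- finsupp c) c x *: b x = \sum_(x <- A) c x *: b x.
  by move=> c_A; apply: big_fset_incl => // x _ x_c; rewrite fsfun_dflt // scale0r.
have expand_a0 : f = \sum_(x <- finsupp a0) a0 x *: b x.
  rewrite (widen _ [fset x in G]%fset); last first.
    apply/fsubsetP => x; rewrite mem_finsupp a0E inE.
    by apply: contraNT => /a_out ->.
  rewrite expand_f; under [RHS]eq_bigr => x _ do rewrite a0E.
  by apply: perm_big; apply: uniq_perm; rewrite ?fset_uniq // => x; rewrite inE.
split=> [[c [expand_c <-]]|->]; last by exists a0; split; rewrite ?a0E.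
pose A := (finsupp c `|` finsupp a0)%fset.
have relation : \sum_(x <- A) (c x - a0 x) *: b x = 0.
  under eq_bigr => x _ do rewrite scalerBl.
  rewrite sumrB -(widen c) ?fsubsetUl // -(widen a0) ?fsubsetUr //.
  by rewrite -expand_c -expand_a0 subrr.
rewrite -a0E; have [ga_A|] := boolP (ga \in A).
  by have /eqP := free_b _ _ (fset_uniq A) relation ga ga_A; rewrite subr_eq0 => /eqP.
by rewrite inE negb_or => /andP[ga_c ga_a0]; rewrite !fsfun_dflt.
Qed.

Lemma lattice_tableaux_fset (la : intpart) (al : seq nat) (ga : intpart) :
  exists S : {fset tableau}, (forall T, T \in S <-> lattice_tableau la al ga T) /\
  ((sumn ga <= sumn la + sumn al)%N ->
   forall n, (3 * (sumn la + sumn al) < n)%N ->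
   #|` S| = #|kronecker_arrays n (size al).+1 (sumn la + sumn al).+1 la al ga|).
Proof.
set s0 := (sumn la + sumn al)%N; have [ga_s0|s0_ga] := leqP (sumn ga) s0; last first.
  exists fset0; split=> // T; rewrite in_fset0; split=> // /lattice_tableau_sumn.
  by rewrite leqNgt s0_ga.
have count n : (3 * s0 < n)%N -> exists S : {fset tableau},
    (forall T, T \in S <-> lattice_tableau la al ga T) /\
    #|` S| = #|kronecker_arrays n (size al).+1 s0.+1 la al ga|.
  move=> s0_n; have [size_ga size_la] := (size_intpart_le ga, size_intpart_le la).
  by apply: card_lattice_tableaux; rewrite ?intpartP //; rewrite /s0 in ga_s0 s0_n *; nia.
have [S [memS _]] := count (3 * s0).+1 (ltnSn _); exists S; split=> // _ n.
case/count=> S' [memS' <-]; congr (#|` _|); apply/fsetP => T.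
by apply/idP/idP => [/memS/memS'|/memS'/memS].
Qed.

Theorem mainTheorem4
  (hall : {bilinear symfun -> symfun -> algC | *%R & *%R})
  (hallP : is_hall hall)
  (stilde htilde : intpart -> symfun)
  (stildeP : forall la : intpart, is_stilde la (stilde la))
  (htildeP : forall la : intpart, is_htilde hall la (htilde la))
  (la ga mu : intpart) (al : seq nat)
  (al_comp : 0%N \notin al)
  (mu_sort : mu = sort geq al :> seq nat) :
  exists S : {fset tableau},
    (forall T : tableau,
       T \in S <->
       [/\ is_mct ga la al T, all (all set_label) T & is_lattice T]) /\
    (forall a : algC,
       coef_in stilde (htilde mu * stilde la) ga a <-> a = #|` S|%:R).
Proof.
have mu_al : perm_eq mu al by rewrite mu_sort perm_sort.
have /choice[tableaux tableauxP] := lattice_tableaux_fset la al.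
exists (tableaux ga); split=> [|a]; first by case: (tableauxP ga).
apply: (coef_in_unique _ _ (stilde_linearly_independent stildeP) (parts_uniq _)
  (a := fun x => #|` tableaux x|%:R)).
- apply: htilde_stilde_mul (htildeP mu) al_comp mu_al _ => // x n x_small n_large.
  by have [_ card_tableaux] := tableauxP x; apply: card_tableaux.
move=> x; rewrite mem_parts -leqNgt => x_large; apply/eqP; rewrite pnatr_eq0 cardfs_eq0.
have [mem_tableaux _] := tableauxP x; apply/negPn/negP => /fset0Pn[T].
by move/mem_tableaux/lattice_tableau_sumn; rewrite leqNgt x_large.
Qed.
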